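(* Let $(K,v)$ be a henselian field. The following are equivalent: (1) $(K,v)$ is a defectless field; (2) for some (equivalently, every) tame extension $(N|K,v)$, $(N,v)$ is a defectless field; (3) $(K^r,v)$ is a defectless field; (4) every finite purely wild extension of $(K,v)$ is defectless; (5) every maximal purely wild extension of $(K,v)$ is defectless. The same equivalences hold if ''defectless field'' is replaced by ''separably defectless field'' in (1), (2), (3) and ''purely wild extension'' is replaced by ''separable purely wild extension'' in (4) and (5).
   Context: Henselian: $v$ extends uniquely to every algebraic extension. Let $p$ be the characteristic exponent of the residue field $Kv$. A finite extension $(E|K,v)$ of a henselian field is defectless if $[E:K]=(vE:vK)[Ev:Kv]$; an arbitrary algebraic extension is defectless if all its finite subextensions are; a field is (separably) defectless if every finite (separable) extension is defectless. An algebraic extension $(L|K,v)$ of a henselian field is tame if every finite subextension $E|K$ satisfies: $(vE:vK)$ prime to $p$, $Ev|Kv$ separable, and $E|K$ defectless. An algebraic extension of a henselian field is purely wild if it is linearly disjoint over $K$ from every tame extension. $K^r$ denotes the ramification field of the normal extension $(K^{sep}|K,v)$ (the unique maximal tame extension of $(K,v)$). *)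

(* Defs.v *)
(* Valuation theory of (possibly infinite) algebraic
   extensions of a henselian field, modelled inside a fixed algebraically
   closed field Omega carrying a valuation ring O (the unique extension of v)
   and a residue map res : Omega -> kappa. *)
From mathcomp Require Import all_boot all_order all_algebra.
From mathcomp Require Import all_field.
Set Implicit Arguments. Unset Strict Implicit. Unset Printing Implicit Defensive.
Import GRing.Theory.
Local Open Scope ring_scope.

Section Generic.
Variable L : fieldType.

Definition subset (E F : L -> Prop) := forall x, E x -> F x.

Definition is_subfield (E : L -> Prop) :=
  [/\ E 0, E 1,
      (forall x y, E x -> E y -> E (x - y)),
      (forall x y, E x -> E y -> E (x * y)) &
      (forall x, E x -> x != 0 -> E x^-1)].

Definition lin_indep (E : L -> Prop) (s : seq L) :=
  forall c : seq L, size c = size s -> (forall i, E c`_i) ->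
    \sum_(i < size s) c`_i * s`_i = 0 -> forall i, c`_i = 0.

Definition spans (E F : L -> Prop) (s : seq L) :=
  forall x, F x -> exists c : seq L, size c = size s /\ (forall i, E c`_i) /\
    x = \sum_(i < size s) c`_i * s`_i.

Definition degree_eq (E F : L -> Prop) (n : nat) :=
  exists s : seq L, [/\ size s = n, (forall x, x \in s -> F x),
                        lin_indep E s & spans E F s].

Definition finite_ext (E F : L -> Prop) :=
  [/\ is_subfield E, is_subfield F, subset E F & exists n, degree_eq E F n].

Definition poly_over (E : L -> Prop) (p : {poly L}) := forall i, E p`_i.

Definition algebraic_ext (E F : L -> Prop) :=
  [/\ is_subfield E, is_subfield F, subset E F &
      forall x, F x -> exists p : {poly L}, [/\ p != 0, poly_over E p & root p x]].

Definition separable_ext (E F : L -> Prop) :=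
  [/\ is_subfield E, is_subfield F, subset E F &
      forall x, F x -> exists p : {poly L},
        [/\ poly_over E p, separable_poly p & root p x]].

Definition lin_disjoint (K E F : L -> Prop) :=
  forall s : seq L, (forall x, x \in s -> E x) -> lin_indep K s -> lin_indep F s.

Definition is_valuation_ring (F R : L -> Prop) :=
  subset R F /\
  [/\ R 0, R 1,
      (forall x y, R x -> R y -> R (x - y)),
      (forall x y, R x -> R y -> R (x * y)) &
      (forall x, F x -> x != 0 -> R x \/ R x^-1)].
End Generic.

Section Valued.
Variables (Om : closedFieldType) (O : Om -> Prop) (kappa : fieldType)
          (res : Om -> kappa).

Definition unitO (x : Om) := [/\ O x, x != 0 & O x^-1].

Definition is_residue_map :=
  [/\ (forall x y, O x -> O y -> res (x + y) = res x + res y),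
      (forall x y, O x -> O y -> res (x * y) = res x * res y),
      res 1 = 1,
      (forall a, exists x, O x /\ res x = a) &
      (forall x, O x -> (res x = 0 <-> ~ unitO x))].

Definition resf (E : Om -> Prop) : kappa -> Prop :=
  fun a => exists x, [/\ E x, O x & res x = a].

(* x and y (nonzero) have the same value modulo vE *)
Definition same_class (E : Om -> Prop) (x y : Om) :=
  exists e, [/\ E e, e != 0 & unitO (x / (y * e))].

Definition vindex_eq (E F : Om -> Prop) (n : nat) :=
  exists s : seq Om,
    [/\ size s = n, (forall x, x \in s -> F x /\ x != 0),
        (forall i j, (i < n)%N -> (j < n)%N -> same_class E s`_i s`_j -> i = j) &
        (forall x, F x -> x != 0 -> exists2 y, y \in s & same_class E x y)].

Definition henselian (K : Om -> Prop) :=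
  forall L R, algebraic_ext K L -> is_valuation_ring L R ->
    (forall x, K x -> (R x <-> O x)) -> forall x, L x -> (R x <-> O x).

Definition defectless_fin (E F : Om -> Prop) :=
  exists n e f, [/\ degree_eq E F n, vindex_eq E F e,
                    degree_eq (resf E) (resf F) f & n = (e * f)%N].

Definition defectless_ext (E F : Om -> Prop) :=
  algebraic_ext E F /\
  forall M, finite_ext E M -> subset M F -> defectless_fin E M.

Definition defectless_field (E : Om -> Prop) :=
  forall F, finite_ext E F -> defectless_fin E F.

Definition sep_defectless_field (E : Om -> Prop) :=
  forall F, finite_ext E F -> separable_ext E F -> defectless_fin E F.

(* e prime to the characteristic exponent of kappa (= that of Kv) *)
Definition prime_to_charexp (e : nat) :=
  forall q, q \in [pchar kappa] -> ~~ (q %| e)%N.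

Definition tame_ext (E T : Om -> Prop) :=
  algebraic_ext E T /\
  forall M, finite_ext E M -> subset M T ->
    [/\ (forall e, vindex_eq E M e -> prime_to_charexp e),
        separable_ext (resf E) (resf M) & defectless_fin E M].

Definition purely_wild_ext (E W : Om -> Prop) :=
  algebraic_ext E W /\ forall T, tame_ext E T -> lin_disjoint E W T.

Definition max_purely_wild_ext (E W : Om -> Prop) :=
  purely_wild_ext E W /\
  forall W', purely_wild_ext E W' -> subset W W' -> subset W' W.

Definition max_sep_purely_wild_ext (E W : Om -> Prop) :=
  (purely_wild_ext E W /\ separable_ext E W) /\
  forall W', purely_wild_ext E W' -> separable_ext E W' -> subset W W' ->
    subset W' W.

(* K^r: the maximal tame extension of E inside Om (union of all tame ones) *)
Definition Kr (E : Om -> Prop) : Om -> Prop :=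
  fun x => exists T, tame_ext E T /\ T x.
End Valued.

(* Main.v *)
(* Tame extensions do not change the defect: a finite extension of a field N between K and K^r is
   already defined over a finite subextension T of N, and T|K is defectless. This gives the equivalence
   of (1), (2) and (3), while (1) => (4) => (5) is immediate.

   For (5) => (1), let W be a maximal purely wild extension. Since W|K is defectless, it is enough that
   the field W is defectless, and by maximality W has no proper finite purely wild extension. If some
   separable x were not in W^r, let L be its Galois closure over W, with group G, ramification group
   P <> 1 (a p-group) and V = P/Phi(P). The extension of G/P by V need not split, but it does after
   tensoring V with the residue field of L, because O_L contains an element whose trace over G/P has
   residue 1. Artin-Schreier roots turn the splitting into a crossed homomorphism to V, on the Galois
   group of a larger extension M, which restricts on the ramification group of M to the projection
   onto V. The fixed field of its kernel is a proper purely wild extension of W, a contradiction. So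
   every finite separable extension of W is tame, hence defectless; when inseparable extensions are
   allowed, W is moreover perfect. *)
From HB Require Import structures.
Require Import Defs.
From mathcomp Require Import all_boot all_order all_algebra all_field.
From mathcomp Require Import all_fingroup all_solvable all_character.
From mathcomp Require classical_sets.
From mathcomp Require Import boolp ring.
Import Defs.
Set Implicit Arguments. Unset Strict Implicit. Unset Printing Implicit Defensive.
Import GRing.Theory GroupScope.
Local Open Scope ring_scope.

(** * Subfields as predicates: linear algebra and separability *)

(** One dichotomy carries the valuation theory. An element is a tame generator ([telt]) if it is a
    simple root modulo the maximal ideal of an integral polynomial, or a radical of exponent prime
    to the residue characteristic. By Hensel's lemma, an extension without new elements of this kind
    is purely wild in the elementwise sense of [pw] ([pw_lemma]). This one statement decomposes
    finite tame extensions into simple steps, turns linear disjointness into conditions on values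
    and residues, describes the ramification group by 1-units, and shows that the fixed field of the
    kernel is purely wild. The last step must also work in mixed characteristic. The valuation ring
    then does not contain F_p, so the cocycle identities hold only for residues, while the Galois
    group acts on the ring. Hence all cocycles are computed with lifts and compared through the
    residue map. *)

Record subfld (L : fieldType) :=
  Subfld { sf_pred : L -> Prop; sf_ok : is_subfield sf_pred }.

Definition sf_mem (L : fieldType) (E : subfld L) : {pred L} :=
  fun x => `[< sf_pred E x >].

Lemma sf_memP (L : fieldType) (E : subfld L) x : reflect (sf_pred E x) (x \in sf_mem E).
Proof. exact: asboolP. Qed.

Lemma sf_divring_closed (L : fieldType) (E : subfld L) : divring_closed (sf_mem E).
Proof.
have [E0 E1 EB EM EV] := sf_ok E.
split; first exact/sf_memP.
  by move=> x y /sf_memP Ex /sf_memP Ey; apply/sf_memP/EB.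
move=> x y /sf_memP Ex /sf_memP Ey; apply/sf_memP.
have [->|y0] := eqVneq y 0; first by rewrite invr0 mulr0.
by apply: EM => //; apply: EV.
Qed.

HB.instance Definition _ (L : fieldType) (E : subfld L) :=
  GRing.isDivringClosed.Build L (sf_mem E) (sf_divring_closed E).

Record sftype (L : fieldType) (E : subfld L) :=
  SfType { sfval :> L; sfvalP : sfval \in sf_mem E }.

HB.instance Definition _ (L : fieldType) (E : subfld L) := [isSub for @sfval L E].
HB.instance Definition _ (L : fieldType) (E : subfld L) := [Choice of sftype E by <:].
HB.instance Definition _ (L : fieldType) (E : subfld L) :=
  [SubChoice_isSubIntegralDomain of sftype E by <:].
HB.instance Definition _ (L : fieldType) (E : subfld L) :=
  [SubIntegralDomain_isSubField of sftype E by <:].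

Lemma sfval_sum (L : fieldType) (E : subfld L) (I : Type) (r : seq I) (P : pred I)
  (f : I -> sftype E) : sfval (\sum_(i <- r | P i) f i) = \sum_(i <- r | P i) sfval (f i).
Proof. exact: (raddf_sum (val : {additive sftype E -> L})). Qed.

(* [fext h] is F as a [fieldExtType] over [sftype K]; this is how subfields given by predicates
   are handed to the library's theory of separable and Galois extensions. *)
Section FinExt.
Variables (L : fieldType) (K F : subfld L) (n : nat).
Record finext_data := FinextData {
  fed_sub : subset (sf_pred K) (sf_pred F);
  fed_deg : degree_eq (sf_pred K) (sf_pred F) n }.
Variable h : finext_data.

Definition fext of finext_data := sftype F.
Local Notation FT := (fext h).
HB.instance Definition _ := GRing.Field.on FT.

Definition fscale (a : sftype K) (x : FT) : FT :=
  SfType (introT (sf_memP F _) (fed_sub h (elimT (sf_memP K _) (sfvalP a)))) * (x : sftype F).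

Fact fscaleA a b x : fscale a (fscale b x) = fscale (a * b) x.
Proof. by apply: val_inj; rewrite /= mulrA. Qed.
Fact fscale1 : left_id 1 fscale.
Proof. by move=> x; apply: val_inj; rewrite /= mul1r. Qed.
Fact fscaleDr : right_distributive fscale +%R.
Proof. by move=> a x y; apply: val_inj; rewrite /= mulrDr. Qed.
Fact fscaleDl x : {morph fscale^~ x : a b / a + b}.
Proof. by move=> a b; apply: val_inj; rewrite /= mulrDl. Qed.
HB.instance Definition _ := GRing.Zmodule_isLmodule.Build _ FT fscaleA fscale1 fscaleDr fscaleDl.
Fact fscaleAl a (x y : FT) : a *: (x * y) = a *: x * y.
Proof. by apply: val_inj; rewrite /= mulrA. Qed.
HB.instance Definition _ := GRing.Lmodule_isLalgebra.Build _ FT fscaleAl.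
Fact fscaleAr a (x y : FT) : a *: (x * y) = x * (a *: y).
Proof. by apply: val_inj; rewrite /= mulrCA. Qed.
HB.instance Definition _ := GRing.Lalgebra_isAlgebra.Build _ FT fscaleAr.

Fact fext_vect : Lmodule_hasFinDim (sftype K) FT.
Proof.
have /cid[s [ss sF si sg]] := fed_deg h.
have sP (i : 'I_n) : s`_i \in sf_mem F by apply/sf_memP/sF/mem_nth; rewrite ss.
pose b i : FT := SfType (sP i).
pose r2v (v : 'rV[sftype K]_n) : FT := \sum_i v 0 i *: b i.
have r2v_lin: linear r2v.
  move=> a u v; rewrite /r2v scaler_sumr -big_split /=; apply: eq_bigr => i _.
  by rewrite scalerA -scalerDl !mxE.
pose r2vlM := GRing.isLinear.Build _ _ _ _ r2v r2v_lin.
pose r2vL : {linear _ -> _} := HB.pack r2v r2vlM.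
have val_r2v v : val (r2v v : sftype F) = \sum_(i < n) val (v 0 i) * s`_i.
  by rewrite /r2v (raddf_sum (val : {additive sftype F -> L})).
have v2rP (x : FT): {r : 'rV[sftype K]_n | x = r2v r}.
  apply: cid; have [c [sc [Kc xE]]] := sg _ (elimT (sf_memP F _) (sfvalP x)).
  exists (\row_i SfType (introT (sf_memP K _) (Kc i))).
  apply: val_inj; rewrite /= val_r2v xE ss; apply: eq_bigr => i _.
  by rewrite mxE.
pose v2r x := sval (v2rP x).
have v2rK: cancel v2r r2vL by rewrite /v2r => x; case: (v2rP x).
suffices r2vK: cancel r2v v2r.
  by exists n, v2r; [apply: can2_linear v2rK | exists r2v].
move=> r; apply/eqP; rewrite -subr_eq0; apply/eqP.
set u := v2r _ - r; have u0 : r2v u = 0.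
  have /= e := v2rK (r2v r); by rewrite -[r2v _]/(r2vL _) /u raddfB /= e subrr.
apply/rowP=> i; have -> : (0 : 'rV[sftype K]_n) 0 i = 0 by rewrite mxE.
apply: val_inj; rewrite /=.
pose c := mkseq (fun i => if insub i is Some j then val (u 0 j) else 0) n.
have ci (j : 'I_n) : c`_j = val (u 0 j) by rewrite nth_mkseq // valK.
rewrite -ci; apply: si; first by rewrite size_mkseq ss.
  move=> k; have [kn|kn] := ltnP k n.
    by rewrite (ci (Ordinal kn)); apply/sf_memP; apply: sfvalP.
  by rewrite nth_default ?size_mkseq //; have [] := sf_ok K.
transitivity (val (r2v u : sftype F)); last by rewrite u0.
by rewrite val_r2v ss; apply: eq_bigr => j _; rewrite ci.
Qed.
HB.instance Definition _ := fext_vect.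
HB.instance Definition _ := Algebra_isFalgebra.Build (sftype K) FT.
End FinExt.

Section SubfieldFacts.
Variables (L : fieldType) (E : L -> Prop).
Hypothesis hE : is_subfield E.
Let h0 : E 0. Proof. by case: hE. Qed.
Let h1 : E 1. Proof. by case: hE. Qed.
Lemma sf0 : E 0. Proof. exact: h0. Qed.
Lemma sf1 : E 1. Proof. exact: h1. Qed.
Lemma sfB x y : E x -> E y -> E (x - y). Proof. by case: hE => _ _ + _ _; exact. Qed.
Lemma sfM x y : E x -> E y -> E (x * y). Proof. by case: hE => _ _ _ + _; exact. Qed.
Lemma sfN x : E x -> E (- x). Proof. by move=> Ex; rewrite -sub0r; apply: sfB. Qed.
Lemma sfD x y : E x -> E y -> E (x + y).
Proof. by move=> Ex Ey; rewrite -[y]opprK; apply/sfB/sfN. Qed.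
Lemma sfV x : E x -> E x^-1.
Proof.
move=> Ex; have [->|x0] := eqVneq x 0; first by rewrite invr0.
by case: hE => _ _ _ _; apply.
Qed.
Lemma sf_div x y : E x -> E y -> E (x / y).
Proof. by move=> Ex Ey; apply/sfM/sfV. Qed.
Lemma sfX x n : E x -> E (x ^+ n).
Proof. by move=> Ex; elim: n => [|n IH]; rewrite ?expr0 ?exprS //; apply: sfM. Qed.
Lemma sf_sum (I : Type) (r : seq I) (P : pred I) (f : I -> L) :
  (forall i, P i -> E (f i)) -> E (\sum_(i <- r | P i) f i).
Proof. by move=> Ef; elim/big_rec: _ => // i x Pi Ex; apply: sfD => //; apply: Ef. Qed.
Lemma sf_nat n : E n%:R.
Proof. by elim: n => [|n IH]; rewrite ?mulr0n // mulrS; apply: sfD. Qed.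
Lemma sf_lift x : E x -> exists y : sftype (Subfld hE), val y = x.
Proof. by move=> Ex; exists (SfType (introT (sf_memP (Subfld hE) x) Ex)). Qed.
Lemma sf_down (y : sftype (Subfld hE)) : E (val y).
Proof. by have /sf_memP := sfvalP y. Qed.
End SubfieldFacts.

Lemma sum_option (V : nmodType) (I : finType) (F : option I -> V) :
  \sum_o F o = F None + \sum_i F (Some i).
Proof.
rewrite (bigD1 None) //=; congr (_ + _).
rewrite (reindex_omap (@Some I) id) /=; last by case.
by apply: eq_bigl => i; rewrite eqxx.
Qed.

Lemma sum_unit (V : nmodType) (F : unit -> V) : \sum_i F i = F tt.
Proof. by rewrite (bigD1 tt) //= big1 ?addr0 // => -[]. Qed.

Lemma sum_pair (V : nmodType) (I J : finType) (F : I * J -> V) :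
  \sum_ij F ij = \sum_j \sum_i F (i, j).
Proof. by rewrite exchange_big pair_bigA; apply: eq_bigr => -[]. Qed.

(** * Bases, spans and degrees over a subfield *)

Section Lin.
Variable L : fieldType.
Implicit Types (E F M K : L -> Prop) (I J : finType).

(** Families indexed by finite types replace the lists of the definitions: [option I] adds a vector,
    [I * J] indexes the products in a tower, and cardinals give the degrees. *)
Definition indep E I (v : I -> L) :=
  forall c : I -> L, (forall i, E (c i)) -> \sum_i c i * v i = 0 -> forall i, c i = 0.

Definition span E I (v : I -> L) (x : L) :=
  exists2 c : I -> L, (forall i, E (c i)) & x = \sum_i c i * v i.

Definition basis E F I (v : I -> L) :=
  [/\ forall i, F (v i), indep E v & forall x, F x -> span E v x].

Lemma indepS E E' I (v : I -> L) : Defs.subset E E' -> indep E' v -> indep E v.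
Proof. by move=> sE iv c Ec; apply: iv => i; apply: sE. Qed.

Lemma spanS E E' I (v : I -> L) x : Defs.subset E E' -> span E v x -> span E' v x.
Proof. by move=> sE [c Ec ->]; exists c => // i; apply: sE. Qed.

Section OverE.
Variable E : L -> Prop.
Hypothesis hE : is_subfield E.

Lemma span_mem I (v : I -> L) i : span E v (v i).
Proof.
exists (fun j => (j == i)%:R) => [j|]; first exact: sf_nat.
by rewrite (bigD1 i) //= eqxx mul1r big1 ?addr0 // => j /negPf->; rewrite mul0r.
Qed.

Lemma span0 I (v : I -> L) : span E v 0.
Proof. by exists (fun=> 0) => [i|]; [apply: sf0 | rewrite big1 // => i; rewrite mul0r]. Qed.

Lemma spanD I (v : I -> L) x y : span E v x -> span E v y -> span E v (x + y).
Proof.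
move=> [c Ec ->] [d Ed ->]; exists (fun i => c i + d i) => [i|]; first exact: sfD.
by rewrite -big_split; apply: eq_bigr => i _; rewrite mulrDl.
Qed.

Lemma spanZ I (v : I -> L) a x : E a -> span E v x -> span E v (a * x).
Proof.
move=> Ea [c Ec ->]; exists (fun i => a * c i) => [i|]; first exact: sfM.
by rewrite mulr_sumr; apply: eq_bigr => i _; rewrite mulrA.
Qed.

Lemma spanN I (v : I -> L) x : span E v x -> span E v (- x).
Proof. by move=> vx; rewrite -mulN1r; apply: spanZ vx; apply: sfN (sf1 hE). Qed.

Lemma span_sum I (v : I -> L) (T : Type) (r : seq T) (P : pred T) (f : T -> L) :
  (forall i, P i -> span E v (f i)) -> span E v (\sum_(i <- r | P i) f i).
Proof.
move=> Ef; elim/big_rec: _ => [|i x Pi Ex]; first exact: span0.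
by apply: spanD => //; apply: Ef.
Qed.

Lemma span_trans I J (v : I -> L) (w : J -> L) x :
  (forall i, span E w (v i)) -> span E v x -> span E w x.
Proof. by move=> vw [c Ec ->]; apply: span_sum => i _; apply: spanZ. Qed.

(** Steinitz bound: if [I] were larger, the matrix writing [v] in terms of [w] would have more rows
    than columns, and a nonzero vector of its left kernel would be a relation between the [v i]. *)
Lemma indep_leq_span I J (v : I -> L) (w : J -> L) :
  indep E v -> (forall i, span E w (v i)) -> (#|I| <= #|J|)%N.
Proof.
move=> iv vw; rewrite leqNgt; apply/negP => ltJI.
pose ET := sftype (Subfld hE).
have aP i : exists a : J -> ET, v i = \sum_j val (a j) * w j.
  have [c Ec ->] := vw i; have /choice[a aE] j := sf_lift hE (Ec j).
  by exists a; apply: eq_bigr => j _; rewrite aE.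
have {aP} /choice[a vE] := aP.
pose A : 'M[ET]_(#|I|, #|J|) := \matrix_(i, j) a (enum_val i) (enum_val j).
have /rowV0Pn[u /sub_kermxP uA u0] : kermx A != 0.
  by rewrite kermx_eq0 neq_ltn (leq_ltn_trans (rank_leq_col A)).
have [k uk] : exists k, u 0 k != 0.
  apply: contrapT => nk; case/negP: u0; apply/eqP/rowP => k; rewrite [RHS]mxE.
  by apply: contrapT => /eqP uk; apply: nk; exists k.
case/negP: uk; have := iv (fun i => val (u 0 (enum_rank i))).
move=> /(_ (fun i => sf_down _)) h; apply/eqP/val_inj.
rewrite -[k]enum_valK; apply: h.
under eq_bigr do rewrite vE mulr_sumr.
rewrite exchange_big big1 //= => j _.
have /rowP/(_ (enum_rank j)) := uA; rewrite !mxE => /(congr1 (@sfval _ _)).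
rewrite sfval_sum /= => e.
under eq_bigr do rewrite mulrA.
rewrite -mulr_suml (reindex (enum_val : 'I_#|I| -> I)) /=; last first.
  by apply: onW_bij; apply: enum_val_bij.
suff -> : \sum_(i < #|I|) val (u 0 (enum_rank (enum_val i))) * val (a (enum_val i) j) = 0.
  by rewrite mul0r.
rewrite -[RHS]e; apply: eq_bigr => i _.
by rewrite enum_valK !mxE enum_rankK.
Qed.

Lemma indep_option I (v : I -> L) x : indep E v -> ~ span E v x ->
  indep E (fun o : option I => if o is Some i then v i else x).
Proof.
move=> iv nx c Ec; rewrite sum_option => s0.
have c0 : c None = 0.
  apply: contrapT => /eqP c0; apply: nx.
  exists (fun i => - (c None)^-1 * c (Some i)) => [i|].
    by apply: sfM => //; apply: sfN => //; apply: sfV.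
  apply: (mulfI c0); rewrite mulr_sumr; move/eqP: s0; rewrite addr_eq0 => /eqP->.
  rewrite -sumrN; apply: eq_bigr => i _.
  by rewrite !mulrA mulrN divff // mulN1r mulNr.
move: s0; rewrite c0 mul0r add0r => s0; case=> [i|//].
exact: (iv (fun i => c (Some i))).
Qed.

Lemma basis_exists F n :
  (forall I (v : I -> L), (forall i, F (v i)) -> indep E v -> (#|I| <= n)%N) ->
  exists I, exists v : I -> L, basis E F v.
Proof.
move=> bd; pose Q m := exists I, exists2 v : I -> L, #|I| = m & (forall i, F (v i)) /\ indep E v.
have Q0 : exists m, `[< Q m >].
  by exists 0%N; apply/asboolP; exists 'I_0, (fun=> 0); [rewrite card_ord | split=> [[]|c _ _ []]].
have Qle m : `[< Q m >] -> (m <= n)%N by move/asboolP => [I [v <- [Fv iv]]]; apply: bd iv.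
case: (ex_maxnP Q0 Qle) => m /asboolP[I [v cI [Fv iv]]] mmax.
exists I, v; split=> // x Fx; apply: contrapT => nx.
have := mmax m.+1; rewrite ltnn => h; suff: false by [].
apply: h; apply/asboolP; exists (option I).
exists (fun o : option I => if o is Some i then v i else x); first by rewrite card_option cI.
by split; [case | apply: indep_option].
Qed.

Lemma basis_card F I J (v : I -> L) (w : J -> L) : basis E F v -> basis E F w -> #|I| = #|J|.
Proof.
move=> [Fv iv sv] [Fw iw sw]; apply/eqP; rewrite eqn_leq; apply/andP; split.
  by apply: indep_leq_span iv _ => i; apply: sw.
by apply: indep_leq_span iw _ => i; apply: sv.
Qed.
End OverE.

Lemma span1_gt0 E I (v : I -> L) : span E v 1 -> (0 < #|I|)%N.
Proof.
move=> [c _ /eqP]; rewrite lt0n; apply: contraTneq => /card0_eq I0.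
by rewrite big1 ?oner_eq0 // => i; have := I0 i.
Qed.

Lemma basis_reindex E F I J (v : I -> L) (f : J -> I) :
  bijective f -> basis E F v -> basis E F (v \o f).
Proof.
move=> bf [Fv iv sv]; have [g fg gf] := bf; split => [j|c Ec|x /sv[c Ec ->]] /=.
- exact: Fv.
- move=> s0 j; rewrite -[j]fg; apply: (iv (c \o g)) => [i|]; first exact: Ec.
  by rewrite (reindex f) /=; [under eq_bigr do rewrite fg | apply: onW_bij].
- exists (c \o f) => [j|]; first exact: Ec.
  by rewrite (reindex f) //=; apply: onW_bij.
Qed.

Lemma degreeP E F n : is_subfield E ->
  degree_eq E F n <-> exists v : 'I_n -> L, basis E F v.
Proof.
move=> hE; pose nc (c : 'I_n -> L) := mkseq (fun i => if insub i is Some j then c j else 0) n.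
have ncE c (j : 'I_n) : (nc c)`_j = c j by rewrite nth_mkseq // valK.
have Enc c : (forall i, E (c i)) -> forall i, E (nc c)`_i.
  move=> Ec k; have [kn|kn] := ltnP k n; first by rewrite (ncE c (Ordinal kn)).
  by rewrite nth_default ?size_mkseq //; apply: sf0.
split=> [[s [ss sF si sg]]|[v [Fv iv sv]]].
  exists (fun i : 'I_n => s`_i); split=> [i|c Ec s0 i|x /sg[c [sc [Ec ->]]]].
  - by apply/sF/mem_nth; rewrite ss.
  - rewrite -ncE; apply: si; [by rewrite size_mkseq ss | exact: Enc |].
    by rewrite ss -[RHS]s0; apply: eq_bigr => j _; rewrite ncE.
  - by exists (fun i : 'I_n => c`_i) => //; rewrite ss.
exists (nc v); split; first by rewrite size_mkseq.
- move=> x /(nthP 0)[i]; rewrite size_mkseq => lin <-; rewrite (ncE v (Ordinal lin)).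
  exact: Fv.
- rewrite /lin_indep size_mkseq => c sc Ec s0 i; have [lin|ni] := ltnP i n; last first.
    by rewrite nth_default ?sc.
  apply: (iv (fun i : 'I_n => c`_i) _ _ (Ordinal lin)) => //.
  by rewrite -[RHS]s0; apply: eq_bigr => j _; rewrite ncE.
move=> x Fx; have [c Ec ->] := sv x Fx; exists (nc c); split; rewrite !size_mkseq //; split.
  exact: Enc.
by apply: eq_bigr => j _; rewrite !ncE.
Qed.

Lemma degree_card E F I (v : I -> L) : is_subfield E -> basis E F v -> degree_eq E F #|I|.
Proof.
move=> hE bv; apply/(degreeP _ _ hE); exists (v \o enum_val).
by apply: basis_reindex bv; apply: enum_val_bij.
Qed.

Lemma degree_eqP E F n : is_subfield E -> degree_eq E F n ->
  forall I (v : I -> L), basis E F v -> #|I| = n.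
Proof.
by move=> hE /(degreeP _ _ hE)[w bw] I v bv; rewrite (basis_card hE bv bw) card_ord.
Qed.

Lemma basis_tower E F M I J (v : I -> L) (w : J -> L) :
  is_subfield E -> is_subfield F -> Defs.subset E F ->
  (forall x y, F x -> M y -> M (x * y)) ->
  basis E F v -> basis F M w -> basis E M (fun ij : I * J => v ij.1 * w ij.2).
Proof.
move=> hE hF EF FM [Fv iv sv] [Mw iw sw]; split=> [[i j]|c Ec|x Mx] /=.
- exact: FM.
- rewrite sum_pair /=.
  under eq_bigr => j _.
    under eq_bigr do rewrite mulrA. rewrite -mulr_suml. over.
  move=> s0 [i j]; apply: (iv (fun i => c (i, j))) => //.
  apply: (iw (fun j => \sum_i c (i, j) * v i)) => // k.
  by apply: (sf_sum hF) => l _; apply: sfM => //; apply: EF.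
have [c Fc ->] := sw x Mx.
have /choice[d dP] j : exists d, (forall i, E (d i)) /\ c j = \sum_i d i * v i.
  by have [d Ed ->] := sv _ (Fc j); exists d.
exists (fun ij => d ij.2 ij.1) => [[i j]|]; first by case: (dP j).
rewrite sum_pair /=.
apply: eq_bigr => j _; case: (dP j) => _ ->; rewrite mulr_suml.
by apply: eq_bigr => i _; rewrite mulrA.
Qed.

Lemma basis_sub E F M I (v : I -> L) :
  is_subfield E -> is_subfield F -> Defs.subset E F -> Defs.subset F M ->
  basis E M v ->
  (exists J, exists w : J -> L, basis E F w) /\ (exists J, exists w : J -> L, basis F M w).
Proof.
move=> hE hF EF FM [Fv iv sv]; split; apply: (@basis_exists _ _ _ #|I|) => // J w Fw iw.
  by apply: (indep_leq_span hE iw) => j; apply/sv/FM.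
by apply: (indep_leq_span hE (indepS EF iw)) => j; apply/sv.
Qed.

Lemma finite_extP E F : finite_ext E F <->
  [/\ is_subfield E, is_subfield F, Defs.subset E F & exists I, exists v : I -> L, basis E F v].
Proof.
split=> [[hE hF EF [n /(degreeP _ _ hE)[v bv]]]|[hE hF EF [I [v bv]]]].
  by split=> //; exists 'I_n, v.
by split=> //; exists #|I|; apply: degree_card bv.
Qed.

Lemma finite_ext_trans E F M : finite_ext E F -> finite_ext F M -> finite_ext E M.
Proof.
move=> /finite_extP[hE hF EF [I [v bv]]] /finite_extP[_ hM FM [J [w bw]]].
apply/finite_extP; split=> // [x /EF /FM //|].
exists (I * J)%type, (fun ij => v ij.1 * w ij.2); apply: basis_tower bv bw => //.
by move=> x y /FM Mx My; apply: sfM.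
Qed.

Lemma degree_tower E F M n m : finite_ext E F -> finite_ext F M ->
  degree_eq E F n -> degree_eq F M m -> degree_eq E M (n * m)%N.
Proof.
move=> /finite_extP[hE hF EF _] /finite_extP[_ hM FM _].
move=> /(degreeP _ _ hE)[v bv] /(degreeP _ _ hF)[w bw].
rewrite -[n in (n * _)%N]card_ord -[m in (_ * m)%N]card_ord -card_prod.
apply: degree_card (basis_tower _ _ _ _ bv bw) => //.
by move=> x y /FM Mx My; apply: sfM.
Qed.

Lemma finite_ext_sub E F M : is_subfield F -> Defs.subset E F -> Defs.subset F M ->
  finite_ext E M -> finite_ext E F /\ finite_ext F M.
Proof.
move=> hF EF FM /finite_extP[hE hM EM [I [v bv]]].
have [bF bM] := basis_sub hE hF EF FM bv.
by split; apply/finite_extP.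
Qed.

Lemma finite_ext_refl E : is_subfield E -> finite_ext E E.
Proof.
move=> hE; apply/finite_extP; split=> //; exists unit, (fun=> 1); split=> [_|c Ec|x Ex].
- exact: sf1.
- by rewrite sum_unit mulr1 => e [].
- by exists (fun=> x) => //; rewrite sum_unit mulr1.
Qed.

(** Here [A] is just a [K]-subspace. The coefficients [c i] are expanded in a [K]-basis [w] of their
    span; [w] stays independent over [B], so the relation splits into one relation over [K] among
    the [b i] for each vector of [w]. *)
Lemma linear_disjoint_sym K A B I (b : I -> L) : is_subfield K -> is_subfield B -> Defs.subset K B ->
  (forall x y, A x -> A y -> A (x + y)) -> (forall k x, K k -> A x -> A (k * x)) -> A 0 ->
  (forall J (a : J -> L), (forall j, A (a j)) -> indep K a -> indep B a) ->
  (forall i, B (b i)) -> indep K b -> indep A b.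
Proof.
move=> hK hB KB AD KA A0 dj Bb ib c Ac s0.
have [J [w [Aw iw sw]]] : exists J, exists w : J -> L, basis K (span K c) w.
  by apply: (@basis_exists _ hK _ #|I|) => J w cw iw; apply: (indep_leq_span hK iw).
have Asp x : span K c x -> A x.
  by move=> [d Kd ->]; elim/big_rec: _ => // i y _ Ay; apply: AD => //; apply: KA.
have /choice[d dP] i : exists d, (forall j, K (d j)) /\ c i = \sum_j d j * w j.
  by have [d Ed ->] := sw _ (span_mem hK c i); exists d.
have iB := dj _ w (fun j => Asp _ (Aw j)) iw.
have d0 j : \sum_i d i j * b i = 0.
  apply: (iB (fun j => \sum_i d i j * b i)) => [k|].
    apply: (sf_sum hB) => i _; apply: sfM => //; apply: KB; exact: (dP i).1.
  rewrite -[RHS]s0; under eq_bigr do rewrite mulr_suml.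
  rewrite exchange_big /=; apply: eq_bigr => i _; rewrite (dP i).2 mulr_suml.
  by apply: eq_bigr => k _; rewrite mulrAC.
move=> i; rewrite (dP i).2 big1 // => j _.
by rewrite (ib (fun i => d i j) _ (d0 j) i) ?mul0r // => k; case: (dP k).
Qed.
End Lin.

Section Polynomials.
Variables (L : fieldType) (E : L -> Prop).
Hypothesis hE : is_subfield E.
Local Notation ES := (Subfld hE).

Lemma poP p : reflect (poly_over E p) (p \is a polyOver (sf_mem ES)).
Proof.
apply: (iffP polyOverP) => h i; first exact: (elimT (sf_memP ES _) (h i)).
by apply/(sf_memP ES)/h.
Qed.

Lemma po_lift p : poly_over E p -> exists q : {poly sftype ES}, p = map_poly val q.
Proof.
move=> Ep; have /choice[c cE] i := sf_lift hE (Ep i).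
exists (\poly_(i < size p) c i); apply/polyP => i.
rewrite coef_map coef_poly; case: ltnP => [_|h]; first exact/esym/cE.
by rewrite nth_default // rmorph0.
Qed.

Lemma po_map (q : {poly sftype ES}) : poly_over E (map_poly val q).
Proof. by move=> i; rewrite coef_map; apply: sf_down. Qed.

Lemma poC c : E c -> poly_over E c%:P.
Proof. by move=> Ec i; rewrite coefC; case: eqP => // _; apply: sf0. Qed.
Lemma po1 : poly_over E 1. Proof. by apply/poP/rpred1. Qed.
Lemma poX : poly_over E 'X. Proof. by apply/poP/polyOverX. Qed.
Lemma poXn n : poly_over E 'X^n. Proof. by apply/poP/rpredX/polyOverX. Qed.
Lemma poB p q : poly_over E p -> poly_over E q -> poly_over E (p - q).
Proof. by move=> /poP Ep /poP Eq; apply/poP/rpredB. Qed.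
Lemma poM p q : poly_over E p -> poly_over E q -> poly_over E (p * q).
Proof. by move=> /poP Ep /poP Eq; apply/poP/rpredM. Qed.
Lemma poZ c p : E c -> poly_over E p -> poly_over E (c *: p).
Proof. by move=> Ec Ep i; rewrite coefZ; apply: sfM. Qed.
Lemma po_deriv p : poly_over E p -> poly_over E p^`().
Proof.
by move=> Ep i; rewrite coef_deriv -mulr_natr; apply: sfM => //; apply: sf_nat.
Qed.
Lemma po_poly n (c : nat -> L) : (forall i, (i < n)%N -> E (c i)) ->
  poly_over E (\poly_(i < n) c i).
Proof. by move=> Ec i; rewrite coef_poly; case: ifP => [/Ec|_] //; apply: sf0. Qed.
Lemma po_modp p q : poly_over E p -> poly_over E q -> poly_over E (p %% q).
Proof.
by move=> /po_lift[p0 ->] /po_lift[q0 ->]; rewrite -map_modp; apply: po_map.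
Qed.
Lemma po_divp p q : poly_over E p -> poly_over E q -> poly_over E (p %/ q).
Proof.
by move=> /po_lift[p0 ->] /po_lift[q0 ->]; rewrite -map_divp; apply: po_map.
Qed.
Lemma po_gcdp p q : poly_over E p -> poly_over E q -> poly_over E (gcdp p q).
Proof.
by move=> /po_lift[p0 ->] /po_lift[q0 ->]; rewrite -gcdp_map; apply: po_map.
Qed.
End Polynomials.

(** * Minimal polynomials and finitely generated extensions *)

Section Minpoly.
Variable L : fieldType.
Implicit Types (E F M K : L -> Prop) (a x y : L) (p q g : {poly L}).

Definition alg E a := exists p, [/\ p != 0, poly_over E p & root p a].

Definition minpoly E a g :=
  [/\ g \is monic, poly_over E g, root g a &
      forall q, poly_over E q -> root q a -> g %| q].

Definition sep E x := exists p, [/\ poly_over E p, separable_poly p & root p x].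

Definition adj E a : L -> Prop := fun x => exists2 p, poly_over E p & x = p.[a].

Definition adjs E (s : seq L) : L -> Prop := foldl adj E s.

Lemma poS E F p : Defs.subset E F -> poly_over E p -> poly_over F p.
Proof. by move=> EF Ep i; apply: EF. Qed.

Lemma algS E F a : Defs.subset E F -> alg E a -> alg F a.
Proof. by move=> EF [p [p0 Ep pa]]; exists p; split=> //; apply: poS EF Ep. Qed.

Lemma sepS E F a : Defs.subset E F -> sep E a -> sep F a.
Proof. by move=> EF [p [Ep sp pa]]; exists p; split=> //; apply: poS EF Ep. Qed.

Lemma sep_alg E a : sep E a -> alg E a.
Proof. by case=> p [Ep sp pa]; exists p; split=> //; apply: separable_poly_neq0. Qed.

Lemma minpoly_ex E a : is_subfield E -> alg E a -> exists g, minpoly E a g.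
Proof.
move=> hE [p [p0 Ep pa]].
pose Q m := exists g, [/\ g \is monic, poly_over E g, root g a & size g = m].
have Q0 : exists m, `[< Q m >].
  exists (size p); apply/asboolP; exists ((lead_coef p)^-1 *: p); split.
  - by rewrite monicE lead_coefZ mulVf // lead_coef_eq0.
  - by apply: poZ => //; apply: sfV => //; apply: Ep.
  - by rewrite rootZ // invr_eq0 lead_coef_eq0.
  - by rewrite size_scale // invr_eq0 lead_coef_eq0.
case: (ex_minnP Q0) => m /asboolP[g [mg Eg ga sg]] mmin.
exists g; split=> // q Eq qa; apply: contrapT => /negP; rewrite /dvdp => r0.
have := mmin (size (q %% g)); rewrite leqNgt -sg ltn_modp monic_neq0 // => h.
suff: false by []. apply: h; apply/asboolP.
set r := q %% g in r0 *.
have Er : poly_over E r by apply: po_modp.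
have ra : root r a.
  rewrite /root; have /eqP e := qa; move: e.
  by rewrite (divp_eq q g) hornerD hornerM (eqP ga) mulr0 add0r -/r => ->.
exists ((lead_coef r)^-1 *: r); split.
- by rewrite monicE lead_coefZ mulVf // lead_coef_eq0.
- by apply: poZ => //; apply: sfV => //; apply: Er.
- by rewrite rootZ // invr_eq0 lead_coef_eq0.
- by rewrite size_scale // invr_eq0 lead_coef_eq0.
Qed.

Lemma minpoly_neq0 E a g : minpoly E a g -> g != 0.
Proof. by case=> mg _ _ _; apply: monic_neq0. Qed.

Lemma minpoly_gt1 E a g : minpoly E a g -> (1 < size g)%N.
Proof.
move=> mg; have [_ _ ga _] := mg; rewrite ltnNge; apply/negP => /size1_polyC e.
by move: ga (minpoly_neq0 mg); rewrite e rootC polyC_eq0 => /eqP->; rewrite eqxx.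
Qed.

Lemma minpoly_small E a g q : minpoly E a g -> poly_over E q -> root q a ->
  (size q < size g)%N -> q = 0.
Proof.
move=> [_ _ _ gm] Eq qa sq; apply: contrapT => /eqP q0.
by have := dvdp_leq q0 (gm q Eq qa); rewrite leqNgt sq.
Qed.

Lemma minpoly_basis E a g : is_subfield E -> minpoly E a g ->
  basis E (adj E a) (fun i : 'I_(size g).-1 => a ^+ i).
Proof.
move=> hE mg; have g1 := minpoly_gt1 mg; have [mong Eg ga _] := mg.
split=> [i|c Ec s0 i|x [p Ep ->]].
- by exists 'X^i; [exact: (poXn hE) | rewrite hornerXn].
- pose q := \poly_(j < (size g).-1) (if insub j is Some j then c j else 0).
  have q0 : q = 0.
    apply: (minpoly_small mg).
    - by apply: po_poly => // j _; case: insubP => // _; apply: sf0.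
    - rewrite /root horner_poly -[X in _ == X]s0; apply/eqP.
      by apply: eq_bigr => j _; rewrite valK.
    - by rewrite (leq_ltn_trans (size_poly _ _)) // prednK // ltnW.
  by have := congr1 (fun q => q`_i) q0; rewrite coef_poly ltn_ord valK coef0.
- have sr : (size (p %% g)%R <= (size g).-1)%N.
    by rewrite -ltnS prednK ?ltn_modp ?(minpoly_neq0 mg) // ltnW.
  exists (fun i : 'I_(size g).-1 => (p %% g)`_i) => [i|]; first exact: po_modp.
  by rewrite {1}(divp_eq p g) hornerD hornerM (eqP ga) mulr0 add0r (horner_coef_wide _ sr).
Qed.

Lemma horner_in E F p a : is_subfield F -> Defs.subset E F -> poly_over E p -> F a -> F p.[a].
Proof.
move=> hF EF Ep Fa; rewrite horner_coef; apply: (sf_sum hF) => i _.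
by apply: sfM => //; [apply: EF | apply: sfX].
Qed.

(** If [g = h * 'X + g(0)] is the minimal polynomial of a nonzero [x], its constant term is nonzero
    and [x^-1 = - h(x) / g(0)] lies in [R]. *)
Lemma ring_subfield E R : is_subfield E -> Defs.subset E R ->
  (forall x y, R x -> R y -> R (x - y)) -> (forall x y, R x -> R y -> R (x * y)) ->
  (forall x, R x -> alg E x) -> is_subfield R.
Proof.
move=> hE ER RB RM Ra; have R0 := ER _ (sf0 hE); have R1 := ER _ (sf1 hE).
have RD x y : R x -> R y -> R (x + y).
  by move=> Rx Ry; rewrite -[y]opprK; apply: (RB) => //; rewrite -sub0r; apply: (RB).
split=> // x Rx x0; have [g mg] := minpoly_ex hE (Ra x Rx).
have [mong Eg gx _] := mg.
pose h := \poly_(i < (size g).-1) g`_i.+1.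
have Eh : poly_over E h by apply: po_poly => // i _; apply: Eg.
have gE : g = h * 'X + (g`_0)%:P.
  apply/polyP => -[|i]; rewrite coefD coefMX coefC /= ?add0r // addr0 coef_poly.
  case: ltnP => // si; rewrite nth_default //; move: si.
  by case: (size g).
have g0 : g`_0 != 0.
  apply/eqP => g0; have hx : root h x.
    move: gx; rewrite {1}gE g0 addr0 rootM => /orP[//|].
    by rewrite /root hornerX (negPf x0).
  have e := minpoly_small mg Eh hx.
  move: (minpoly_neq0 mg); rewrite gE e ?g0 ?mul0r ?addr0 ?eqxx //.
  by rewrite (leq_ltn_trans (size_poly _ _)) // prednK // ltnW // (minpoly_gt1 mg).
have -> : x^-1 = (- (g`_0)^-1) * h.[x].
  apply: (mulIf x0); rewrite mulVf // -mulrA.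
  have := gx; rewrite /root {1}gE hornerD hornerM hornerX hornerC addr_eq0 => /eqP->.
  by rewrite mulNr mulrN opprK mulVf.
apply: (RM); first by apply: (ER); apply: sfN => //; apply: sfV.
rewrite horner_coef; elim/big_rec: _ => // i y _ Ry; apply: (RD) => //.
apply: (RM); first exact: ER.
by elim: (nat_of_ord i) => [|n IH]; rewrite ?expr0 // exprS; apply: (RM).
Qed.

Lemma alg_span E (I : finType) (v : I -> L) x :
  is_subfield E -> (forall i, span E v (x ^+ i)) -> alg E x.
Proof.
move=> hE sv; apply: contrapT => na.
have iv : indep E (fun i : 'I_#|I|.+1 => x ^+ i).
  move=> c Ec s0; apply: contrapT => nc.
  have [i ci] : exists i, c i != 0.
    by apply: contrapT => ni; apply: nc => i; apply: contrapT => /eqP ci; apply: ni; exists i.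
  apply: na; exists (\poly_(j < #|I|.+1) (if insub j is Some j then c j else 0)); split.
  - apply: contraNneq ci => /(congr1 (fun q : {poly L} => q`_i)).
    by rewrite coef_poly ltn_ord valK coef0 => ->.
  - by apply: po_poly => // j _; case: insubP => // *; apply: sf0.
  - rewrite /root horner_poly -[X in _ == X]s0; apply/eqP.
    by apply: eq_bigr => j _; rewrite valK.
by have := indep_leq_span hE iv (fun i => sv i); rewrite card_ord ltnn.
Qed.

Lemma finite_alg E F x : finite_ext E F -> F x -> alg E x.
Proof.
move=> /finite_extP[hE hF EF [I [v [_ _ sv]]]] Fx.
by apply: (alg_span hE (v := v)) => i; apply: sv; apply: sfX.
Qed.

Lemma adj_sub E a : is_subfield E -> Defs.subset E (adj E a).
Proof. by move=> hE x Ex; exists x%:P; [exact: (poC hE) | rewrite hornerC]. Qed.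

Lemma adj_mem E a : is_subfield E -> adj E a a.
Proof. by move=> hE; exists 'X; [exact: (poX hE) | rewrite hornerX]. Qed.

Lemma adj_least E F a : is_subfield F -> Defs.subset E F -> F a -> Defs.subset (adj E a) F.
Proof. by move=> hF EF Fa x [p Ep ->]; exact: (horner_in hF EF Ep Fa). Qed.

Lemma adjM E a x y : is_subfield E -> adj E a x -> adj E a y -> adj E a (x * y).
Proof.
move=> hE [p Ep ->] [q Eq ->]; exists (p * q); last by rewrite hornerM.
exact: (poM hE).
Qed.

Lemma adj_finite E a : is_subfield E -> alg E a -> finite_ext E (adj E a).
Proof.
move=> hE aa; have [g mg] := minpoly_ex hE aa; have [av iv sv] := minpoly_basis hE mg.
have aX x i : adj E a x -> adj E a (x ^+ i).
  move=> ax; elim: i => [|i IH]; first by rewrite expr0; apply: (adj_sub _ hE); apply: (sf1 hE).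
  by rewrite exprS; apply: adjM.
apply/finite_extP; split=> //; last 2 first.
- exact: adj_sub.
- by exists 'I_(size g).-1, (fun i : 'I__ => a ^+ i).
apply: (ring_subfield hE (R := adj E a)) => [|x y [p Ep ->] [q Eq ->]|x y|x ax].
- exact: adj_sub.
- exists (p - q); first exact: (poB hE).
  by rewrite hornerD hornerN.
- exact: adjM.
- by apply: (alg_span hE (v := fun i : 'I_(size g).-1 => a ^+ i)) => i; apply: sv; apply: aX.
Qed.

Lemma adj_subfield E a : is_subfield E -> alg E a -> is_subfield (adj E a).
Proof. by move=> hE /(adj_finite hE)[]. Qed.

Lemma adjS E F a : Defs.subset E F -> Defs.subset (adj E a) (adj F a).
Proof. by move=> EF x [p Ep ->]; exists p => //; apply: poS EF Ep. Qed.

Section Adjs.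
Variable E : L -> Prop.
Hypothesis hE : is_subfield E.

Lemma adjs_rcons s a : adjs E (rcons s a) = adj (adjs E s) a.
Proof. by rewrite /adjs -cats1 foldl_cat. Qed.

Lemma adjs_cat s t : adjs E (s ++ t) = adjs (adjs E s) t.
Proof. by rewrite /adjs foldl_cat. Qed.

Lemma adjs_finite s : (forall x, x \in s -> alg E x) -> finite_ext E (adjs E s).
Proof.
elim/last_ind: s => [|s a IH] sa; first exact: finite_ext_refl.
have {}IH : finite_ext E (adjs E s).
  by apply: IH => x xs; apply: sa; rewrite mem_rcons inE xs orbT.
have [_ hEs EEs _] := IH; rewrite adjs_rcons; apply: (finite_ext_trans IH).
apply: adj_finite => //; apply: (algS EEs).
by apply: sa; rewrite mem_rcons mem_head.
Qed.

Lemma adjs_least F s : is_subfield F -> Defs.subset E F -> (forall x, x \in s -> F x) ->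
  Defs.subset (adjs E s) F.
Proof.
move=> hF EF; elim/last_ind: s => [|s a IH] sF //; rewrite adjs_rcons.
apply: adj_least => //; last by apply: sF; rewrite mem_rcons mem_head.
by apply: IH => x xs; apply: sF; rewrite mem_rcons inE xs orbT.
Qed.

Lemma adjs_mem s x : (forall x, x \in s -> alg E x) -> x \in s -> adjs E s x.
Proof.
elim/last_ind: s => [|s a IH] sa //; rewrite mem_rcons inE adjs_rcons.
have sa' y : y \in s -> alg E y by move=> ys; apply: sa; rewrite mem_rcons inE ys orbT.
have [_ hEs _ _] := adjs_finite sa'.
by case/predU1P=> [->|xs]; [apply: adj_mem | apply: adj_sub => //; apply: IH].
Qed.
End Adjs.

Lemma adjsS E F s : Defs.subset E F -> Defs.subset (adjs E s) (adjs F s).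
Proof.
move=> EF; elim/last_ind: s => [|s a IH] //; rewrite !adjs_rcons; exact: adjS.
Qed.

Lemma finite_gen E F : finite_ext E F -> exists2 s, (forall x, x \in s -> F x) &
  forall x, F x <-> adjs E s x.
Proof.
move=> fF; have /finite_extP[hE hF EF [I [v [Fv iv sv]]]] := fF.
exists [seq v i | i <- enum I] => [x /mapP[i _ ->]|x]; first exact: Fv.
have sF y : y \in [seq v i | i <- enum I] -> F y by move=> /mapP[i _ ->]; apply: Fv.
have sA y : y \in [seq v i | i <- enum I] -> alg E y by move=> /sF; apply: finite_alg.
have [_ hA EA _] := adjs_finite hE sA.
split=> [/sv[c Ec ->]|]; last exact: adjs_least.
apply: (sf_sum hA) => i _; apply: sfM => //; first exact: EA.
by apply: adjs_mem => //; apply: map_f; rewrite mem_enum.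
Qed.

(** Let [g] be the minimal polynomial and [d = gcd(g, g')]. As [x] is not a root of [g'], it is a
    root of [g / d], so [g] divides [g / d] and [d] is constant. Separability is proved below by
    exhibiting [x] as a simple root; [p] may have multiple roots elsewhere. *)
Lemma sep_simple E x p : is_subfield E -> poly_over E p -> root p x -> ~~ root p^`() x ->
  sep E x.
Proof.
move=> hE Ep px p'x.
have p0 : p != 0 by apply: contraNneq p'x => ->; rewrite derivC root0.
have [g mg] : exists g, minpoly E x g by apply: minpoly_ex => //; exists p.
have [mong Eg gx gm] := mg.
have g'x : ~~ root g^`() x.
  apply: contra p'x => g'x; have /dvdpP[h ->] := gm p Ep px.
  by rewrite derivM rootE hornerD !hornerM (eqP g'x) (eqP gx) !mulr0 addr0.
exists g; split=> //; rewrite separable_poly.unlock.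
set d := gcdp g g^`(); have Ed : poly_over E d by apply: po_gcdp => //; apply: po_deriv.
have dg : d %| g by apply: dvdp_gcdl.
have : root (g %/ d * d) x by rewrite divpK.
rewrite rootM => /orP[ex|dx]; last first.
  by case/negP: g'x; apply: root_dvdp dx; apply: dvdp_gcdr.
have [d0|d0] := eqVneq d 0.
  by have := minpoly_neq0 mg; rewrite -(divpK dg) d0 mulr0 eqxx.
have e0 : g %/ d != 0 by rewrite dvdp_div_eq0 // (minpoly_neq0 mg).
have := dvdp_leq e0 (gm _ (po_divp hE Eg Ed) ex).
rewrite size_divp // leqNgt /coprimep -/d.
have := size_poly_gt0 d; rewrite d0; have := minpoly_gt1 mg.
case: (size d) => [|[|k]] //; case: (size g) => [|[|m]] // _ _.
by rewrite /= subSS ltnS leq_subr.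
Qed.

Lemma sep_minpoly E x g : minpoly E x g -> sep E x -> ~~ root g^`() x.
Proof.
move=> [_ _ gx gm] [p [Ep sp px]].
have := dvdp_separable (gm p Ep px) sp; rewrite separable_poly.unlock => cg.
by rewrite /root; apply: coprimep_root cg gx.
Qed.
End Minpoly.

(** * Translation between subfields of L and field extension types *)

Section Bridge.
Variables (L : fieldType) (E F : L -> Prop) (hE : is_subfield E) (hF : is_subfield F) (n : nat).
Local Notation ES := (Subfld hE).
Local Notation FS := (Subfld hF).
Variable h : finext_data ES FS n.
Local Notation LT := (fext h).

Definition fval : LT -> L := @sfval L FS.

Fact fval_zmod : zmod_morphism fval.
Proof. by []. Qed.
Fact fval_monoid : monoid_morphism fval.
Proof. by []. Qed.
HB.instance Definition _ := GRing.isZmodMorphism.Build LT L fval fval_zmod.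
HB.instance Definition _ := GRing.isMonoidMorphism.Build LT L fval fval_monoid.

Lemma fval_inj : injective fval.
Proof. exact: fmorph_inj. Qed.

Lemma fvalP y : F (fval y).
Proof. exact: sf_down. Qed.

Lemma fval_lift x : F x -> exists y : LT, fval y = x.
Proof. exact: (sf_lift hF). Qed.

Lemma fval_lift_seq s : (forall y, y \in s -> F y) -> exists u : seq LT, map fval u = s.
Proof.
elim: s => [|y r IH] sF; first by exists [::].
have [u <-] : exists u : seq LT, map fval u = r.
  by apply: IH => z zr; apply: sF; rewrite inE zr orbT.
have [z <-] := fval_lift (sF y (mem_head _ _)).
by exists (z :: u).
Qed.

Lemma fvalZ (a : sftype ES) (y : LT) : fval (a *: y) = val a * fval y.
Proof. by []. Qed.

Lemma mem1_fval (y : LT) : y \in 1%AS <-> E (fval y).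
Proof.
split=> [/vlineP[k ->]|/(sf_lift hE)[k kE]].
  by rewrite fvalZ rmorph1 mulr1; apply: sf_down.
by apply/vlineP; exists k; apply: fval_inj; rewrite fvalZ rmorph1 mulr1.
Qed.

Lemma polyOver_fval (U : {vspace LT}) (P : L -> Prop) (p : {poly LT}) :
  (forall y, y \in U -> P (fval y)) -> p \is a polyOver U -> poly_over P (map_poly fval p).
Proof. by move=> UP /polyOverP Up i; rewrite coef_map; apply: UP. Qed.

Lemma po_fval_lift (U : {vspace LT}) (P : L -> Prop) (p : {poly L}) :
  (forall x, P x -> exists2 y, y \in U & fval y = x) -> poly_over P p ->
  exists2 q, q \is a polyOver U & p = map_poly fval q.
Proof.
move=> UP Pp; have /choice[c cE] i : exists y, y \in U /\ fval y = p`_i.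
  by have [y] := UP _ (Pp i); exists y.
exists (\poly_(i < size p) c i).
  by apply/polyOver_poly => i _; case: (cE i).
apply/polyP => i; rewrite coef_map coef_poly; case: ltnP => [_|si].
  by case: (cE i).
by rewrite nth_default // rmorph0.
Qed.

Lemma sep_fvalP (U : {subfield LT}) (P : L -> Prop) (y : LT) :
  (forall x, P x <-> exists2 y, y \in U & fval y = x) ->
  separable_element U y <-> sep P (fval y).
Proof.
move=> UP; split=> [/separable_elementP[f [Uf fy sf]]|[p [Pp sp py]]].
  exists (map_poly fval f); split; last by rewrite fmorph_root.
    by apply: polyOver_fval Uf => z zU; apply/UP; exists z.
  by rewrite separable_map.
have [q Uq e] := po_fval_lift (fun x => iffLR (UP x)) Pp.
apply/separable_elementP; exists q; split=> //.
  by rewrite -(fmorph_root fval) -e.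
by rewrite -(separable_map fval) -e.
Qed.

Lemma mem1_fvalP x : E x <-> exists2 y, y \in (1%AS : {subfield LT}) & fval y = x.
Proof.
split=> [Ex|[y /mem1_fval Ey <-] //].
by have [y e] := fval_lift (fed_sub h Ex); exists y => //; apply/mem1_fval; rewrite e.
Qed.

Lemma fval_adjs (u : seq LT) x : adjs E (map fval u) x -> exists2 z, z \in <<1 & u>>%AS & fval z = x.
Proof.
pose P x := exists2 z, z \in <<1 & u>>%AS & fval z = x; rewrite -/(P x); move: x.
have hP : is_subfield P.
  split.
  - by exists 0; rewrite ?mem0v ?rmorph0.
  - by exists 1; rewrite ?mem1v ?rmorph1.
  - by move=> _ _ [y yU <-] [z zU <-]; exists (y - z); rewrite ?memvB ?rmorphB.
  - by move=> _ _ [y yU <-] [z zU <-]; exists (y * z); rewrite ?memvM ?rmorphM.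
  - by move=> _ [y yU <-] _; exists y^-1; rewrite ?memvV ?fmorphV.
apply: adjs_least => // [y /mem1_fvalP[z z1 <-]|_ /mapP[z zu ->]]; exists z => //.
  exact: (subvP (sub1v _)).
exact: seqv_sub_adjoin.
Qed.
End Bridge.
Arguments fval {L E F hE hF n} h _.

Lemma finext_ex (L : fieldType) (E F : L -> Prop) : finite_ext E F ->
  exists hE hF n, inhabited (@finext_data L (@Subfld L E hE) (@Subfld L F hF) n).
Proof.
by move=> [hE hF EF [n dn]]; exists hE, hF, n; constructor; constructor.
Qed.

(** * Separable and purely inseparable elements *)

Section Sep.
Variable L : fieldType.
Implicit Types (E F : L -> Prop).

Lemma sep_adjs E s x : is_subfield E -> (forall y, y \in s -> sep E y) ->
  sep (adjs E s) x -> sep E x.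
Proof.
move=> hE ss sx; have sa y : y \in s -> alg E y by move=> /ss; apply: sep_alg.
have fS := adjs_finite hE sa; have [_ hS ES _] := fS.
have fF : finite_ext E (adj (adjs E s) x).
  by apply: (finite_ext_trans fS); apply: adj_finite => //; apply: sep_alg.
have [hE' [hF [n [h]]]] := finext_ex fF.
have SF : Defs.subset (adjs E s) (adj (adjs E s) x) by apply: adj_sub.
have [u uE] : exists u : seq (fext h), map (fval h) u = s.
  by apply: fval_lift_seq => y ys; apply/SF/adjs_mem.
have [x' xE] : exists y : fext h, fval h y = x by apply/fval_lift/adj_mem.
pose U := <<1 & u>>%AS; pose P y := exists2 z, z \in U & fval h z = y.
have uU y : y \in u -> y \in U by apply: seqv_sub_adjoin.
have sP : Defs.subset (adjs E s) P.
  by move=> y; rewrite -{1}uE; apply: fval_adjs.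
have sepU : separable 1 U.
  apply: separable_Fadjoin_seq; apply/allP => y yu.
  apply/(sep_fvalP y (mem1_fvalP h)); apply: ss.
  by have := map_f (fval h) yu; rewrite uE.
have sepx : separable U <<U; x'>>.
  rewrite -adjoin_separable_eq; apply/(sep_fvalP (P := P)) => //.
  by rewrite xE; apply: sepS sx.
have /separableP/(_ x' (memv_adjoin U x')) := separable_trans sepU sepx.
by move/(sep_fvalP x' (mem1_fvalP h)); rewrite xE.
Qed.

Lemma sep_base E x : is_subfield E -> E x -> sep E x.
Proof.
move=> hE Ex; apply: (sep_simple hE (p := 'X - x%:P)).
- by apply: poB => //; [apply: poX | apply: poC].
- by rewrite root_XsubC.
- by rewrite derivXsubC rootE hornerC oner_eq0.
Qed.

Lemma sep_gen E s x : is_subfield E -> (forall y, y \in s -> sep E y) ->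
  adjs E s x -> sep E x.
Proof.
move=> hE ss sx; apply: (sep_adjs hE ss); apply: sep_base => //.
by have [] := adjs_finite hE (fun y ys => sep_alg (ss y ys)).
Qed.

Lemma sep_trans E F x : is_subfield E -> is_subfield F -> Defs.subset E F ->
  (forall y, F y -> sep E y) -> sep F x -> sep E x.
Proof.
move=> hE hF EF sF [p [Fp sp px]].
apply: (sep_adjs hE (s := p)) => [y /(nthP 0)[i _ <-]|]; first exact/sF/Fp.
exists p; split=> // i; have [ip|ip] := ltnP i (size p); last first.
  rewrite nth_default //; apply: sf0.
  by have [] := adjs_finite hE (fun y (yp : y \in polyseq p) =>
    let: ex_intro2 i _ e := nthP 0 yp in sep_alg (eq_ind _ _ (sF _ (Fp i)) _ e)).
apply: adjs_mem (mem_nth _ ip) => // y /(nthP 0)[j _ <-].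
exact/sep_alg/sF/Fp.
Qed.

(** The condition on [q] means a power of the characteristic exponent: in characteristic 0 the set
    [[pchar L]] is empty and [q] is 1, which avoids a case distinction later. *)
Lemma sep_exponent E x : is_subfield E -> alg E x ->
  exists2 q, [pchar L].-nat q & sep E (x ^+ q).
Proof.
move=> hE ax; have [hE' [hF [n [h]]]] := finext_ex (adj_finite hE ax).
have [y yE] : exists y : fext h, fval h y = x by apply/fval_lift/adj_mem.
have [q /andP[qp sq]] := separable_exponent_pchar 1 y; exists q.
  apply: sub_in_pnat qp => r _; rewrite !inE => /andP[-> /eqP r0] /=.
  by rewrite -(rmorph_nat (fval h)) r0 rmorph0.
by rewrite -yE -rmorphXn; apply/(sep_fvalP _ (mem1_fvalP h)).
Qed.

Lemma pchar_sum_exp (R : comNzRingType) q (I : Type) (r : seq I) (P : pred I) (f : I -> R) :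
  [pchar R].-nat q -> (\sum_(i <- r | P i) f i) ^+ q = \sum_(i <- r | P i) f i ^+ q.
Proof.
move=> qp; elim/big_rec2: _ => [|i x y _ <-]; last by rewrite exprDn_pchar.
by rewrite expr0n; case: q qp.
Qed.

Lemma minpoly_mod E a g x : is_subfield E -> minpoly E a g -> adj E a x ->
  exists p, [/\ poly_over E p, (size p < size g)%N & x = p.[a]].
Proof.
move=> hE mg [p Ep ->]; have [_ Eg ga _] := mg; exists (p %% g); split.
- exact: po_modp.
- by rewrite ltn_modp (minpoly_neq0 mg).
- by rewrite {1}(divp_eq p g) hornerD hornerM (eqP ga) mulr0 add0r.
Qed.

(** With [d = gcd(g, G)], separability makes [e = g / d] coprime to [d], hence to [G]; since [e]
    divides [G ^+ q], it is constant. *)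
Lemma separable_dvd_exp (g G : {poly L}) q : separable_poly g -> g %| G ^+ q -> g %| G.
Proof.
move=> sg gG; have dg := dvdp_gcdl g G; set d := gcdp g G in dg.
set e := g %/ d; have ed : e * d = g by rewrite divpK.
have ced : coprimep e d by apply: separable_coprime sg _; rewrite ed.
have eg : e %| g by rewrite -ed dvdp_mulr.
have ceG : coprimep e G.
  apply/coprimepP => r re rG; apply: (elimT (coprimepP e d) ced) => //.
  by rewrite dvdp_gcd (dvdp_trans re eg).
have e1 : e %= 1.
  apply: (elimT (coprimepP e (G ^+ q))); rewrite ?dvdpp //; first exact: coprimep_expr.
  exact: dvdp_trans gG.
rewrite -ed -[G]mul1r; apply: dvdp_mul; last exact: dvdp_gcdr.
by rewrite (eqp_dvdl _ e1).
Qed.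

(** A relation over [k(c)] is a polynomial [G = sum lam_i p_i] vanishing at [c], with [p_i] over [k]
    of degree below that of the minimal polynomial [g]. Its power [G ^+ q] has coefficients in [k],
    so [g] divides it, hence divides [G], and the degree forces [G = 0]. Independence of the [lam_i]
    over [k] then kills the coefficients of all [p_i]. *)
Lemma insep_sep_indep1 (k : L -> Prop) c (I : finType) (lam : I -> L) q :
  is_subfield k -> [pchar L].-nat q -> (forall i, k (lam i ^+ q)) -> sep k c ->
  indep k lam -> indep (adj k c) lam.
Proof.
move=> hk qp lq sc il b bk s0; have [g mg] := minpoly_ex hk (sep_alg sc).
have /choice[p pP] i := minpoly_mod hk mg (bk i).
pose G := \sum_i lam i *: p i.
have Gc : root G c.
  rewrite /root horner_sum; apply/eqP; rewrite -[RHS]s0; apply: eq_bigr => i _.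
  by rewrite hornerZ mulrC; case: (pP i) => _ _ ->.
have GqE : G ^+ q = \sum_i lam i ^+ q *: p i ^+ q.
  rewrite pchar_sum_exp; first by apply: eq_bigr => i _; rewrite exprZn.
  by apply: sub_in_pnat qp => r _; rewrite pchar_poly.
have gG : g %| G.
  have [mong kg gc gm] := mg.
  apply: (separable_dvd_exp (q := q)); first by case: sc => r [kr sr rc]; apply: dvdp_separable sr; apply: gm.
  apply: gm; last first.
    by rewrite /root hornerE (eqP Gc) expr0n; case: (q) qp.
  rewrite GqE; move=> j; rewrite coef_sum; apply: (sf_sum hk) => i _.
  rewrite coefZ; apply: sfM => //; have [kp _ _] := pP i.
  by elim: (q) j => [|m IH] j; rewrite ?expr0 ?exprS; [apply: po1 | apply: poM].
have G0 : G = 0.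
  apply: contrapT => /eqP G0; have := dvdp_leq G0 gG; rewrite leqNgt.
  have -> // : (size G < size g)%N.
  rewrite (leq_ltn_trans (size_sum _ _ _)) //.
  rewrite -[size g]prednK; last by rewrite ltnW // (minpoly_gt1 mg).
  rewrite ltnS; apply/bigmax_leqP => i _; apply: leq_trans (size_scale_leq _ _) _.
  by rewrite -ltnS prednK; [case: (pP i) | rewrite ltnW // (minpoly_gt1 mg)].
move=> i; have [kp _ ->] := pP i; suff -> : p i = 0 by rewrite horner0.
apply/polyP => j; rewrite coef0; apply: (il (fun i => (p i)`_j)) => [l|].
  by case: (pP l).
have := congr1 (fun P : {poly L} => P`_j) G0; rewrite coef0 coef_sum => e.
by rewrite -[RHS]e; apply: eq_bigr => l _; rewrite coefZ mulrC.
Qed.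

Lemma insep_sep_indep (k C : L -> Prop) (I : finType) (lam : I -> L) q :
  is_subfield k -> [pchar L].-nat q -> (forall i, k (lam i ^+ q)) ->
  (forall c, C c -> sep k c) -> indep k lam -> indep C lam.
Proof.
move=> hk qp lq Cs il b Cb s0.
pose s := [seq b i | i <- enum I].
have ss x : x \in s -> sep k x by move=> /mapP[i _ ->]; apply: Cs.
have ia : indep (adjs k s) lam.
  elim/last_ind: s ss => [|s a IH] ss //; rewrite adjs_rcons.
  have ss' x : x \in s -> sep k x by move=> xs; apply: ss; rewrite mem_rcons inE xs orbT.
  have [_ hs ks _] := adjs_finite hk (fun x xs => sep_alg (ss' x xs)).
  apply: (insep_sep_indep1 hs qp) => [i||]; [exact/ks/lq | | exact: IH].
  by apply: sepS ks _; apply: ss; rewrite mem_rcons mem_head.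
apply: ia => // i; apply: adjs_mem => [//|x /ss|]; first exact: sep_alg.
by apply: map_f; rewrite mem_enum.
Qed.
End Sep.

(** * Henselian valued fields *)

(* An algebraically closed valued field Om, algebraic over its henselian subfield K. *)
Record hvf := Hvf {
  hOm : closedFieldType; hO : hOm -> Prop; hk : fieldType; hres : hOm -> hk;
  hK : hOm -> Prop;
  hO_val : is_valuation_ring (fun _ => True) hO;
  hres_map : is_residue_map hO hres;
  hK_alg : algebraic_ext hK (fun _ => True);
  hK_hens : henselian hO hK }.

Section Val.
Variable V : hvf.
Local Notation Om := (hOm V).
Local Notation O := (@hO V).
Local Notation kappa := (hk V).
Local Notation res := (@hres V).
Local Notation K := (@hK V).
Local Notation U := (unitO O).
Implicit Types (E F M N T : Om -> Prop) (x y z a b : Om) (p q f g : {poly Om}).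

Lemma OB x y : O x -> O y -> O (x - y). Proof. by case: (hO_val V) => _ [_ _ + _ _]; apply. Qed.
Lemma O0 : O 0. Proof. by case: (hO_val V) => _ []. Qed.
Lemma O1 : O 1. Proof. by case: (hO_val V) => _ []. Qed.
Lemma OM x y : O x -> O y -> O (x * y). Proof. by case: (hO_val V) => _ [_ _ _ + _]; apply. Qed.
Lemma Ocase x : x != 0 -> O x \/ O x^-1. Proof. by case: (hO_val V) => _ [_ _ _ _]; apply. Qed.
Lemma ON x : O x -> O (- x). Proof. by move=> Ox; rewrite -sub0r; exact: (OB O0 Ox). Qed.
Lemma OD x y : O x -> O y -> O (x + y).
Proof. by move=> Ox Oy; rewrite -[y]opprK; exact: (OB Ox (ON Oy)). Qed.
Lemma OX x n : O x -> O (x ^+ n).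
Proof. by move=> Ox; elim: n => [|n IH]; rewrite ?expr0 ?exprS; [apply: O1 | apply: OM]. Qed.
Lemma O_sum (I : Type) (r : seq I) (P : pred I) (f : I -> Om) :
  (forall i, P i -> O (f i)) -> O (\sum_(i <- r | P i) f i).
Proof. by move=> Of; elim/big_rec: _ => [|i x Pi Ox]; [apply: O0 | apply: OD => //; apply: Of]. Qed.
Lemma O_prod (I : Type) (r : seq I) (P : pred I) (f : I -> Om) :
  (forall i, P i -> O (f i)) -> O (\prod_(i <- r | P i) f i).
Proof. by move=> Of; elim/big_rec: _ => [|i x Pi Ox]; [apply: O1 | apply: OM => //; apply: Of]. Qed.
Lemma O_nat n : O n%:R.
Proof. by elim: n => [|n IH]; rewrite ?mulr0n ?mulrS; [apply: O0 | apply: OD => //; apply: O1]. Qed.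

Lemma U_O x : U x -> O x. Proof. by case. Qed.
Lemma U_neq0 x : U x -> x != 0. Proof. by case. Qed.
Lemma U1 : U 1. Proof. by split; rewrite ?oner_eq0 ?invr1 //; apply: O1. Qed.
Lemma UV x : U x -> U x^-1. Proof. by case=> a b c; split; rewrite ?invr_eq0 ?invrK. Qed.
Lemma UM x y : U x -> U y -> U (x * y).
Proof.
move=> [a b c] [d e f]; split; [exact: OM | exact: mulf_neq0 |].
by rewrite invfM; apply: OM.
Qed.
Lemma Udiv x y : U x -> U y -> U (x / y). Proof. by move=> Ux Uy; exact: (UM Ux (UV Uy)). Qed.
Lemma UX x n : U x -> U (x ^+ n).
Proof. by move=> Ux; elim: n => [|n IH]; rewrite ?expr0 ?exprS; [apply: U1 | apply: UM]. Qed.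
Lemma UMl x y : O x -> O y -> U (x * y) -> U x.
Proof.
move=> Ox Oy [_ /[dup] xy0]; rewrite mulf_eq0 negb_or => /andP[x0 y0] h; split=> //.
suff -> : x^-1 = y * (x * y)^-1 by apply: OM.
by rewrite invfM mulrCA mulfV ?mulr1.
Qed.

Lemma resD x y : O x -> O y -> res (x + y) = res x + res y. Proof. by case: (hres_map V) => + _ _ _ _; apply. Qed.
Lemma resM x y : O x -> O y -> res (x * y) = res x * res y. Proof. by case: (hres_map V) => _ + _ _ _; apply. Qed.
Lemma res1 : res 1 = 1. Proof. by case: (hres_map V). Qed.
Lemma res_eq0 x : O x -> res x = 0 <-> ~ U x. Proof. by case: (hres_map V) => _ _ _ _; apply. Qed.
Lemma res0 : res 0 = 0.
Proof. by apply: (addrI (res 0)); rewrite -resD ?addr0 //; apply: O0. Qed.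
Lemma resN x : O x -> res (- x) = - res x.
Proof.
by move=> Ox; apply: (addrI (res x)); rewrite -resD ?subrr ?res0 //; apply: ON.
Qed.
Lemma resB x y : O x -> O y -> res (x - y) = res x - res y.
Proof. by move=> Ox Oy; rewrite resD ?resN //; apply: ON. Qed.
Lemma resX x n : O x -> res (x ^+ n) = res x ^+ n.
Proof.
by move=> Ox; elim: n => [|n IH]; rewrite ?expr0 ?res1 // !exprS resM ?IH //; apply: OX.
Qed.
Lemma res_sum (I : Type) (r : seq I) (P : pred I) (f : I -> Om) :
  (forall i, P i -> O (f i)) -> res (\sum_(i <- r | P i) f i) = \sum_(i <- r | P i) res (f i).
Proof.
move=> Of; suff [] : O (\sum_(i <- r | P i) f i) /\
  res (\sum_(i <- r | P i) f i) = \sum_(i <- r | P i) res (f i) by [].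
elim: r => [|i r [Ox e]]; first by rewrite !big_nil res0; split=> //; apply: O0.
rewrite !big_cons; case: ifP => // Pi.
by rewrite resD ?e; [split=> //; apply: OD | |]; rewrite ?Of //; apply: Of.
Qed.
Lemma res_nat n : res n%:R = n%:R.
Proof.
by elim: n => [|n IH]; rewrite ?mulr0n ?res0 // !mulrS resD ?res1 ?IH //; [apply: O1 | apply: O_nat].
Qed.
Lemma res_mulrn x n : O x -> res (x *+ n) = res x *+ n.
Proof. by move=> Ox; rewrite -mulr_natr resM ?res_nat ?mulr_natr //; apply: O_nat. Qed.
Lemma res_neq0 x : U x -> res x != 0.
Proof. by move=> Ux; apply/eqP => /(res_eq0 (U_O Ux)). Qed.
Lemma resU x : O x -> res x != 0 -> U x.
Proof. by move=> Ox /eqP r0; apply: contrapT => nU; apply/r0/(res_eq0 Ox). Qed.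
Lemma resV x : U x -> res x^-1 = (res x)^-1.
Proof.
move=> Ux; have r0 := res_neq0 Ux; apply: (mulfI r0).
rewrite -resM ?divff ?res1 //; [exact: U_neq0 | exact: U_O | exact: (U_O (UV Ux))].
Qed.
Lemma nU_res x : O x -> ~ U x -> res x = 0. Proof. by move=> Ox; apply: (iffRL (res_eq0 Ox)). Qed.
Lemma nO_inv x : ~ O x -> O x^-1 /\ res x^-1 = 0.
Proof.
move=> nO; have x0 : x != 0 by apply/eqP => x0; apply: nO; rewrite x0; apply: O0.
have [//|Ox] := Ocase x0; split=> //; apply: nU_res => // -[_ _].
by rewrite invrK.
Qed.
Lemma U_nat n : n%:R != 0 :> kappa -> U n%:R.
Proof. by move=> n0; apply: resU; rewrite ?res_nat //; apply: O_nat. Qed.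

(* 1-units *)
Definition ou x := O x /\ res x = 1.
Lemma ou_U x : ou x -> U x. Proof. by move=> [Ox r1]; apply: resU => //; rewrite r1 oner_eq0. Qed.
Lemma ou1 : ou 1. Proof. by split; [apply: O1 | apply: res1]. Qed.
Lemma ouM x y : ou x -> ou y -> ou (x * y).
Proof. by move=> [Ox rx] [Oy ry]; split; [apply: OM | rewrite resM ?rx ?ry ?mulr1]. Qed.
Lemma ouV x : ou x -> ou x^-1.
Proof. by move=> ox; have Ux := ou_U ox; split; [exact: (U_O (UV Ux)) | rewrite resV ?ox.2 ?invr1]. Qed.
Lemma ou_div x y : ou x -> ou y -> ou (x / y). Proof. by move=> ox oy; exact: (ouM ox (ouV oy)). Qed.
Lemma ouX x n : ou x -> ou (x ^+ n).
Proof. by move=> ox; elim: n => [|n IH]; rewrite ?expr0 ?exprS; [apply: ou1 | apply: ouM]. Qed.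
Lemma ou_div_res x y : O x -> U y -> res x = res y -> ou (x / y).
Proof.
move=> Ox Uy e; split; first by apply: OM => //; apply: U_O (UV Uy).
by rewrite resM ?resV ?e ?divff //; [apply: res_neq0 | apply: U_O (UV Uy)].
Qed.

Lemma res_horner p x : poly_over O p -> O x -> res p.[x] = (map_poly res p).[res x].
Proof.
move=> Op Ox; rewrite horner_coef res_sum => [|i _]; last by apply: OM => //; apply: OX.
rewrite (horner_coef_wide _ (size_poly _ _)); apply: eq_bigr => i _.
by rewrite resM ?resX ?coef_map_id0 ?res0 //; apply: OX.
Qed.

Lemma O_horner p x : poly_over O p -> O x -> O p.[x].
Proof. by move=> Op Ox; rewrite horner_coef; apply: O_sum => i _; apply: OM => //; apply: OX. Qed.

Lemma O_integral p x : p \is monic -> poly_over O p -> root p x -> O x.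
Proof.
move=> mp Op px; apply: contrapT => nOx; have [Oy ry] := nO_inv nOx.
have x0 : x != 0 by apply/eqP => x0; apply: nOx; rewrite x0; apply: O0.
have n0 : (0 < size p)%N by rewrite size_poly_gt0 monic_neq0.
pose n := (size p).-1; have nE : size p = n.+1 by rewrite prednK.
have e : \sum_(i < n) p`_i * x^-1 ^+ (n - i) + 1 = 0.
  transitivity (x^-1 ^+ n * p.[x]); last by rewrite (eqP px) mulr0.
  rewrite horner_coef nE big_ord_recr /= mulrDr mulr_sumr; congr (_ + _).
    apply: eq_bigr => i _; rewrite mulrCA; congr (_ * _).
    have -> : x^-1 ^+ n = x^-1 ^+ (n - i) * x^-1 ^+ i by rewrite -exprD subnK // ltnW.
    by rewrite -mulrA -exprMn mulVf // expr1n mulr1.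
  have -> : p`_n = 1 by have := eqP mp; rewrite lead_coefE nE.
  by rewrite mul1r -exprMn mulVf // expr1n.
have Ot (i : 'I_n) : true -> O (p`_i * x^-1 ^+ (n - i)) by move=> _; apply: OM => //; apply: OX.
have := congr1 res e; rewrite resD ?res1 ?res0; [|exact: O_sum|exact: O1].
rewrite res_sum // big1 ?add0r => [/eqP|i _]; first by rewrite oner_eq0.
rewrite resM //; last exact: OX.
by rewrite resX // ry expr0n subn_eq0 leqNgt ltn_ord mulr0.
Qed.

Lemma monic_split p : p \is monic -> exists s : seq Om, p = \prod_(z <- s) ('X - z%:P).
Proof.
move=> mp; have [s e] := closed_field_poly_normal p; exists s.
by rewrite {1}e (eqP mp) scale1r.
Qed.

Lemma monic_O p : p \is monic -> (forall b, root p b -> O b) -> poly_over O p.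
Proof.
move=> /monic_split[s ->] rO.
have {}rO z : z \in s -> O z by move=> zs; apply: rO; rewrite root_prod_XsubC.
elim: s rO => [|z s IH] rO.
  by rewrite big_nil => i; rewrite coef1; case: eqP => _; [apply: O1 | apply: O0].
rewrite big_cons => i; rewrite mulrBl coefB coefXM mul_polyC coefZ.
have {}IH : poly_over O (\prod_(z <- s) ('X - z%:P)).
  by apply: IH => y ys; apply: rO; rewrite inE ys orbT.
apply: OB; first by case: eqP => _ //; apply: O0.
by apply: OM => //; apply: rO; rewrite mem_head.
Qed.

Definition sfK E := is_subfield E /\ Defs.subset K E.

Lemma sfK_sf E : sfK E -> is_subfield E. Proof. by case. Qed.
Lemma sfK_sub E F : sfK E -> is_subfield F -> Defs.subset E F -> sfK F.
Proof. by move=> [_ KE] hF EF; split=> // x /KE /EF. Qed.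
Lemma sfK_K : sfK K. Proof. by case: (hK_alg V) => hK *; split. Qed.

Lemma alg_all E x : sfK E -> alg E x.
Proof.
move=> [_ KE]; have [_ _ _ h] := hK_alg V; have [p [p0 Kp px]] := h x I.
by exists p; split=> // i; apply/KE/Kp.
Qed.

Lemma sfK_adj E a : sfK E -> sfK (adj E a).
Proof.
move=> kE; have hE := sfK_sf kE; apply: (sfK_sub kE).
  by apply: adj_subfield => //; apply: alg_all.
exact: adj_sub.
Qed.

Lemma sfK_adjs E s : sfK E -> sfK (adjs E s).
Proof. by elim: s E => [|a s IH] E // kE; apply/IH/sfK_adj. Qed.

(* S is the graph of an embedding over E of a subfield of Om; pulling O back along it gives a second
   valuation ring over E, so henselianity applies. *)
Lemma emb_O E (S : Om -> Om -> Prop) : sfK E ->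
  (forall e, E e -> S e e) ->
  (forall x x' y y', S x x' -> S y y' -> S (x - y) (x' - y')) ->
  (forall x x' y y', S x x' -> S y y' -> S (x * y) (x' * y')) ->
  (forall y, S 0 y -> y = 0) ->
  forall x x', S x x' -> O x <-> O x'.
Proof.
move=> kE Se SB SM S0 x x' Sx; have hE := sfK_sf kE.
pose D x := exists x', S x x'.
have ED : Defs.subset E D by move=> e Ee; exists e; apply: Se.
have hD : is_subfield D.
  apply: (ring_subfield hE) => // [y z [y' Sy] [z' Sz]|y z [y' Sy] [z' Sz]|y _].
  - by exists (y' - z'); apply: SB.
  - by exists (y' * z'); apply: SM.
  - exact: alg_all.
have Sf y y1 y2 : S y y1 -> S y y2 -> y1 = y2.
  move=> h1 h2; apply/eqP; rewrite -subr_eq0; apply/eqP/S0.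
  by rewrite -[0](subrr y); apply: SB.
pose R y := exists2 y', S y y' & O y'.
have -> : O x' <-> R x.
  by split=> [Ox'|[y Sy Oy]]; [exists x' | rewrite (Sf _ _ _ Sx Sy)].
apply: iff_sym; apply: (@hK_hens V D); last by exists x'.
- have [hK _ _ halg] := hK_alg V; split=> // [y Ky|y _]; last exact: halg.
  by apply/ED; case: kE => _; apply.
- split=> [y [y' Sy _]|]; first by exists y'.
  split=> [||y z [y' Sy Oy] [z' Sz Oz]|y z [y' Sy Oy] [z' Sz Oz]|y Dy y0].
  + by exists 0; [apply/Se/(sf0 hE) | apply: O0].
  + by exists 1; [apply/Se/(sf1 hE) | apply: O1].
  + by exists (y' - z'); [apply: SB | apply: OB].
  + by exists (y' * z'); [apply: SM | apply: OM].
  + have [y' Sy] := Dy; have [_ _ _ _ DV] := hD; have [z' Sz] := DV _ Dy y0.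
    have yz : y' * z' = 1.
      by apply: (Sf 1); [rewrite -(divff y0); apply: SM | apply/Se/(sf1 hE)].
    have y'0 : y' != 0 by apply: contra_eq_neq yz => ->; rewrite mul0r eq_sym oner_eq0.
    have z'E : z' = y'^-1 by apply: (mulfI y'0); rewrite yz divff.
    by case: (Ocase y'0) => Oy; [left; exists y' | right; exists z' => //; rewrite z'E].
- move=> y Ky; have Ey : E y by case: kE => _; apply.
  by split=> [[y' Sy Oy']|Oy]; [rewrite (Sf _ _ _ (Se _ Ey) Sy) | exists y => //; apply: Se].
Qed.

Section Conj.
Variables (E : Om -> Prop) (x y : Om) (g : {poly Om}).
Hypotheses (kE : sfK E) (mg : minpoly E x g) (gy : root g y).
Let hE := sfK_sf kE.

Lemma conj_root p : poly_over E p -> root p x -> root p y.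
Proof. by case: mg => _ _ _ gm Ep px; apply: root_dvdp gy; apply: gm. Qed.

Lemma conj_O p : poly_over E p -> O p.[x] <-> O p.[y].
Proof.
move=> Ep; pose S a b := exists p, [/\ poly_over E p, a = p.[x] & b = p.[y]].
apply: (@emb_O E S kE); last by exists p.
- by move=> e Ee; exists e%:P; rewrite !hornerC; split=> //; apply: poC.
- move=> _ _ _ _ [p1 [E1 -> ->]] [p2 [E2 -> ->]]; exists (p1 - p2).
  by rewrite !hornerD !hornerN; split=> //; apply: poB.
- move=> _ _ _ _ [p1 [E1 -> ->]] [p2 [E2 -> ->]]; exists (p1 * p2).
  by rewrite !hornerM; split=> //; apply: poM.
- by move=> b [q [Eq /esym/eqP qx ->]]; apply/eqP; apply: conj_root.
Qed.

Lemma conj_U p : poly_over E p -> U p.[x] -> U p.[y].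
Proof.
move=> Ep [Op p0 OV].
have [_ _ _ _ aV] := adj_subfield hE (alg_all x kE).
have [q Eq qE] := aV _ (ex_intro2 _ _ p Ep erefl) p0.
have pq : p.[y] * q.[y] = 1.
  apply/eqP; rewrite -hornerM -subr_eq0 -[X in _ - X](hornerC 1 y) -hornerN -hornerD -rootE.
  apply: conj_root; last by rewrite rootE hornerD hornerN hornerM hornerC -qE divff ?subrr.
  by apply: (poB hE); [apply: poM | apply: po1].
have py0 : p.[y] != 0 by apply: contra_eq_neq pq => ->; rewrite mul0r eq_sym oner_eq0.
split=> //; first exact/conj_O.
have -> : p.[y]^-1 = q.[y] by apply: (mulfI py0); rewrite divff.
by apply/conj_O => //; rewrite -qE.
Qed.
End Conj.
End Val.

(** * The fundamental inequality and defectless extensions *)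

Section Fund.
Variable V : hvf.
Local Notation Om := (hOm V).
Local Notation O := (@hO V).
Local Notation kappa := (hk V).
Local Notation res := (@hres V).
Local Notation K := (@hK V).
Local Notation U := (unitO O).
Local Notation rf := (resf O res).
Local Notation scl := (same_class O).
Implicit Types (E F M N T : Om -> Prop) (x y z a b : Om) (I J B C : finType).

Lemma rf_subfield E : is_subfield E -> is_subfield (rf E).
Proof.
move=> hE; split.
- by exists 0; split; [apply: sf0 | apply: O0 | apply: res0].
- by exists 1; split; [apply: sf1 | apply: O1 | apply: res1].
- move=> _ _ [x [Ex Ox <-]] [y [Ey Oy <-]]; exists (x - y).
  by split; [apply: sfB | apply: OB | apply: resB].
- move=> _ _ [x [Ex Ox <-]] [y [Ey Oy <-]]; exists (x * y).
  by split; [apply: sfM | apply: OM | apply: resM].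
- move=> _ [x [Ex Ox <-]] r0; have Ux := resU Ox r0; exists x^-1.
  by split; [apply: sfV | apply: U_O (UV Ux) | apply: resV].
Qed.

Lemma rfS E F : Defs.subset E F -> Defs.subset (rf E) (rf F).
Proof. by move=> EF _ [x [/EF Fx Ox <-]]; exists x. Qed.

Lemma scl_refl E x : is_subfield E -> x != 0 -> scl E x x.
Proof.
move=> hE x0; exists 1; rewrite mulr1 divff // oner_eq0.
by split=> //; [apply: sf1 | apply: U1].
Qed.

Lemma scl_neq0 E x y : scl E x y -> x != 0 /\ y != 0.
Proof.
move=> [e [Ee e0 /U_neq0]]; rewrite mulf_eq0 invr_eq0 mulf_eq0 !negb_or.
by case/andP=> -> /andP[-> _].
Qed.

Lemma scl_sym E x y : is_subfield E -> scl E x y -> scl E y x.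
Proof.
move=> hE xy; have [x0 y0] := scl_neq0 xy; case: xy => e [Ee e0 h].
exists e^-1; split; rewrite ?invr_eq0 //; first exact: sfV.
have := UV h; rewrite !invfM !invrK => h'.
by have -> : y * (x^-1 * e) = x^-1 * (y * e) by rewrite mulrCA.
Qed.

Lemma scl_mul E x y x' y' : is_subfield E -> scl E x y -> scl E x' y' -> scl E (x * x') (y * y').
Proof.
move=> hE [e [Ee e0 h]] [e' [Ee' e'0 h']]; exists (e * e').
split; [exact: sfM | exact: mulf_neq0 |].
have -> : x * x' / (y * y' * (e * e')) = x / (y * e) * (x' / (y' * e')).
  by rewrite mulrACA [in RHS]mulrACA -invfM.
exact: UM.
Qed.

Lemma scl_trans E y x z : is_subfield E -> scl E x y -> scl E y z -> scl E x z.
Proof.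
move=> hE xy yz; have [_ y0] := scl_neq0 xy.
have [_ z0] := scl_neq0 yz.
have [e [Ee e0 h]] := xy; have [e' [Ee' e'0 h']] := yz.
exists (e * e'); split; [exact: sfM | exact: mulf_neq0 |].
have -> : x / (z * (e * e')) = x / (y * e) * (y / (z * e')).
  by field; rewrite y0 z0 e0 e'0.
exact: UM.
Qed.

Lemma scl_prod E (I : finType) (f h : I -> Om) : is_subfield E ->
  (forall i, scl E (f i) (h i)) -> scl E (\prod_i f i) (\prod_i h i).
Proof.
move=> hE fh; elim/big_rec2: _ => [|i x y _ xy]; last exact: scl_mul.
by apply: scl_refl; rewrite ?oner_eq0.
Qed.

Lemma sclX E x y n : is_subfield E -> scl E x y -> scl E (x ^+ n) (y ^+ n).
Proof.
move=> hE xy; elim: n => [|n IH]; last by rewrite !exprS; apply: scl_mul.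
by rewrite !expr0; apply: scl_refl; rewrite ?oner_eq0.
Qed.

Lemma scl_div E x y x' y' : is_subfield E -> scl E x y -> scl E x' y' -> scl E (x / x') (y / y').
Proof.
move=> hE xy x'y'; apply: scl_mul => //; have [x'0 y'0] := scl_neq0 x'y'.
have [e [Ee e0 h]] := scl_sym hE x'y'; exists e; split=> //.
by move: h; rewrite !invfM invrK mulrCA mulrA.
Qed.

Lemma sclS E F x y : Defs.subset E F -> scl E x y -> scl F x y.
Proof. by move=> EF [e [/EF Fe e0 h]]; exists e. Qed.

Lemma scl_base E x : E x -> x != 0 -> scl E x 1.
Proof. by move=> Ex x0; exists x; rewrite mul1r divff //; split=> //; apply: U1. Qed.

Lemma scl_unit E x y : is_subfield E -> y != 0 -> U (x / y) -> scl E x y.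
Proof. by move=> hE y0 h; exists 1; rewrite mulr1 oner_eq0; split=> //; apply: sf1. Qed.

Definition inequiv E I (x : I -> Om) := forall i j, scl E (x i) (x j) -> i = j.

Lemma omax I (P : pred I) (y : I -> Om) i : P i -> (forall i, P i -> y i != 0) ->
  exists2 i0, P i0 & forall i, P i -> O (y i / y i0).
Proof.
move=> Pi y0; suff [i0 Pi0 h] : exists2 i0, P i0 & forall j, j \in enum I -> P j -> O (y j / y i0).
  by exists i0 => // j; apply: h; rewrite mem_enum.
elim: (enum I) => [|k s [i0 Pi0 IH]]; first by exists i.
have [Pk|nPk] := boolP (P k); last first.
  by exists i0 => // j; rewrite inE => /predU1P[-> Pk|]; [rewrite Pk in nPk | apply: IH].
have [h|] := pselect (O (y k / y i0)).
  by exists i0 => // j; rewrite inE => /predU1P[-> //|]; apply: IH.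
move=> /nO_inv[]; rewrite invfM invrK => h _; exists k => // j.
rewrite inE => /predU1P[-> _|js Pj]; first by rewrite divff ?y0 //; apply: O1.
have -> : y j / y k = (y j / y i0) * ((y k)^-1 * y i0).
  by rewrite [(y k)^-1 * _]mulrC mulrA divfK ?y0.
by apply: OM => //; apply: IH.
Qed.

(** Divided by the term of least value, the sum has residue 1, since every other nonzero term has
    strictly larger value. *)
Lemma vsum I (y : I -> Om) :
  (forall i k, y i != 0 -> y k != 0 -> U (y i / y k) -> i = k) ->
  \sum_i y i = 0 -> forall i, y i = 0.
Proof.
move=> yd s0 i; apply: contrapT => /eqP yi.
have [i0 yi0 h] := omax (P := fun i => y i != 0) yi (fun i h => h).
have Oi j : O (y j / y i0).
  have [->|yj] := eqVneq (y j) 0; [by rewrite mul0r; apply: O0 | exact: h].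
have := congr1 (fun z => res (z / y i0)) s0; rewrite /= mul0r res0 mulr_suml res_sum //.
rewrite (bigD1 i0) //= divff // res1 big1 ?addr0 => [/eqP|j ji0]; first by rewrite oner_eq0.
have [->|yj] := eqVneq (y j) 0; first by rewrite mul0r res0.
by apply: nU_res => // /(yd _ _ yj yi0) e; rewrite e eqxx in ji0.
Qed.

Section OverE.
Variable E : Om -> Prop.
Hypothesis hE : is_subfield E.

(** After division by the coefficient [c j0] of least value, the residue of the sum is a nontrivial
    combination of the independent residues of the [u j], hence nonzero. So the sum has the value of
    an element of [E]. *)
Lemma fund1 J (u c : J -> Om) j : (forall j, O (u j)) -> indep (rf E) (res \o u) ->
  (forall j, E (c j)) -> c j != 0 ->
  exists j0, [/\ c j0 != 0, U ((\sum_j c j * u j) / c j0) & forall j, O (c j / c j0)].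
Proof.
move=> Ou iu Ec cj; have [j0 c0 h] := omax (P := fun i => c i != 0) cj (fun i h => h).
have Oc i : O (c i / c j0).
  have [->|ci] := eqVneq (c i) 0; [by rewrite mul0r; apply: O0 | exact: h].
exists j0; split=> //; rewrite mulr_suml.
have eE i : c i * u i / c j0 = (c i / c j0) * u i by rewrite mulrAC.
under eq_bigr do rewrite eE.
have Ot i : true -> O ((c i / c j0) * u i) by move=> _; apply: OM.
apply: resU; first exact: O_sum.
rewrite res_sum //; apply/eqP; under eq_bigr do rewrite resM //.
move=> s0; have := iu (fun i => res (c i / c j0)) _ s0 j0.
rewrite divff // res1 => e1; have /eqP : (1 : kappa) = 0; last by rewrite oner_eq0.
apply: e1 => i.
by exists (c i / c j0); split=> //; apply: sf_div.
Qed.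

(** The core of the inequality [e * f <= n]: by [fund1] each inner sum [w i] is 0 or has its value
    in [vE], so the nonzero terms [x i * w i] lie in different classes and [vsum] applies. *)
Lemma fund2 I J (x u : _ -> Om) : (forall i : I, x i != 0) -> inequiv E x ->
  (forall j : J, O (u j)) -> indep (rf E) (res \o u) ->
  indep E (fun ij : I * J => x ij.1 * u ij.2).
Proof.
move=> x0 xd Ou iu c Ec; rewrite sum_pair exchange_big /=.
pose w i := \sum_j c (i, j) * u j.
have wE i : \sum_j c (i, j) * (x i * u j) = x i * w i.
  by rewrite mulr_sumr; apply: eq_bigr => j _; rewrite mulrCA.
under eq_bigr do rewrite wE.
have wP i : w i != 0 -> exists2 e, E e /\ e != 0 & U (w i / e).
  move=> wi; have [j cj] : exists j, c (i, j) != 0.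
    apply: contrapT => h; case/eqP: wi; apply: big1 => j _.
    have [->|cj] := eqVneq (c (i, j)) 0; [by rewrite mul0r | by case: h; exists j].
  have [j0 [h1 h2 _]] := fund1 Ou iu (fun j => Ec (i, j)) cj.
  by exists (c (i, j0)).
move=> /vsum w0; have {}w0 i : w i = 0.
  apply: contrapT => /eqP wi; suff /eqP : x i * w i = 0.
    by rewrite mulf_eq0 (negPf (x0 i)) (negPf wi).
  apply: w0 => k l; rewrite !mulf_eq0 !negb_or => /andP[_ wk] /andP[_ wl] h.
  apply: xd; have [e [Ee e0 he]] := wP _ wk; have [d [Ed d0 hd]] := wP _ wl.
  exists (d / e); split; [exact: sf_div | by rewrite mulf_neq0 ?invr_eq0 |].
  have -> : x k / (x l * (d / e)) = (x k * w k / (x l * w l)) * ((w l / d) / (w k / e)).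
    by field; rewrite x0 wk wl e0 d0.
  by apply: UM => //; apply: Udiv.
move=> [i j]; apply: contrapT => /eqP cj.
have [j0 [h1 /U_neq0 + _]] := fund1 Ou iu (fun j => Ec (i, j)) cj.
by rewrite -/(w i) w0 mul0r eqxx.
Qed.

Lemma fund_le F I J B (x : I -> Om) (u : J -> Om) (b : B -> Om) : is_subfield F ->
  (forall i, F (x i)) -> (forall i, x i != 0) -> inequiv E x ->
  (forall j, F (u j)) -> (forall j, O (u j)) -> indep (rf E) (res \o u) ->
  (forall y, F y -> span E b y) -> (#|I| * #|J| <= #|B|)%N.
Proof.
move=> hF Fx x0 xd Fu Ou iu sb; rewrite -card_prod.
apply: (indep_leq_span hE (fund2 x0 xd Ou iu)) => -[i j]; apply: sb.
exact: sfM.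
Qed.
End OverE.

(* Representatives of vF/vE. *)
Definition vrep E F I (x : I -> Om) :=
  [/\ forall i, F (x i) /\ x i != 0, inequiv E x &
      forall y, F y -> y != 0 -> exists i, scl E y (x i)].

Definition rbasis E F J (u : J -> Om) :=
  [/\ forall j, F (u j), forall j, O (u j) & basis (rf E) (rf F) (res \o u)].

Lemma vindexP E F n : is_subfield E ->
  vindex_eq O E F n <-> exists x : 'I_n -> Om, vrep E F x.
Proof.
move=> hE; split=> [[s [ss sF si sg]]|[x [Fx xi xg]]].
  exists (fun i : 'I_n => s`_i); split=> [i|i j h|y Fy y0].
  - by apply/sF/mem_nth; rewrite ss.
  - by apply: ord_inj; exact: (si i j (ltn_ord i) (ltn_ord j) h).
  - have [z /(nthP 0)[i]] := sg y Fy y0; rewrite ss => lin <- h.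
    by exists (Ordinal lin).
pose s := mkseq (fun i => if insub i is Some j then x j else 0) n.
have sE (j : 'I_n) : s`_j = x j by rewrite nth_mkseq // valK.
exists s; split; first by rewrite size_mkseq.
- by move=> y /(nthP 0)[i]; rewrite size_mkseq => lin <-; rewrite (sE (Ordinal lin)).
- move=> i j li lj; rewrite (sE (Ordinal li)) (sE (Ordinal lj)) => h.
  by have /(congr1 val) := xi _ _ h.
- move=> y Fy y0; have [i h] := xg y Fy y0; exists (x i) => //.
  by rewrite -sE mem_nth // size_mkseq.
Qed.

Lemma vrep_reindex E F I J (x : I -> Om) (f : J -> I) : bijective f ->
  vrep E F x -> vrep E F (x \o f).
Proof.
move=> bf [Fx xi xg]; split=> [j|j k /xi|y Fy y0] //=; first exact: bij_inj.
by have [i h] := xg y Fy y0; have [g fg gf] := bf; exists (g i); rewrite /= gf.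
Qed.

Lemma vrep_vindex E F I (x : I -> Om) : is_subfield E -> vrep E F x -> vindex_eq O E F #|I|.
Proof.
move=> hE vx; apply/(vindexP _ _ hE); exists (x \o enum_val).
by apply: vrep_reindex vx; apply: enum_val_bij.
Qed.

Lemma vrep_leq E F I J (x : I -> Om) (y : J -> Om) : is_subfield E ->
  (forall i, F (x i) /\ x i != 0) -> inequiv E x -> vrep E F y -> (#|I| <= #|J|)%N.
Proof.
move=> hE Fx xi [Fy yi yg].
have /choice[f fP] i : exists j, scl E (x i) (y j) by apply: yg; case: (Fx i).
apply: (leq_card f) => i k e; apply: xi; apply: (scl_trans hE (fP i)).
by rewrite e; apply: scl_sym.
Qed.

Lemma vrep_card E F I J (x : I -> Om) (y : J -> Om) : is_subfield E ->
  vrep E F x -> vrep E F y -> #|I| = #|J|.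
Proof.
move=> hE vx vy; apply/eqP; rewrite eqn_leq; have [Fx xi _] := vx; have [Fy yi _] := vy.
by rewrite (vrep_leq hE Fx xi vy) (vrep_leq hE Fy yi vx).
Qed.

Lemma vindex_card E F n I (x : I -> Om) : is_subfield E ->
  vindex_eq O E F n -> vrep E F x -> #|I| = n.
Proof.
by move=> hE /(vindexP _ _ hE)[y vy] vx; rewrite (vrep_card hE vx vy) card_ord.
Qed.

Lemma inequiv_option E I (x : I -> Om) y : is_subfield E -> inequiv E x ->
  (forall i, ~ scl E y (x i)) ->
  inequiv E (fun o : option I => if o is Some i then x i else y).
Proof.
move=> hE xi ny [i|] [j|] //= h; first by rewrite (xi _ _ h).
  by case: (ny i); apply: scl_sym.
by case: (ny j).
Qed.

Lemma vrep_exists E F n : is_subfield E ->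
  (forall I (x : I -> Om), (forall i, F (x i) /\ x i != 0) -> inequiv E x -> (#|I| <= n)%N) ->
  exists I, exists x : I -> Om, vrep E F x.
Proof.
move=> hE bd; pose Q m := exists I, exists2 x : I -> Om, #|I| = m &
  (forall i, F (x i) /\ x i != 0) /\ inequiv E x.
have Q0 : exists m, `[< Q m >].
  by exists 0%N; apply/asboolP; exists 'I_0, (fun=> 0); [rewrite card_ord | split=> -[]].
have Qle m : `[< Q m >] -> (m <= n)%N by move/asboolP => [I [v <- [Fv iv]]]; apply: bd iv.
case: (ex_maxnP Q0 Qle) => m /asboolP[I [x cI [Fx xi]]] mmax.
exists I, x; split=> // y Fy y0; apply: contrapT => ny.
have := mmax m.+1; rewrite ltnn => h; suff: false by [].
apply: h; apply/asboolP; exists (option I).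
exists (fun o : option I => if o is Some i then x i else y); first by rewrite card_option cI.
split; first by case.
by apply: inequiv_option => // i h; apply: ny; exists i.
Qed.

Lemma rindep_lift F J (w : J -> kappa) : (forall j, rf F (w j)) ->
  exists u : J -> Om, [/\ forall j, F (u j), forall j, O (u j) & w = res \o u].
Proof.
move=> /choice[u uP]; exists u; split=> [j|j|]; try by case: (uP j).
by apply: funext => j; case: (uP j).
Qed.

Lemma ef_exists E F : finite_ext E F ->
  (exists I, exists x : I -> Om, vrep E F x) /\ (exists J, exists u : J -> Om, rbasis E F u).
Proof.
move=> /finite_extP[hE hF EF [B [b [Fb ib sb]]]]; split.
  apply: (@vrep_exists _ _ #|B|) => // I x Fx xi.
  have := @fund_le E hE F I unit B x (fun=> 1) b hF; rewrite card_unit muln1; apply=> //.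
  - by move=> i; case: (Fx i).
  - by move=> i; case: (Fx i).
  - by move=> _; apply: sf1.
  - by move=> _; apply: O1.
  - by move=> c _; rewrite sum_unit /= res1 mulr1 => c0 [].
have hf := rf_subfield hE.
have [J [w bw]] : exists J, exists w : J -> kappa, basis (rf E) (rf F) w.
  apply: (@basis_exists _ _ hf _ #|B|) => J w Fw iw.
  have [u [Fu Ou wE]] := rindep_lift Fw.
  have := @fund_le E hE F unit J B (fun=> 1) u b hF; rewrite card_unit mul1n; apply=> //.
  - by move=> _; apply: sf1.
  - by move=> _; apply: oner_neq0.
  - by move=> [] [].
  - by rewrite -wE.
have [Fw _ _] := bw; have [u [Fu Ou wE]] := rindep_lift Fw.
by exists J, u; split=> //; rewrite -wE.
Qed.

(** The two families already account for the whole degree, so by the fundamental inequality there is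
    no room for one more class or one more independent residue; both families are therefore
    complete. Defectlessness is established below by exhibiting such families. *)
Lemma deflI E F I J (x : I -> Om) (u : J -> Om) n : finite_ext E F -> degree_eq E F n ->
  (forall i, F (x i)) -> (forall i, x i != 0) -> inequiv E x ->
  (forall j, F (u j)) -> (forall j, O (u j)) -> indep (rf E) (res \o u) ->
  (n <= #|I| * #|J|)%N ->
  [/\ defectless_fin O res E F, vrep E F x & rbasis E F u].
Proof.
move=> fF dn Fx x0 xi Fu Ou iu le.
have /finite_extP[hE hF EF [B [b bb]]] := fF; have [_ _ sb] := bb.
have hf := rf_subfield hE.
have cB := degree_eqP hE dn bb; rewrite -cB in dn le.
have B0 : (0 < #|B|)%N.
  exact: (span1_gt0 (sb 1 (sf1 hF))).
have [IJ0 eB] : (0 < #|I| * #|J|)%N /\ (#|I| * #|J|)%N = #|B|.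
  split; first exact: leq_trans le.
  by apply/eqP; rewrite eqn_leq le (fund_le hE hF Fx x0 xi Fu Ou iu sb).
move: IJ0; rewrite muln_gt0 => /andP[I0 J0].
have vx : vrep E F x.
  split=> [i|//|y Fy y0]; first by split.
  apply: contrapT => ny.
  have xi' : inequiv E (fun o : option I => if o is Some i then x i else y).
    by apply: inequiv_option => // i h; apply: ny; exists i.
  have := fund_le hE hF _ _ xi' Fu Ou iu sb.
  rewrite card_option mulSn eB -[X in (_ <= X)%N]add0n leq_add2r leqNgt J0 => h.
  by suff: false by []; apply: h; case=> *; rewrite ?Fu ?x0.
have bu : basis (rf E) (rf F) (res \o u).
  split=> // [j|c Fc]; first by exists (u j).
  apply: contrapT => nc; have [y [Fy Oy yE]] := Fc.
  have iu' : indep (rf E) (res \o (fun o : option J => if o is Some j then u j else y)).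
    have := indep_option hf iu nc; rewrite -yE => h d Ed; rewrite sum_option => s0.
    by apply: h => //; rewrite sum_option.
  have := fund_le hE hF Fx x0 xi _ _ iu' sb.
  rewrite card_option mulnS eB -[X in (_ <= X)%N]add0n leq_add2r leqNgt I0 => h.
  by suff: false by []; apply: h; case=> *; rewrite ?Fu ?x0.
split=> //; exists #|B|, #|I|, #|J|; split=> //.
- exact: (vrep_vindex hE vx).
- exact: (degree_card hf bu).
Qed.

Lemma deflE E F I J B (x : I -> Om) (u : J -> Om) (b : B -> Om) : is_subfield E ->
  defectless_fin O res E F -> vrep E F x -> rbasis E F u -> basis E F b ->
  #|B| = (#|I| * #|J|)%N.
Proof.
move=> hE [n [e [f [dn de df nE]]]] vx [_ _ bu] bb.
have -> : #|B| = n by exact: (degree_eqP hE dn bb).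
rewrite nE (vindex_card hE de vx).
by rewrite (degree_eqP (rf_subfield hE) df bu).
Qed.

Lemma vrep_tower E F M I J (x : I -> Om) (y : J -> Om) : is_subfield E -> is_subfield M ->
  Defs.subset E F -> Defs.subset F M -> is_subfield F ->
  vrep E F x -> vrep F M y -> vrep E M (fun ij : I * J => x ij.1 * y ij.2).
Proof.
move=> hE hM EF FM hF [Fx xi xg] [My yi yg]; split=> [[i j]|[i j] [k l] /= h|z Mz z0] /=.
- have [Fi i0] := Fx i; have [Mj j0] := My j; split; last exact: mulf_neq0.
  by apply: sfM => //; apply: FM.
- have jl : j = l.
    apply: yi; have := scl_div hF (sclS EF h)
      (scl_trans hF (scl_base (Fx i).1 (Fx i).2) (scl_sym hF (scl_base (Fx k).1 (Fx k).2))).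
    by rewrite ![x _ * y _]mulrC !mulfK ?(Fx _).2.
  congr (_, _) => //; apply: xi; rewrite jl in h.
  have := scl_div hE h (scl_refl hE (My l).2).
  by rewrite !mulfK ?(My _).2.
- have [j [e [Fe e0 h]]] := yg z Mz z0.
  have [i hi] := xg e Fe e0; exists (i, j) => /=.
  have [_ j0] := My j.
  apply: (scl_trans hE (y := e * y j)); last by apply: scl_mul => //; apply: scl_refl.
  by apply: scl_unit => //; rewrite ?mulf_neq0 // [e * _]mulrC.
Qed.

Lemma rbasis_tower E F M I J (u : I -> Om) (w : J -> Om) : is_subfield E -> is_subfield M ->
  Defs.subset E F -> Defs.subset F M -> is_subfield F ->
  rbasis E F u -> rbasis F M w -> rbasis E M (fun ij : I * J => u ij.1 * w ij.2).
Proof.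
move=> hE hM EF FM hF [Fu Ou bu] [Mw Ow bw]; split=> [[i j]|[i j]|] /=.
- by apply: sfM => //; apply: FM.
- exact: OM.
- have -> : (res \o (fun ij : I * J => u ij.1 * w ij.2)) =
    (fun ij : I * J => (res \o u) ij.1 * (res \o w) ij.2).
    by apply: funext => -[i j]; rewrite /= resM.
  apply: basis_tower bu bw; try exact: rf_subfield; first exact: rfS.
  by move=> c d /(rfS FM) hc hd; apply: sfM => //; apply: rf_subfield.
Qed.

Lemma defl_tower E F M : finite_ext E F -> finite_ext F M ->
  defectless_fin O res E F -> defectless_fin O res F M -> defectless_fin O res E M.
Proof.
move=> f1 f2 d1 d2; have f3 := finite_ext_trans f1 f2.
have /finite_extP[hE hF EF [B [b bb]]] := f1; have /finite_extP[_ hM FM [C [c bc]]] := f2.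
have [[I [x vx]] [J [u ru]]] := ef_exists f1.
have [[I' [x' vx']] [J' [u' ru']]] := ef_exists f2.
have vM := vrep_tower hE hM EF FM hF vx vx'; have uM := rbasis_tower hE hM EF FM hF ru ru'.
have bM : basis E M (fun ij : B * C => b ij.1 * c ij.2).
  by apply: basis_tower bb bc => // y z /FM My Mz; apply: sfM.
exists #|{: B * C}|, #|{: I * I'}|, #|{: J * J'}|; split.
- exact: (degree_card hE bM).
- exact: (vrep_vindex hE vM).
- by case: uM => _ _ h; apply: degree_card h; apply: rf_subfield.
- by rewrite !card_prod (deflE hE d1 vx ru bb) (deflE hF d2 vx' ru' bc) mulnACA.
Qed.

(** Degree, ramification index and residue degree are multiplicative, and [e * f <= n] holds on both
    steps; equality of the products forces equality in each factor. *)
Lemma defl_sub E F M : is_subfield F -> Defs.subset E F -> Defs.subset F M ->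
  finite_ext E M -> defectless_fin O res E M ->
  defectless_fin O res E F /\ defectless_fin O res F M.
Proof.
move=> hF EF FM f3 d3; have [f1 f2] := finite_ext_sub hF EF FM f3.
have /finite_extP[hE _ _ [B [b bb]]] := f1; have /finite_extP[_ hM _ [C [c bc]]] := f2.
have [[I [x vx]] [J [u ru]]] := ef_exists f1.
have [[I' [x' vx']] [J' [u' ru']]] := ef_exists f2.
have vM := vrep_tower hE hM EF FM hF vx vx'; have uM := rbasis_tower hE hM EF FM hF ru ru'.
have bM : basis E M (fun ij : B * C => b ij.1 * c ij.2).
  by apply: basis_tower bb bc => // y z /FM My Mz; apply: sfM.
have := deflE hE d3 vM uM bM; rewrite !card_prod.
have le1 : (#|I| * #|J| <= #|B|)%N.
  have [Fx xi _] := vx; have [Fu Ou [_ iu _]] := ru; have [_ _ sb] := bb.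
  by apply: (fund_le hE hF _ _ xi Fu Ou iu sb) => i; case: (Fx i).
have le2 : (#|I'| * #|J'| <= #|C|)%N.
  have [Fx xi _] := vx'; have [Fu Ou [_ iu _]] := ru'; have [_ _ sb] := bc.
  by apply: (fund_le hF hM _ _ xi Fu Ou iu sb) => i; case: (Fx i).
have B0 : (0 < #|B|)%N.
  by have [_ _ sb] := bb; apply: (span1_gt0 (sb 1 (sf1 hF))).
have C0 : (0 < #|C|)%N.
  by have [_ _ sb] := bc; apply: (span1_gt0 (sb 1 (sf1 hM))).
rewrite mulnACA => e.
have eB : #|B| = (#|I| * #|J|)%N.
  apply/eqP; rewrite eqn_leq le1 andbT -(leq_pmul2r C0) e leq_mul2l le2 orbT //.
have eC : #|C| = (#|I'| * #|J'|)%N.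
  by apply/eqP; rewrite -(eqn_pmul2l B0) e -eB.
have hf := rf_subfield hE; have hf' := rf_subfield hF.
split.
  exists #|B|, #|I|, #|J|; split=> //; [exact: (degree_card hE bb) | exact: (vrep_vindex hE vx) |].
  by case: ru => _ _ h; apply: degree_card h.
exists #|C|, #|I'|, #|J'|; split=> //; [exact: (degree_card hF bc) | exact: (vrep_vindex hF vx') |].
by case: ru' => _ _ h; apply: degree_card h.
Qed.

(* Lagrange: multiplying a system of representatives by y permutes its classes. *)
Lemma vrep_exp E F I (x : I -> Om) y : is_subfield E -> is_subfield F -> vrep E F x ->
  F y -> y != 0 -> scl E (y ^+ #|I|) 1.
Proof.
move=> hE hF [Fx xi xg] Fy y0.
have /choice[s sP] i : exists j, scl E (y * x i) (x j).
  by have [Fi i0] := Fx i; apply: xg; [apply: sfM | apply: mulf_neq0].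
have sI : injective s.
  move=> i j e; apply: xi.
  have h : scl E (y * x i) (y * x j).
    by apply: (scl_trans hE (sP i)); rewrite e; apply: scl_sym.
  have := scl_div hE h (scl_refl hE y0).
  by rewrite ![y * _]mulrC !mulfK.
have h1 : scl E (\prod_i (y * x i)) (\prod_i x i).
  rewrite [X in scl E _ X](reindex_inj sI) /=; exact: scl_prod.
have P0 : \prod_i x i != 0 by apply/prodf_neq0 => i _; case: (Fx i).
have := scl_div hE h1 (scl_refl hE P0).
by rewrite big_split /= prodr_const mulfK // divff.
Qed.
End Fund.

(** * Tame extensions *)

Section Tame.
Variable V : hvf.
Local Notation Om := (hOm V).
Local Notation O := (@hO V).
Local Notation kappa := (hk V).
Local Notation res := (@hres V).
Local Notation K := (@hK V).
Local Notation U := (unitO O).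
Local Notation rf := (resf O res).
Local Notation scl := (same_class O).
Implicit Types (E F M N T : Om -> Prop) (x y z a b : Om) (I J B C : finType).
Implicit Types (f g p q : {poly Om}).

Lemma pred_ext (X : Type) (A B : X -> Prop) : (forall x : X, A x <-> B x) -> A = B.
Proof. by move=> h; apply: funext => x; apply: propext. Qed.

Lemma minpoly_conj E x y g : sfK E -> minpoly E x g -> root g y -> minpoly E y g.
Proof.
move=> kE mg gy; have hE := sfK_sf kE; have [mong Eg gx gm] := mg.
have [h [monh Eh hy hm]] := minpoly_ex hE (alg_all y kE).
suff -> : g = h by split.
have hg := hm g Eg gy; apply/eqP; rewrite -eqp_monic // /eqp hg andbT.
have : root (g %/ h * h) x by rewrite divpK.
rewrite rootM => /orP[kx|]; last exact: gm.
have Ek := po_divp hE Eg Eh; have k0 : g %/ h != 0.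
  by rewrite dvdp_div_eq0 // monic_neq0.
have := dvdp_leq k0 (gm _ Ek kx); rewrite size_divp ?monic_neq0 //.
have := minpoly_gt1 mg; have h1 : (1 < size h)%N.
  rewrite ltnNge; apply/negP => /size1_polyC e; move: hy (monic_neq0 monh).
  by rewrite e rootC polyC_eq0 => /eqP->; rewrite eqxx.
case: (size h) h1 => [|[|k]] // _; case: (size g) => [|m] // _.
by rewrite /= subSS leqNgt ltnS leq_subr.
Qed.

Lemma O_deriv p : poly_over O p -> poly_over O p^`().
Proof. by move=> Op i; rewrite coef_deriv -mulr_natr; apply: OM => //; apply: O_nat. Qed.

Lemma deriv_map_res f : poly_over O f -> (map_poly res f)^`() = map_poly res f^`().
Proof.
move=> Of; apply/polyP => i; rewrite coef_deriv !coef_map_id0 ?res0 // coef_deriv.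
by rewrite res_mulrn.
Qed.

Lemma nU_M x y : O x -> O y -> ~ U x -> ~ U (x * y).
Proof. by move=> Ox Oy nx /(UMl Ox Oy). Qed.

Lemma nU_D x y : O x -> O y -> ~ U x -> ~ U y -> ~ U (x + y).
Proof.
move=> Ox Oy nx ny; apply/(res_eq0 (OD Ox Oy)).
by rewrite resD // !nU_res ?addr0.
Qed.

Lemma prod_nU (s : seq Om) r : (forall b, b \in s -> O (r - b)) ->
  ~ U (\prod_(z <- s) (r - z)) -> exists2 b, b \in s & ~ U (r - b).
Proof.
elim: s => [|z s IH] sO; first by rewrite big_nil => /(_ (U1 V)).
rewrite big_cons => nU; have [Uz|nUz] := pselect (U (r - z)); last first.
  by exists z => //; apply: mem_head.
have [||b bs nb] := IH; last by exists b => //; rewrite inE bs orbT.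
  by move=> b bs; apply: sO; rewrite inE bs orbT.
by move=> Us; apply: nU; apply: UM.
Qed.

Lemma res_eqP x y : O x -> O y -> res x = res y <-> ~ U (x - y).
Proof.
move=> Ox Oy; split=> [e|nU].
  by apply/(res_eq0 (OB Ox Oy)); rewrite resB // e subrr.
by apply/eqP; rewrite -subr_eq0 -resB // nU_res //; apply: OB.
Qed.

(** Uniqueness of the extension enters through [conj_U]: a root [a] of [f] congruent to [r] has all
    its conjugates over [F] congruent to [r]. If [a] had degree at least 2 over [F], two linear
    factors of [f] would be nonunits at [r], which makes [f'(r)] a nonunit. *)
Lemma hensel F f r : sfK F -> f \is monic -> poly_over F f -> poly_over O f ->
  F r -> O r -> ~ U f.[r] -> U f^`().[r] ->
  exists a, [/\ F a, root f a, O a & res a = res r].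
Proof.
move=> kF mf Ff Of Fr Or nUf Uf'; have hF := sfK_sf kF.
have [s fE] := monic_split mf.
have sO b : b \in s -> O b.
  by move=> bs; apply: (O_integral mf Of); rewrite fE root_prod_XsubC.
have [a as_ nUa] : exists2 a, a \in s & ~ U (r - a).
  apply: prod_nU; first by move=> b /sO Ob; apply: OB.
  rewrite -(eq_bigr _ (fun b _ => hornerXsubC b r)) -horner_prod -fE //.
have Oa := sO a as_.
have fa : root f a by rewrite fE root_prod_XsubC.
exists a; split=> //; last by apply/esym/res_eqP.
have [g mg] := minpoly_ex hF (alg_all a kF); have [mong Fg ga gm] := mg.
have [t gE] := monic_split mong.
have tO b : b \in t -> O b /\ ~ U (r - b).
  move=> bt; have gb : root g b by rewrite gE root_prod_XsubC.
  have fb := root_dvdp (gm f Ff fa) gb.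
  split; first by apply: sO; rewrite -root_prod_XsubC -fE.
  move=> Ub; apply: nUa; have mgb := minpoly_conj kF mg gb.
  have Fp : poly_over F (r%:P - 'X) by apply: (poB hF); [apply: (poC hF) | apply: poX].
  have := conj_U kF mgb ga Fp; rewrite !hornerD !hornerN !hornerC !hornerX; exact.
have /dvdpP[k fk] := gm f Ff fa.
(* [t] lists the roots with multiplicity, so degree at least 2 provides [b] and [c] even if [g] is
   inseparable; [b = c] is allowed. *)
case: t gE tO => [|b [|c t]] gE tO.
- by move: ga; rewrite gE big_nil rootC oner_eq0.
- rewrite big_seq1 in gE; have := ga; rewrite gE root_XsubC => /eqP->.
  have := Fg 0%N; rewrite gE coefB coefX coefC sub0r /= => /(sfN hF).
  by rewrite opprK.
have [Ob nb] := tO b (mem_head _ _).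
have [Oc nc] : O c /\ ~ U (r - c) by apply: tO; rewrite inE mem_head orbT.
pose k' := k * \prod_(z <- t) ('X - z%:P).
have fE' : f = ('X - b%:P) * (('X - c%:P) * k').
  by rewrite fk gE !big_cons /k'; ring.
clearbody k'.
have mk' : k' \is monic.
  by have := mf; rewrite fE' !monicMl ?monicXsubC.
have Ok' : poly_over O k'.
  apply: monic_O => // d k'd; apply: (O_integral mf Of).
  by rewrite fE' !rootM k'd !orbT.
suff: ~ U f^`().[r] by [].
have -> : f^`().[r] = (r - b) * ((k'.[r] + (r - c) * k'^`().[r])) + (r - c) * k'.[r].
  rewrite fE' !derivM !derivB !derivX !derivC subr0 !mul1r !hornerE.
  by ring.
have Obr : O (r - b) by apply: OB.
have Ocr : O (r - c) by apply: OB.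
have Okr : O k'.[r] by apply: O_horner.
have Okr' : O k'^`().[r] by apply: O_horner => //; apply: O_deriv.
have Ox : O (k'.[r] + (r - c) * k'^`().[r]) by apply: OD => //; apply: OM.
by apply: nU_D; [apply: OM|apply: OM|apply: nU_M|apply: nU_M].
Qed.

(* a is integral over E and a simple root modulo the maximal ideal. *)
Definition unr E a := exists f, [/\ f \is monic, poly_over E f, root f a,
  forall b, root f b -> O b & U f^`().[a]].

Definition rad E a := exists m : nat, [/\ m%:R != 0 :> kappa, a != 0 & E (a ^+ m)].

(** The two kinds of generators of tame extensions: [unr] elements generate unramified extensions,
    [rad] elements radical ones of exponent prime to the residue characteristic. *)
Definition telt E a := unr E a \/ rad E a.

Lemma teltS E F a : Defs.subset E F -> telt E a -> telt F a.
Proof.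
move=> EF [[f [mf Ef fa fO Uf]]|[m [m0 a0 Em]]]; [left|right].
  by exists f; split=> // i; apply: EF.
by exists m; split=> //; apply: EF.
Qed.

Lemma unr_minpoly E a g : sfK E -> unr E a -> minpoly E a g ->
  (forall b, root g b -> O b) /\ U g^`().[a].
Proof.
move=> kE [f [mf Ef fa fO Uf]] [mg Eg ga gm].
have /dvdpP[h fE] := gm f Ef fa.
have gO b : root g b -> O b by move=> gb; apply: fO; rewrite fE rootM gb orbT.
have mh : h \is monic by have := mf; rewrite fE monicMr.
have Oh : poly_over O h by apply: monic_O => // b hb; apply: fO; rewrite fE rootM hb.
have Og : poly_over O g by apply: monic_O.
have Oa := gO a ga; split=> //; move: Uf.
rewrite fE derivM hornerD !hornerM (eqP ga) mulr0 add0r mulrC.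
by apply: UMl; apply: O_horner => //; apply: O_deriv.
Qed.

Lemma sep_unr E a : sfK E -> unr E a -> sep E a.
Proof.
move=> kE ua; have hE := sfK_sf kE; have [g mg] := minpoly_ex hE (alg_all a kE).
have [_ Ug] := unr_minpoly kE ua mg; have [_ Eg ga _] := mg.
by apply: (sep_simple hE Eg ga); rewrite rootE U_neq0.
Qed.

Lemma prod_U (s : seq Om) z c : O z -> (forall b, b \in s -> O b) -> c \in s ->
  U (\prod_(w <- s) (z - w)) -> U (z - c).
Proof.
move=> Oz sO cs; rewrite (big_rem c cs) /=; apply: UMl; first by apply: OB => //; apply: sO.
rewrite big_seq; apply: O_prod => b /mem_rem bs; apply: OB => //; exact: sO.
Qed.

(** A repeated residue would make a factor [z - c] of the derivative at [z] a nonunit. The cofactor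
    [h] is there for the induction, which moves the linear factors into it one by one. *)
Lemma uniq_res (h : {poly Om}) (t : seq Om) : (forall b, b \in t -> O b) -> poly_over O h ->
  (forall b, b \in t -> U (h * \prod_(z <- t) ('X - z%:P))^`().[b]) -> uniq (map res t).
Proof.
elim: t h => //= z t IH h tO Oh tU.
have tO' b : b \in t -> O b by move=> bt; apply: tO; rewrite inE bt orbT.
have Oz : O z by apply: tO; apply: mem_head.
apply/andP; split; last first.
  apply: (IH (h * ('X - z%:P)) tO') => [|b bt].
    move=> i; rewrite mulrBr coefB coefMX mulrC mul_polyC coefZ.
    by apply: OB; [case: eqP => _; [apply: O0 | apply: Oh] | apply: OM].
  by have := tU b; rewrite inE bt orbT big_cons mulrA; apply.
apply/negP => /mapP[c ct e]; have := tU z (mem_head _ _).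
rewrite big_cons mulrCA derivM derivXsubC mul1r !hornerE subrr mul0r addr0 horner_prod.
under eq_bigr do rewrite hornerXsubC.
rewrite mulrC => Uz; have Uzc : U (z - c).
  apply: (prod_U Oz tO' ct); apply: UMl Uz; last exact: O_horner.
  by rewrite big_seq; apply: O_prod => b /tO' Ob; apply: OB.
by move/(res_eqP Oz (tO' c ct)): e; apply.
Qed.

(** A relation between the residues lifts to a polynomial [Q] over [E] of degree below that of [g]
    with [Q(a)] a nonunit. By conjugation [Q] is a nonunit at all roots of [g], whose residues are
    distinct by [uniq_res], so the reduction of [Q] has too many roots and vanishes. *)
Lemma unr_indep E a g : sfK E -> unr E a -> minpoly E a g ->
  indep (rf E) (res \o (fun i : 'I_(size g).-1 => a ^+ i)).
Proof.
move=> kE ua mg c Ec s0; have hE := sfK_sf kE.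
have [gO Ug] := unr_minpoly kE ua mg; have [mong Eg ga gm] := mg.
have Oa := gO a ga.
have /choice[d dP] i := Ec i.
have [t gE] := monic_split mong.
have st : size t = (size g).-1 by rewrite gE size_prod_XsubC.
pose Q := \poly_(i < (size g).-1) (if insub i is Some j then d j else 0).
have QE i : Q`_i = if insub i is Some j then d j else 0.
  by rewrite coef_poly; case: ltnP => // le; rewrite insubN // -leqNgt.
have EQ : poly_over E Q.
  by move=> i; rewrite QE; case: insubP => [j _ _|_]; [case: (dP j) | apply: sf0].
have OQ : poly_over O Q.
  by move=> i; rewrite QE; case: insubP => [j _ _|_]; [case: (dP j) | apply: O0].
have nUa : ~ U Q.[a].
  apply/(res_eq0 (O_horner OQ Oa)); rewrite -[RHS]s0 horner_poly res_sum => [|i _].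
    apply: eq_bigr => i _ /=; rewrite valK; have [_ Od <-] := dP i.
    by rewrite resM //; apply: OX.
  by apply: OM; [rewrite valK; case: (dP i) | apply: OX].
have tO b : b \in t -> O b by move=> bt; apply: gO; rewrite gE root_prod_XsubC.
have rt b : b \in t -> root (map_poly res Q) (res b).
  move=> bt; have gb : root g b by rewrite gE root_prod_XsubC.
  have Ob := tO b bt; rewrite rootE -res_horner //; apply/eqP; apply: nU_res; first exact: O_horner.
  by move=> Ub; apply: nUa; apply: (conj_U kE (minpoly_conj kE mg gb) ga).
have ut : uniq (map res t).
  apply: (uniq_res (h := 1)) => // [i|b bt].
    by rewrite coef1; case: eqP => _; [apply: O1 | apply: O0].
  rewrite mul1r -gE; apply: (conj_U kE mg) (po_deriv hE Eg) Ug.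
  by rewrite gE root_prod_XsubC.
have Q0 : map_poly res Q = 0.
  apply: contrapT => /eqP Q0; have := max_poly_roots Q0 _ ut.
  rewrite size_map st => h; have : (size (map_poly res Q) <= (size g).-1)%N.
    by rewrite (leq_trans (size_poly _ _)) // size_poly.
  rewrite leqNgt h //; apply/allP => _ /mapP[b bt ->]; exact: rt.
move=> i; have := congr1 (fun p : {poly kappa} => p`_i) Q0.
by rewrite coef0 coef_map_id0 ?res0 // QE valK; case: (dP i) => _ _ ->.
Qed.
End Tame.

Section Tfin.
Variable V : hvf.
Local Notation Om := (hOm V).
Local Notation O := (@hO V).
Local Notation kappa := (hk V).
Local Notation res := (@hres V).
Local Notation K := (@hK V).
Local Notation U := (unitO O).
Local Notation rf := (resf O res).
Local Notation scl := (same_class O).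
Implicit Types (E F M N T : Om -> Prop) (x y z a b : Om) (I J B C : finType).
Implicit Types (f g p q : {poly Om}).

(** Unlike [tame_ext], this tests the extension itself and not its finite subextensions; [tfin_sub]
    shows that they inherit it. *)
Definition tfin E M := [/\ finite_ext E M,
  forall e, vindex_eq O E M e -> @prime_to_charexp kappa e,
  separable_ext (rf E) (rf M) & defectless_fin O res E M].

Lemma prime_to_nat e : e%:R != 0 :> kappa -> @prime_to_charexp kappa e.
Proof. by move=> e0 q qp; rewrite (dvdn_pcharf qp). Qed.

Lemma prime_to_neq0 e : (0 < e)%N -> @prime_to_charexp kappa e -> e%:R != 0 :> kappa.
Proof.
move=> e0 h; rewrite natf_neq0_pchar; apply/pnatP => // q pq qe; rewrite inE /=.
by apply/negP => qk; have := h q qk; rewrite qe.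
Qed.

Lemma vrep_gt0 E F I (x : I -> Om) : is_subfield F -> vrep E F x -> (0 < #|I|)%N.
Proof.
move=> hF [_ _ vg]; have [i _] := vg 1 (sf1 hF) (oner_neq0 _).
by apply/card_gt0P; exists i.
Qed.

Lemma tfin_refl E : is_subfield E -> tfin E E.
Proof.
move=> hE; have hf := rf_subfield hE; have fE := finite_ext_refl hE.
have d1 : degree_eq E E #|{: unit}|.
  apply: (degree_card hE (v := fun=> 1)); split=> [_|c Ec|x Ex].
  - exact: sf1.
  - by rewrite sum_unit mulr1 => e [].
  - by exists (fun=> x) => //; rewrite sum_unit mulr1.
have [dE vE rE] : [/\ defectless_fin O res E E, vrep E E (fun _ : unit => 1) &
   rbasis E E (fun _ : unit => 1)].
  apply: (deflI fE d1) => //; try by move=> _; rewrite ?oner_eq0 //; exact: sf1.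
  - by move=> [] [].
  - by move=> _; apply: O1.
  - by move=> c _; rewrite sum_unit /= res1 mulr1 => c0 [].
  - by rewrite card_unit.
split=> // [e /vindex_card h|].
  by rewrite -(h _ _ hE vE) card_unit; apply: prime_to_nat; rewrite oner_eq0.
by split=> // x rx; apply: sep_base.
Qed.

Lemma tfin_trans E F M : tfin E F -> tfin F M -> tfin E M.
Proof.
move=> [f1 e1 s1 d1] [f2 e2 s2 d2]; have f3 := finite_ext_trans f1 f2.
have /finite_extP[hE hF EF _] := f1; have /finite_extP[_ hM FM _] := f2.
split=> // [e de||]; last exact: defl_tower d1 d2.
  have [[I [x vx]] _] := ef_exists f1; have [[J [y vy]] _] := ef_exists f2.
  have vM := vrep_tower hE hM EF FM hF vx vy.
  rewrite -(vindex_card hE de vM) card_prod; apply: prime_to_nat.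
  have eI := e1 _ (vrep_vindex hE vx); have eJ := e2 _ (vrep_vindex hF vy).
  by rewrite natrM mulf_neq0 //; apply: prime_to_neq0 => //; [apply: vrep_gt0 vx|apply: vrep_gt0 vy].
have [hrE hrF rEF sEF] := s1; have [_ hrM rFM sFM] := s2.
split=> // [x /rEF /rFM //|x Mx].
by apply: (sep_trans hrE hrF) => //; apply: sFM.
Qed.

Lemma tfin_sub E F M : is_subfield F -> Defs.subset E F -> Defs.subset F M -> tfin E M ->
  tfin E F /\ tfin F M.
Proof.
move=> hF EF FM [f3 e3 s3 d3]; have [f1 f2] := finite_ext_sub hF EF FM f3.
have /finite_extP[hE _ _ _] := f1; have /finite_extP[_ hM _ _] := f2.
have [d1 d2] := defl_sub hF EF FM f3 d3.
have [[I [x vx]] _] := ef_exists f1; have [[J [y vy]] _] := ef_exists f2.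
have vM := vrep_tower hE hM EF FM hF vx vy.
have := prime_to_neq0 (vrep_gt0 hM vM) (e3 _ (vrep_vindex hE vM)).
rewrite card_prod natrM mulf_eq0 negb_or => /andP[eI eJ].
have [hrE hrM rEM sEM] := s3; have hrF := rf_subfield hF.
split; split=> //.
- by move=> e de; rewrite -(vindex_card hE de vx); apply: prime_to_nat.
- by split=> // [|z Fz]; [exact: rfS | apply/sEM/(rfS FM)].
- by move=> e de; rewrite -(vindex_card hF de vy); apply: prime_to_nat.
- by split=> // [|z Mz]; [exact: rfS | apply: (sepS (rfS EF)); apply: sEM].
Qed.

Lemma unr_tfin E a : sfK E -> unr E a ->
  tfin E (adj E a) /\ vrep E (adj E a) (fun _ : unit => 1).
Proof.
move=> kE ua; have hE := sfK_sf kE; have [g mg] := minpoly_ex hE (alg_all a kE).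
have [gO Ug] := unr_minpoly kE ua mg; have [mong Eg ga gm] := mg.
have Oa := gO a ga.
have fE := adj_finite hE (alg_all a kE).
have hF := adj_subfield hE (alg_all a kE).
have bb := minpoly_basis hE mg; have dd := degree_card hE bb.
have [dE vE rE] : [/\ defectless_fin O res E (adj E a), vrep E (adj E a) (fun _ : unit => 1) &
   rbasis E (adj E a) (fun i : 'I_(size g).-1 => a ^+ i)].
  apply: (deflI fE dd) => //.
  - by move=> _; apply: sf1.
  - by move=> _; rewrite oner_eq0.
  - by move=> [] [].
  - by move=> i; apply: sfX => //; apply: adj_mem.
  - by move=> i; apply: OX.
  - exact: unr_indep.
  - by rewrite card_unit mul1n.
split=> //; split=> // [e /vindex_card h|].
  by rewrite -(h _ _ hE vE) card_unit; apply: prime_to_nat; rewrite oner_eq0.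
have hrE := rf_subfield hE; split=> //; first exact: rf_subfield; first exact/rfS/adj_sub.
have sa : sep (rf E) (res a).
  have Og := monic_O mong gO.
  apply: (sep_simple hrE (p := map_poly res g)).
  - move=> i; rewrite coef_map_id0 ?res0 //; exists g`_i; split=> //; exact: Og.
  - by rewrite rootE -res_horner // (eqP ga) res0.
  - rewrite deriv_map_res //.
    by rewrite rootE -res_horner //; [apply: res_neq0 | apply: O_deriv].
move=> c Fc; have [_ _ [_ _ sc]] := rE.
apply: (sep_gen hrE (s := [:: res a])) => [y|]; first by rewrite inE => /eqP->.
have [d Ed ->] := sc c Fc; have := adj_subfield hrE (sep_alg sa) => hra.
apply: (sf_sum hra) => i _; apply: sfM => //=; first exact: adj_sub.
by rewrite resX //; apply: sfX => //; apply: adj_mem.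
Qed.

Lemma scl_unit_ext E F x y : sfK E -> vrep E F (fun _ : unit => 1) -> is_subfield F ->
  Defs.subset E F -> scl F x y -> scl E x y.
Proof.
move=> kE [_ _ vg] hF EF [e [Fe e0 h]]; have hE := sfK_sf kE.
have [_ y0] : x != 0 /\ y != 0 by apply: (@scl_neq0 _ F); exists e.
have [_ [d [Ed d0]]] := vg e Fe e0; rewrite mul1r => h'.
exists d; split=> //; have -> : x / (y * d) = x / (y * e) * (e / d).
  by field; rewrite y0 e0 d0.
exact: UM.
Qed.

(** Let [m'] be the order of the value of [a] modulo [vE], and [a ^+ m' = u * c] with [c] in [E] and
    [u] a unit. Then [u ^+ k] lies in [E] for [k = m / m'], so [u] is an unramified step. Over
    [E(u)] the element [a] has degree at most [m'], and its powers below [m'] have different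
    classes, so this second step is totally ramified. *)
Lemma rad_tfin E a : sfK E -> rad E a -> tfin E (adj E a).
Proof.
move=> kE [m [mk a0 Em]]; have hE := sfK_sf kE.
have m_gt0 : (0 < m)%N by case: m mk {Em} => //; rewrite eqxx.
pose P i := (0 < i)%N && `[< scl E (a ^+ i) 1 >].
have exP : exists i, P i.
  exists m; rewrite /P m_gt0; apply/asboolP; apply: scl_base => //.
  by rewrite expf_neq0.
case: (ex_minnP exP) => m' /andP[m'0 /asboolP sm'] mmin.
have m'm : (m' %| m)%N.
  rewrite /dvdn eqn0Ngt; apply/negP => r0.
  have := mmin (m %% m')%N; rewrite leqNgt ltn_mod m'0 => h.
  suff: false by []; apply: h; rewrite /P r0; apply/asboolP.
  have am : scl E (a ^+ m) 1 by apply: scl_base => //; rewrite expf_neq0.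
  have := scl_div hE am (sclX (m %/ m') hE sm').
  have -> : a ^+ m = a ^+ (m %% m') * (a ^+ m') ^+ (m %/ m').
    by rewrite -exprM -exprD addnC [(m' * _)%N]mulnC -divn_eq.
  by rewrite expr1n divr1 mulfK // !expf_neq0.
have [c [Ec c0 Uu]] := sm'; rewrite mul1r in Uu; set u := a ^+ m' / c in Uu.
pose k := (m %/ m')%N; have km : m = (m' * k)%N by rewrite mulnC divnK.
have k0 : (0 < k)%N by rewrite divn_gt0 // dvdn_leq.
have [mk' kk] : m'%:R != 0 :> kappa /\ k%:R != 0 :> kappa.
  by apply/andP; rewrite -negb_or -mulf_eq0 -natrM -km.
have Euk : E (u ^+ k) by rewrite /u expr_div_n -exprM -km; apply: sf_div => //; apply: sfX.
have ur : unr E u.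
  have mf : 'X^k - (u ^+ k)%:P \is monic by apply: monicXnsubC.
  exists ('X^k - (u ^+ k)%:P); split=> //.
  - by apply: poB => //; [apply: poXn | apply: poC].
  - by rewrite rootE !hornerE subrr.
  - move=> b fb; apply: (O_integral mf _ fb) => i; rewrite coefB coefXn coefC.
    by apply: OB; [apply: O_nat | case: eqP => _; [apply/OX/U_O | apply: O0]].
  - rewrite derivB derivC subr0 derivXn hornerMn hornerXn -mulr_natl.
    by apply: UM; [apply: U_nat | apply: UX].
pose E1 := adj E u; have kE1 : sfK E1 by apply: sfK_adj.
have hE1 := sfK_sf kE1; have [t1 v1] := unr_tfin kE ur.
have hF := adj_subfield hE (alg_all a kE).
have EE1 : Defs.subset E E1 by apply: adj_sub.
have E1F : Defs.subset E1 (adj E a).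
  apply: adj_least => //; first exact: adj_sub.
  by apply: sf_div => //; [apply: sfX => //; apply: adj_mem | apply: adj_sub].
have eF : adj E1 a = adj E a.
  apply: pred_ext => x; split; last exact: adjS.
  by apply: adj_least => //; apply: adj_mem.
have E1am : E1 (a ^+ m').
  have -> : a ^+ m' = u * c by rewrite /u mulfVK.
  by apply: sfM => //; [apply: adj_mem | apply: adj_sub].
have t2 : tfin E1 (adj E1 a); last by rewrite -eF; apply: tfin_trans t2.
have [g mg] := minpoly_ex hE1 (alg_all a kE1).
have fE1 := adj_finite hE1 (alg_all a kE1).
have bb := minpoly_basis hE1 mg; have dd := degree_card hE1 bb.
rewrite card_ord in dd.
have sg : ((size g).-1 <= m')%N.
  have [_ _ _ gm] := mg; rewrite -ltnS prednK; last by rewrite ltnW // (minpoly_gt1 mg).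
  have d0 : 'X^m' - (a ^+ m')%:P != 0 by rewrite monic_neq0 // monicXnsubC.
  have := dvdp_leq d0 (gm _ _ _); rewrite size_XnsubC //; apply.
    by apply: poB => //; [apply: poXn | apply: poC].
  by rewrite rootE !hornerE subrr.
have [dE vE rE] : [/\ defectless_fin O res E1 (adj E1 a),
    vrep E1 (adj E1 a) (fun i : 'I_m' => a ^+ i) &
    rbasis E1 (adj E1 a) (fun _ : unit => 1)].
  have aF i : adj E1 a (a ^+ i) by rewrite eF; apply: sfX => //; apply: adj_mem.
  apply: (deflI fE1 dd) => //.
  - by move=> i; rewrite expf_neq0.
  - suff ne (i j : 'I_m') : (i < j)%N -> ~ scl E1 (a ^+ j) (a ^+ i).
      move=> i j h; apply: val_inj; case: (ltngtP i j) => // l; last by case: (ne _ _ l).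
      by case: (ne _ _ l); apply: scl_sym.
    move=> ij h; have := scl_div hE1 h (scl_refl hE1 (expf_neq0 i a0)).
    rewrite divff ?expf_neq0 // -{1}(subnK (ltnW ij)) exprD mulfK ?expf_neq0 // => h'.
    have := mmin (j - i)%N; rewrite /P subn_gt0 ij /= leqNgt.
    rewrite (leq_ltn_trans (leq_subr _ _)) // => h2; suff: false by []; apply: h2.
    by apply/asboolP/(scl_unit_ext kE v1 hE1 EE1).
  - by move=> _; apply: sf1; rewrite eF.
  - by move=> _; apply: O1.
  - by move=> d _; rewrite sum_unit /= res1 mulr1 => d0 [].
  - by rewrite card_unit muln1 card_ord.
split=> // [e /vindex_card h|].
  by rewrite -(h _ _ hE1 vE) card_ord; apply: prime_to_nat.
have hrE := rf_subfield hE1; split=> //; first by apply: rf_subfield; rewrite eF.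
  exact/rfS/adj_sub.
move=> d; have [_ _ [_ _ sc]] := rE => /sc[w Ew ->]; apply: sep_base => //.
by rewrite sum_unit /= res1 mulr1.
Qed.

Lemma telt_tfin E a : sfK E -> telt E a -> tfin E (adj E a).
Proof. by move=> kE [ua|ra]; [case: (unr_tfin kE ua) | apply: rad_tfin]. Qed.

Lemma sep_telt E a : sfK E -> telt E a -> sep E a.
Proof.
move=> kE [|[m [mk a0 Em]]]; first exact: sep_unr.
have hE := sfK_sf kE; have m_gt0 : (0 < m)%N by case: m mk {Em} => //; rewrite eqxx.
apply: (sep_simple hE (p := 'X^m - (a ^+ m)%:P)).
- by apply: poB => //; [apply: poXn | apply: poC].
- by rewrite rootE !hornerE subrr.
- rewrite derivB derivC subr0 derivXn rootE hornerMn hornerXn -mulr_natl.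
  by rewrite mulf_neq0 ?expf_neq0 //; apply/U_neq0/U_nat.
Qed.
End Tfin.

(** * Purely wild extensions and the ramification field *)

Section PurelyWild.
Variable V : hvf.
Local Notation Om := (hOm V).
Local Notation O := (@hO V).
Local Notation kappa := (hk V).
Local Notation res := (@hres V).
Local Notation K := (@hK V).
Local Notation U := (unitO O).
Local Notation rf := (resf O res).
Local Notation scl := (same_class O).
Local Notation ppow := ([pchar kappa].-nat).
Implicit Types (E F M N T : Om -> Prop) (x y z a b : Om) (I J B C : finType).
Implicit Types (f g p : {poly Om}) (q : nat).

(* vF/vE is a p-group and Fv/Ev is purely inseparable. This condition is transitive and, unlike
   linear disjointness, can be checked element by element; see [pw_wild] and [wild_pw]. *)
Definition pw E F := forall x, F x -> x != 0 ->
  exists q c, [/\ ppow q, E c, c != 0 & ou (x ^+ q / c)].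

Lemma pw_trans E F M : pw E F -> pw F M -> pw E M.
Proof.
move=> EF FM x Mx x0; have [q [c [qp Fc c0 oc]]] := FM x Mx x0.
have [r [d [rp Ed d0 od]]] := EF c Fc c0.
exists (q * r)%N, d; split=> //; first by rewrite pnatM qp.
have -> : x ^+ (q * r) / d = (x ^+ q / c) ^+ r * (c ^+ r / d).
  by rewrite expr_div_n exprM mulrA divfK // expf_neq0.
by apply: ouM => //; apply: ouX.
Qed.

Lemma rf_lift_poly E (mu : {poly kappa}) : is_subfield E -> mu \is monic -> poly_over (rf E) mu ->
  exists f, [/\ f \is monic, poly_over E f, poly_over O f & map_poly res f = mu].
Proof.
move=> hE mm Emu; have /choice[d dP] i := Emu i.
pose n := (size mu).-1; have n0 : size mu = n.+1.
  by rewrite prednK // size_poly_gt0 monic_neq0.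
pose f := 'X^n + \poly_(i < n) d i.
have fE i : f`_i = (i == n)%:R + (if (i < n)%N then d i else 0).
  by rewrite coefD coefXn coef_poly.
have mf : f \is monic.
  rewrite monicE lead_coefE (_ : size f = n.+1) /=; last first.
    by rewrite size_polyDl size_polyXn // ltnS size_poly.
  by rewrite fE eqxx ltnn addr0.
exists f; split=> // [i|i|].
- rewrite fE; apply: sfD => //; first exact: sf_nat.
  by case: ifP => _; [case: (dP i) | apply: sf0].
- rewrite fE; apply: OD; first exact: O_nat.
  by case: ifP => _; [case: (dP i) | apply: O0].
apply/polyP => i; rewrite coef_map_id0 ?res0 // fE resD.
- rewrite res_nat; case: ltngtP => [lin|ni|->].
  + by rewrite add0r; case: (dP i).
  + by rewrite add0r res0 nth_default // n0.
  + by rewrite res0 addr0; have := eqP mm; rewrite lead_coefE n0 => ->.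
- exact: O_nat.
- by case: ifP => _; [case: (dP i) | apply: O0].
Qed.

Lemma rf_finite E F : finite_ext E F -> finite_ext (rf E) (rf F).
Proof.
move=> fE; have /finite_extP[hE hF EF _] := fE; have [_ [J [u [_ _ bu]]]] := ef_exists fE.
apply/finite_extP; split; try exact: rf_subfield; first exact: rfS.
by exists J, (res \o u).
Qed.

(** Some power [res u ^+ q] is separable over the residue field of [E]. Hensel's lemma lifts it to a
    root [a] in [F] of a lift of its minimal polynomial; [a] is [unr], hence in [E] by
    assumption. *)
Lemma pw_unit E F u : sfK E -> sfK F -> Defs.subset E F ->
  (forall a, F a -> telt E a -> E a) -> F u -> U u ->
  exists q a, [/\ ppow q, E a & ou (u ^+ q / a)].
Proof.
move=> kE kF EF noT Fu Uu; have hE := sfK_sf kE; have hF := sfK_sf kF.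
have hrE := rf_subfield hE; have Ou := U_O Uu.
have au : alg (rf E) (res u).
  apply: (finite_alg (rf_finite (adj_finite hE (alg_all u kE)))).
  by exists u; split=> //; apply: adj_mem.
have [q qp sq] := sep_exponent hrE au; exists q.
set w := u ^+ q; have Ow : O w by apply: OX.
have rw : res w = res u ^+ q by apply: resX.
have Fw : F w by apply: sfX.
have [mu mmu] := minpoly_ex hrE (sep_alg sq); have mu' := sep_minpoly mmu sq.
have [monmu Emu mur _] := mmu.
have [f [mf Ef Of fE]] := rf_lift_poly hE monmu Emu.
have [a [Fa fa Oa ra]] : exists a, [/\ F a, root f a, O a & res a = res w].
  apply: hensel => //.
  - by move=> i; apply/EF/Ef.
  - by apply/(res_eq0 (O_horner Of Ow)); rewrite res_horner // fE rw; apply/eqP.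
  - apply: resU; first exact/O_horner/Ow/O_deriv.
    by rewrite res_horner //; [rewrite -deriv_map_res // fE rw | apply: O_deriv].
have Ua : U a by apply: resU => //; rewrite ra rw expf_neq0 // res_neq0.
exists a; split=> //; last exact: ou_div_res.
apply: noT => //; left; exists f; split=> // [b fb|]; first exact: O_integral fb.
apply: resU; first exact/O_horner/Oa/O_deriv.
by rewrite res_horner //; [rewrite -deriv_map_res // fE ra rw | apply: O_deriv].
Qed.

(** Write the index of [vE] in the value group of [E(x)] as [q * m], with [q] its p-part, and let
    [y = x ^+ q]. Then [y ^+ m] is a unit [u] times some [c] of [E], and by [pw_unit] a power
    [u ^+ r] is some [a] of [E] times a 1-unit [w]. As [m] is prime to the residue characteristic,
    Hensel's lemma gives an [m]-th root [b] of [w] that is a 1-unit of [F]. Then [z = y ^+ r / b]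
    satisfies [z ^+ m = c ^+ r * a], so it is a radical element, which the hypothesis puts into
    [E]. *)
Lemma pw_lemma E F : sfK E -> sfK F -> Defs.subset E F ->
  (forall a, F a -> telt E a -> E a) -> pw E F.
Proof.
move=> kE kF EF noT x Fx x0; have hE := sfK_sf kE; have hF := sfK_sf kF.
have fE := adj_finite hE (alg_all x kE); have [_ hx _ _] := fE.
have [[I [v vI]] _] := ef_exists fE.
have n0 := vrep_gt0 hx vI; set n := #|I| in n0.
have nE := partnC [pchar kappa] n0.
set q := (n`_[pchar kappa])%N in nE; set m := (n`_[pchar kappa]^')%N in nE.
have qp : ppow q by apply: part_pnat.
have m0 : m%:R != 0 :> kappa by rewrite natf_neq0_pchar; apply: part_pnat.
set y := x ^+ q; have y0 : y != 0 by apply: expf_neq0.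
have Fy : F y by apply: sfX.
have [c [Ec c0]] := vrep_exp hE hx vI (adj_mem x hE) x0.
rewrite -/n -nE exprM mul1r -/y; set u := y ^+ m / c => Uu.
have Fu : F u by apply: sf_div; [|apply: sfX|apply: EF].
have [r [a [rp Ea oa]]] := pw_unit kE kF EF noT Fu Uu.
set w := u ^+ r / a in oa; have Fw : F w by apply: sf_div; [|apply: sfX|apply: EF].
have a0 : a != 0 by have := U_neq0 (ou_U oa); rewrite mulf_eq0 negb_or invr_eq0 => /andP[].
have m_gt0 : (0 < m)%N by apply: part_gt0.
have [b [Fb fb Ob rb]] : exists b, [/\ F b, root ('X^m - w%:P) b, O b & res b = res 1].
  have [Ow rw] := oa; apply: hensel => //.
  - exact: monicXnsubC.
  - by apply: poB => //; [apply: poXn | apply: poC].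
  - by move=> i; rewrite coefB coefXn coefC; apply: OB; [apply: O_nat | case: eqP => _ //; apply: O0].
  - exact: sf1.
  - exact: O1.
  - rewrite !hornerE expr1n; apply/res_eqP => //; first exact: O1.
    by rewrite res1 rw.
  - by rewrite derivB derivC subr0 derivXn hornerMn hornerXn expr1n; apply: U_nat.
move: fb; rewrite rootE !hornerE subr_eq0 => /eqP bm.
have ob : ou b by split=> //; rewrite rb res1.
have b0 := U_neq0 (ou_U ob).
pose z := y ^+ r / b; have z0 : z != 0 by rewrite mulf_neq0 ?expf_neq0 ?invr_eq0.
have Fz : F z by apply: sf_div => //; apply: sfX.
exists (q * r)%N, z; split=> //; first by rewrite pnatM qp.
  apply: noT => //; right; exists m; split=> //.
  have u0 := U_neq0 Uu.
  have -> : z ^+ m = c ^+ r * a.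
    rewrite /z expr_div_n bm -exprM mulnC exprM /w invfM invrK.
    have -> : y ^+ m = u * c by rewrite /u divfK.
    by rewrite exprMn; field; rewrite expf_neq0.
  by apply: sfM => //; apply: sfX.
have -> : x ^+ (q * r) / z = b by rewrite exprM -/y /z invfM invrK mulrA divff ?mul1r // expf_neq0.
exact: ob.
Qed.

(** Otherwise 1 and [c] are independent over [k], and by [insep_sep_indep] they stay so with
    coefficients separable over [k]; but [c] is such a coefficient, and [- c * 1 + 1 * c = 0]. *)
Lemma insep_sep_base (L : fieldType) (k : L -> Prop) (c : L) q : is_subfield k ->
  [pchar L].-nat q -> k (c ^+ q) -> sep k c -> k c.
Proof.
move=> hk qp kq sc; apply: contrapT => nc.
have i1 : indep k (fun _ : unit => 1 : L).
  by move=> d _; rewrite sum_unit mulr1 => d0 [].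
have nsp : ~ span k (fun _ : unit => 1 : L) c.
  by move=> [d kd]; rewrite sum_unit mulr1 => e; apply: nc; rewrite e.
have i2 := indep_option hk i1 nsp.
have qo (o : option unit) : k ((if o is Some _ then 1 else c) ^+ q).
  by case: o => [_|] //; rewrite expr1n; apply: sf1.
have i3 := insep_sep_indep (C := sep k) hk qp qo (fun c h => h) i2.
have /eqP : (1 : L) = 0; last by rewrite oner_eq0.
apply: (i3 (fun o => if o is Some _ then - c else 1) _ _ None) => [[_|]|].
- apply: (sep_gen hk (s := [:: c])) => [y|]; first by rewrite inE => /eqP->.
  by apply: sfN; [apply: adj_subfield => //; apply: sep_alg | apply: adj_mem].
- by apply: sep_base => //; apply: sf1.
- by rewrite sum_option sum_unit mul1r mulr1 subrr.
Qed.

Lemma scl_coprime E y m q : is_subfield E -> y != 0 -> (0 < q)%N -> coprime q m ->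
  scl E (y ^+ q) 1 -> scl E (y ^+ m) 1 -> scl E y 1.
Proof.
move=> hE y0 q0 /(coprimeP _ q0)[[u v] /= e] hq hm.
have lt : (v * m < u * q)%N by rewrite -subn_gt0 e.
have := scl_div hE (sclX u hE hq) (sclX v hE hm).
rewrite !expr1n divr1 -!exprM [(q * u)%N]mulnC [(m * v)%N]mulnC.
by rewrite -{1}(subnK (ltnW lt)) e exprD expr1 mulfK // expf_neq0.
Qed.

Lemma ppow_coprime q m : ppow q -> m%:R != 0 :> kappa -> coprime q m.
Proof. by rewrite natf_neq0_pchar => qp mp; apply: pnat_coprime qp mp. Qed.

Lemma ppow_gt0 q : ppow q -> (0 < q)%N. Proof. by case/andP. Qed.

Lemma pw_res E F c : is_subfield E -> pw E F -> rf F c -> exists2 q, ppow q & rf E (c ^+ q).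
Proof.
move=> hE pwEF [u [Fu Ou <-]]; have [r0|r0] := eqVneq (res u) 0.
  by exists 1%N => //; rewrite r0 expr1; apply: (sf0 (rf_subfield hE)).
have Uu := resU Ou r0; have [q [d [qp Ed d0 od]]] := pwEF u Fu (U_neq0 Uu).
exists q => //; exists d.
have Ud : U d.
  have -> : d = u ^+ q / (u ^+ q / d) by rewrite invfM invrK mulrA divff ?mul1r // expf_neq0 // U_neq0.
  by apply: Udiv; [apply: UX | apply: ou_U].
split=> //; first exact: U_O.
have -> : res u ^+ q = res (u ^+ q) by rewrite resX.
have -> : u ^+ q = (u ^+ q / d) * d by rewrite divfK.
by rewrite resM ?od.2 ?mul1r //; [apply: od.1 | apply: U_O].
Qed.

Lemma pw_scl E F x : is_subfield E -> pw E F -> F x -> x != 0 ->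
  exists2 q, ppow q & scl E (x ^+ q) 1.
Proof.
move=> hE pwEF Fx x0; have [q [c [qp Ec c0 oc]]] := pwEF x Fx x0; exists q => //.
apply: (scl_trans hE (scl_unit hE c0 (ou_U oc))); exact: scl_base.
Qed.

(** Every class in [vT/vE] has both p-power order and order prime to [p], so the ramification index
    is 1. The residue extension is separable and purely inseparable, hence trivial. Without defect
    the degree is then 1. *)
Lemma tfin_pw_eq E T : tfin E T -> pw E T -> Defs.subset T E.
Proof.
move=> [fE eE sE dE] pwE; have /finite_extP[hE hT ET [B [b bb]]] := fE.
have [[I [x vx]] _] := ef_exists fE; have hrE := rf_subfield hE; have hrT := rf_subfield hT.
have v1 : vrep E T (fun _ : unit => 1).
  split=> [_|[] [] //|y Ty y0]; first by rewrite oner_eq0; split=> //; apply: sf1.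
  exists tt; have [q qp yq] := pw_scl hE pwE Ty y0.
  have m0 := prime_to_neq0 (vrep_gt0 hT vx) (eE _ (vrep_vindex hE vx)).
  exact: (scl_coprime hE y0 (ppow_gt0 qp) (ppow_coprime qp m0) yq (vrep_exp hE hT vx Ty y0)).
have r1 : rbasis E T (fun _ : unit => 1).
  split=> [i|i|]; [exact: sf1 | exact: O1 | split=> [i|d _|c Tc]].
  - by rewrite /= res1; apply: (sf1 hrT).
  - by rewrite sum_unit /= res1 mulr1 => d0 [].
  - exists (fun=> c) => [_|]; last by rewrite sum_unit /= res1 mulr1.
    have [q qp cq] := pw_res hE pwE Tc.
    by apply: insep_sep_base cq _ => //; case: sE => _ _ _; apply.
have := deflE hE dE v1 r1 bb; rewrite card_unit => cB y Ty; apply: contrapT => nE.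
have i1 : indep E (fun _ : unit => 1 : Om).
  by move=> d _; rewrite sum_unit mulr1 => d0 [].
have nsp : ~ span E (fun _ : unit => 1 : Om) y.
  by move=> [d kd]; rewrite sum_unit mulr1 => e; apply: nE; rewrite e.
have := indep_leq_span hE (indep_option hE i1 nsp) (w := b).
rewrite card_option card_unit cB => h; suff: false by []; apply: h => o.
by have [_ _ sb] := bb; apply: sb; case: o => [_|] //; apply: sf1.
Qed.

(* kr E below is the union of all towers of [telt] steps; [Kr_kr] identifies it with K^r. *)
Fixpoint tchain E (s : seq Om) : Prop :=
  if s is a :: t then telt E a /\ tchain (adj E a) t else True.

Lemma tchain_tfin E s : sfK E -> tchain E s -> tfin E (adjs E s).
Proof.
elim: s E => [|a s IH] E kE /=; first by move=> _; apply: tfin_refl; apply: sfK_sf.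
by move=> [ta ts]; apply: (tfin_trans (telt_tfin kE ta)); apply: IH => //; apply: sfK_adj.
Qed.

Lemma tchain_sep E s x : sfK E -> tchain E s -> adjs E s x -> sep E x.
Proof.
elim: s E => [|a s IH] E kE /=; first by move=> _; apply: sep_base; apply: sfK_sf.
move=> [ta ts] sx; have hE := sfK_sf kE; have kEa := sfK_adj a kE.
apply: (sep_adjs hE (s := [:: a])) => [y|]; last exact: IH.
by rewrite inE => /eqP->; apply: sep_telt.
Qed.

Lemma tchainS E F s : Defs.subset E F -> tchain E s -> tchain F s.
Proof.
elim: s E F => //= a s IH E F EF [ta ts]; split; first exact: teltS ta.
by apply: IH ts; apply: adjS.
Qed.

Lemma tchain_cat E s t : tchain E s -> tchain (adjs E s) t -> tchain E (s ++ t).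
Proof. by elim: s E => //= a s IH E [ta ts] tt; split=> //; apply: IH. Qed.

(** Induction on the degree: as long as [T] contains an element [a] outside [E] with [telt E a], it
    is adjoined; when none is left, [pw_lemma] makes [T] purely wild and [tfin_pw_eq] makes it
    trivial. *)
Lemma tfin_chain E T : sfK E -> tfin E T -> exists2 s, tchain E s & T = adjs E s.
Proof.
move=> kE tT; have [[hE hT ET [n dn]] _ _ _] := tT.
elim: n {-2}n (leqnn n) E kE tT hE ET dn => [|m IH] n nm E kE tT hE ET dn.
  have /(degreeP _ _ hE)[b [_ _ sb]] := dn; have := span1_gt0 (sb 1 (sf1 hT)).
  by rewrite card_ord ltnNge nm.
have [[a [Ta ta nEa]]|no] := pselect (exists a, [/\ T a, telt E a & ~ E a]); last first.
  exists [::] => //=; apply: pred_ext => x; split; last exact: ET.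
  apply: (tfin_pw_eq tT); apply: pw_lemma => //; first exact: sfK_sub kE hT ET.
  by move=> a Ta ta; apply: contrapT => nEa; apply: no; exists a.
have kEa := sfK_adj a kE; have hEa := sfK_sf kEa.
have EaT : Defs.subset (adj E a) T by apply: adj_least.
have EEa : Defs.subset E (adj E a) by apply: adj_sub.
have [t1 t2] := tfin_sub hEa EEa EaT tT; have [[_ _ _ [k dk]] _ _ _] := t2.
have [[_ _ _ [l dl]] _ _ _] := t1; have [f1 _ _ _] := t1; have [f2 _ _ _] := t2.
have [|s ts ->] := IH k _ _ kEa t2 hEa EaT dk; last by exists (a :: s).
have d3 := degree_tower f1 f2 dl dk.
have nE : n = (l * k)%N.
  have /(degreeP _ _ hE)[b bb] := dn; have /(degreeP _ _ hE)[b' bb'] := d3.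
  by have := basis_card hE bb bb'; rewrite !card_ord.
have l2 : (1 < l)%N.
  have /(degreeP _ _ hE)[b [_ _ sb]] := dl.
  have i1 : indep E (fun _ : unit => 1 : Om) by move=> d _; rewrite sum_unit mulr1 => d0 [].
  have nsp : ~ span E (fun _ : unit => 1 : Om) a.
    by move=> [d kd]; rewrite sum_unit mulr1 => e; apply: nEa; rewrite e.
  have := indep_leq_span hE (indep_option hE i1 nsp) (w := b).
  rewrite card_option card_unit card_ord; apply=> o; apply: sb.
  by case: o => [_|]; [apply: sf1 | apply: adj_mem].
have k0 : (0 < k)%N.
  have /(degreeP _ _ hEa)[b [_ _ sb]] := dk.
  by have := span1_gt0 (sb 1 (sf1 hT)); rewrite card_ord.
rewrite -ltnS; apply: leq_trans nm; rewrite nE.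
by rewrite -[X in (X < _)%N]mul1n ltn_pmul2r.
Qed.

Lemma tfin_tame E T : tfin E T -> tame_ext O res E T.
Proof.
move=> tT; have [[hE hT ET _] _ _ _] := tT; split.
  by split=> // x Tx; case: tT => fT _ _ _; apply: finite_alg fT Tx.
move=> M [_ hM EM _] MT; have [[_ e1 s1 d1] _] := tfin_sub hM EM MT tT.
by split.
Qed.

Definition kr E x := exists2 s, tchain E s & adjs E s x.

Lemma tame_kr E T : sfK E -> tame_ext O res E T -> Defs.subset T (kr E).
Proof.
move=> kE [[hE hT ET _] tT] x Tx; have fE := adj_finite hE (alg_all x kE).
have [e s d] := tT _ fE (adj_least hT ET Tx).
have [t ct tE] := tfin_chain kE (And4 fE e s d).
by exists t => //; rewrite -tE; apply: adj_mem.
Qed.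

Lemma Kr_kr E : sfK E -> Kr O res E = kr E.
Proof.
move=> kE; apply: pred_ext => x; split=> [[T [tT Tx]]|[s cs sx]]; first exact: tame_kr Tx.
by exists (adjs E s); split=> //; apply: tfin_tame; apply: tchain_tfin.
Qed.

Section Kr.
Variable E : Om -> Prop.
Hypothesis kE : sfK E.
Let hE := sfK_sf kE.

Lemma kr_seq (s : seq Om) : (forall x, x \in s -> kr E x) ->
  exists2 t, tchain E t & forall x, x \in s -> adjs E t x.
Proof.
elim: s => [|x s IH] sk; first by exists [::].
have [t ct tP] : exists2 t, tchain E t & forall x, x \in s -> adjs E t x.
  by apply: IH => y ys; apply: sk; rewrite inE ys orbT.
have [u cu ux] := sk x (mem_head _ _).
have Eu : Defs.subset E (adjs E u) by case: (tchain_tfin kE cu) => -[].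
have ku := sfK_adjs u kE; have cut := tchainS Eu ct.
exists (u ++ t); first exact: tchain_cat.
move=> y; rewrite adjs_cat inE => /predU1P[->|ys].
  by have [[_ _ h _] _ _ _] := tchain_tfin ku cut; apply: h.
exact/(adjsS Eu)/tP.
Qed.

Lemma kr_base : Defs.subset E (kr E).
Proof. by move=> x Ex; exists [::]. Qed.

Lemma kr_subfield : is_subfield (kr E).
Proof.
have kr2 x y : kr E x -> kr E y -> exists2 t, tchain E t & adjs E t x /\ adjs E t y.
  move=> kx ky; have [z|t ct tP] := @kr_seq [:: x; y].
    by rewrite !inE => /orP[] /eqP->.
  by exists t => //; split; apply: tP; rewrite !inE eqxx ?orbT.
apply: (ring_subfield hE); first exact: kr_base.
- move=> x y kx ky; have [t ct [tx ty]] := kr2 x y kx ky; exists t => //.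
  by apply: sfB => //; apply: (sfK_sf (sfK_adjs t kE)).
- move=> x y kx ky; have [t ct [tx ty]] := kr2 x y kx ky; exists t => //.
  by apply: sfM => //; apply: (sfK_sf (sfK_adjs t kE)).
- by move=> x _; apply: alg_all.
Qed.

Lemma kr_sfK : sfK (kr E).
Proof. exact: sfK_sub kE kr_subfield kr_base. Qed.

(** Only finitely many elements of [kr E] occur in the condition [telt], so it already holds over
    one finite tower, which [a] prolongs. *)
Lemma kr_telt a : telt (kr E) a -> kr E a.
Proof.
move=> ta; suff [t ct tta] : exists2 t, tchain E t & telt (adjs E t) a.
  exists (t ++ [:: a]); first by apply: tchain_cat => //=.
  by rewrite adjs_cat /=; apply: adj_mem; apply: (sfK_sf (sfK_adjs t kE)).
case: ta => [[f [mf Ef fa fO Uf]]|[m [m0 a0 Em]]].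
  have [x /(nthP 0)[i _ <-]|t ct tP] := @kr_seq f; first exact: Ef.
  exists t => //; left; exists f; split=> // i; have [ip|ip] := ltnP i (size f).
    by apply: tP; apply: mem_nth.
  by rewrite nth_default //; apply: sf0; apply: (sfK_sf (sfK_adjs t kE)).
have [x|t ct tP] := @kr_seq [:: a ^+ m]; first by rewrite inE => /eqP->.
by exists t => //; right; exists m; split=> //; apply/tP/mem_head.
Qed.

Lemma kr_chain F s : Defs.subset F (kr E) -> tchain F s -> Defs.subset (adjs F s) (kr E).
Proof.
elim: s F => //= a s IH F FE [ta ts]; apply: IH => //.
by apply: adj_least => //; [exact: kr_subfield | apply: kr_telt; apply: teltS ta].
Qed.

Lemma kr_idem N : sfK N -> Defs.subset E N -> Defs.subset N (kr E) -> kr N = kr E.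
Proof.
move=> kN EN NE; apply: pred_ext => x; split=> [[s cs sx]|[s cs sx]]; first exact: kr_chain cs _ sx.
by exists s; [apply: tchainS cs | apply: adjsS sx].
Qed.

Lemma kr_sep x : kr E x -> sep E x.
Proof. by move=> [s cs sx]; apply: tchain_sep cs sx. Qed.

Lemma kr_finite M : finite_ext E M -> Defs.subset M (kr E) -> tfin E M.
Proof.
move=> fM ME; have [s sM MP] := finite_gen fM; have [_ hM EM _] := fM.
have [x xs|t ct tP] := @kr_seq s; first exact/ME/sM.
have [[_ ht Et _] _ _ _] := tchain_tfin kE ct.
have Mt : Defs.subset M (adjs E t).
  by move=> x /MP; apply: adjs_least.
by have [] := tfin_sub hM EM Mt (tchain_tfin kE ct).
Qed.

Lemma kr_tame : tame_ext O res E (kr E).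
Proof.
split; first by split; [| exact: kr_subfield | exact: kr_base | move=> x _; apply: alg_all].
by move=> M fM ME; have [_ ? ? ?] := kr_finite fM ME; split.
Qed.
End Kr.
End PurelyWild.

(** * Moving defectlessness along tame extensions *)

Section Transfer.
Variable V : hvf.
Local Notation Om := (hOm V).
Local Notation O := (@hO V).
Local Notation kappa := (hk V).
Local Notation res := (@hres V).
Local Notation K := (@hK V).
Local Notation U := (unitO O).
Local Notation rf := (resf O res).
Local Notation scl := (same_class O).
Local Notation ppow := ([pchar kappa].-nat).
Implicit Types (E F M N T W : Om -> Prop) (x y z a b : Om) (I J B C D : finType).
Implicit Types (f g p : {poly Om}) (q : nat).

Lemma kr_scl E c : sfK E -> kr E c -> c != 0 ->
  exists2 m : nat, m%:R != 0 :> kappa & scl E (c ^+ m) 1.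
Proof.
move=> kE [s cs sc] c0; have [fT eT _ _] := tchain_tfin kE cs.
have [hE hT _ _] := fT; have [[I [x vx]] _] := ef_exists fT.
exists #|I|; last exact: vrep_exp vx sc c0.
exact: prime_to_neq0 (vrep_gt0 hT vx) (eT _ (vrep_vindex hE vx)).
Qed.

Lemma kr_rsep E c : sfK E -> rf (kr E) c -> sep (rf E) c.
Proof.
move=> kE [x [[s cs sx] Ox <-]]; have [_ _ [_ _ _ sT] _] := tchain_tfin kE cs.
by apply: sT; exists x.
Qed.

(** The class of [z] modulo [vE] has p-power order because [z] lies in [W], and order prime to [p]
    because it is the class of [c]. *)
Lemma pw_kr_scl E W z c : sfK E -> pw E W -> W z -> kr E c -> z != 0 -> c != 0 ->
  scl E z c -> scl E z 1.
Proof.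
move=> kE pwW Wz kc z0 c0 zc; have hE := sfK_sf kE.
have [q qp zq] := pw_scl hE pwW Wz z0; have [m m0 cm] := kr_scl kE kc c0.
apply: (scl_coprime hE z0 (ppow_gt0 qp) (ppow_coprime qp m0) zq).
exact: scl_trans (sclX m hE zc) cm.
Qed.

Lemma scl_ratio E x y : is_subfield E -> x != 0 -> y != 0 -> scl E (x / y) 1 -> scl E x y.
Proof.
move=> hE x0 y0 h; have := scl_mul hE h (scl_refl hE y0).
by rewrite divfK // mul1r.
Qed.

Lemma inequiv_pw_kr E W I (x : I -> Om) : sfK E -> sfK W -> pw E W -> (forall i, W (x i)) ->
  (forall i, x i != 0) -> inequiv E x -> inequiv (kr E) x.
Proof.
move=> kE kW pwW Wx x0 xi i j [c [kc c0 h]]; apply: xi; have hE := sfK_sf kE.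
apply: (scl_ratio hE) => //; apply: (pw_kr_scl kE pwW _ kc) => //.
- by apply: sf_div; first exact: sfK_sf kW.
- by rewrite mulf_neq0 ?invr_eq0.
- apply: scl_unit => //; have -> : x i / x j / c = x i / (x j * c) by rewrite invfM mulrA.
  by [].
Qed.

Lemma inequiv_kr_pw E W I (x : I -> Om) : sfK E -> pw E W -> (forall i, kr E (x i)) ->
  (forall i, x i != 0) -> inequiv E x -> inequiv W x.
Proof.
move=> kE pwW kx x0 xi i j [z [Wz z0 h]]; apply: xi; have hE := sfK_sf kE.
have k0 : x i / x j != 0 by rewrite mulf_neq0 ?invr_eq0.
have zc : scl E z (x i / x j).
  apply: scl_sym => //; apply: scl_unit => //.
  by have -> : x i / x j / z = x i / (x j * z) by rewrite invfM mulrA.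
apply: (scl_ratio hE) => //; apply: (scl_trans hE (scl_sym hE zc)).
apply: (pw_kr_scl kE pwW Wz _ z0 k0 zc).
by apply: sf_div => //; apply: kr_subfield.
Qed.

Lemma pw_rf_common E W J (a : J -> kappa) : is_subfield E -> pw E W -> (forall j, rf W (a j)) ->
  exists2 q, ppow q & forall j, rf E (a j ^+ q).
Proof.
move=> hE pwW Wa.
have /choice[q qP] j : exists q, ppow q /\ rf E (a j ^+ q).
  by have [q qp h] := pw_res hE pwW (Wa j); exists q.
exists (\prod_j q j)%N.
  by elim/big_rec: _ => // j n _ np; rewrite pnatM np andbT; case: (qP j).
move=> j; rewrite (bigD1 j) //= exprM; apply: sfX; first exact: rf_subfield.
by case: (qP j).
Qed.

Lemma rindep_pw_kr E W J (a : J -> kappa) : sfK E -> pw E W -> (forall j, rf W (a j)) ->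
  indep (rf E) a -> indep (rf (kr E)) a.
Proof.
move=> kE pwW Wa ia; have hE := sfK_sf kE; have [q qp aq] := pw_rf_common hE pwW Wa.
by apply: insep_sep_indep qp aq _ ia => [|c]; [exact: rf_subfield | exact: kr_rsep].
Qed.

(** The residue extension of [W] is purely inseparable and that of [kr E] separable; [rindep_pw_kr]
    gives their disjointness in one direction and [linear_disjoint_sym] reverses it. *)
Lemma rindep_kr_pw E W J (a : J -> kappa) : sfK E -> sfK W -> Defs.subset E W -> pw E W ->
  (forall j, rf (kr E) (a j)) -> indep (rf E) a -> indep (rf W) a.
Proof.
move=> kE kW EW pwW ka ia; have hE := sfK_sf kE; have hrE := rf_subfield hE.
have hrW := rf_subfield (sfK_sf kW); have hrk := rf_subfield (kr_subfield kE).
apply: (linear_disjoint_sym hrE hrk) ka ia; first exact/rfS/kr_base.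
- by move=> x y kx ky; apply: sfD.
- by move=> k x /(rfS EW) hk kx; apply: sfM.
- exact: sf0.
- by move=> J' a' Wa; apply: (rindep_pw_kr kE pwW Wa).
Qed.

Lemma indep_max (L : fieldType) (E F : L -> Prop) I B (v : I -> L) (b : B -> L) : is_subfield E ->
  basis E F b -> (forall i, F (v i)) -> indep E v -> (#|B| <= #|I|)%N -> basis E F v.
Proof.
move=> hE [Fb ib sb] Fv iv le; split=> // x Fx; apply: contrapT => nx.
have := indep_leq_span hE (indep_option hE iv nx) (w := b).
rewrite card_option ltnNge le => h; suff: false by []; apply: h => o.
by apply: sb; case: o.
Qed.

Lemma basis_disjoint (L : fieldType) (E T W : L -> Prop) B I (b : B -> L) (v : I -> L) :
  is_subfield W -> Defs.subset E W -> basis E T b -> indep W b -> (forall i, W (v i)) ->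
  indep E v -> indep T v.
Proof.
move=> hW EW [Tb ib sb] iW Wv iv c Tc s0.
have /choice[d dP] i : exists d, (forall j, E (d j)) /\ c i = \sum_j d j * b j.
  by have [d Ed ->] := sb _ (Tc i); exists d.
have d0 j : \sum_i d i j * v i = 0.
  apply: (iW (fun j => \sum_i d i j * v i)) => [k|].
    apply: (sf_sum hW) => i _; apply: sfM => //; apply: EW; exact: (dP i).1.
  rewrite -[RHS]s0; under eq_bigr do rewrite mulr_suml.
  rewrite exchange_big /=; apply: eq_bigr => i _; rewrite (dP i).2 mulr_suml.
  by apply: eq_bigr => k _; rewrite mulrAC.
move=> i; rewrite (dP i).2 big1 // => j _.
by rewrite (iv (fun i => d i j) _ (d0 j) i) ?mul0r // => k; case: (dP k).
Qed.

(** The coefficients lie in a finite tame [T]. Being defectless, [T] has an [E]-basis of products of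
    class representatives and residue lifts. Over [W] the former stay inequivalent and the latter
    keep independent residues, so by [fund2] the products stay independent; [basis_disjoint] then
    exchanges the roles of [T] and [W]. *)
Lemma pw_disjoint E W I (v : I -> Om) : sfK E -> sfK W -> Defs.subset E W -> pw E W ->
  (forall i, W (v i)) -> indep E v -> indep (kr E) v.
Proof.
move=> kE kW EW pwW Wv iv c kc s0; have hE := sfK_sf kE; have hW := sfK_sf kW.
have [y /mapP[i _ ->]|t ct tP] := @kr_seq _ E kE [seq c i | i <- enum I]; first exact: kc.
have tT := tchain_tfin kE ct; have [fT eT sT dT] := tT.
have [[J [x vx]] [J' [u ru]]] := ef_exists fT.
have /finite_extP[_ hT ET [B [b bb]]] := fT.
have cB := deflE hE dT vx ru bb; have [Tx xi _] := vx; have [Tu Ou [_ iu _]] := ru.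
have Tkr : Defs.subset (adjs E t) (kr E) by move=> y ty; exists t.
have iE := fund2 hE (fun j => (Tx j).2) xi Ou iu.
have bE : basis E (adjs E t) (fun ij : J * J' => x ij.1 * u ij.2).
  apply: (indep_max hE bb) iE _; last by rewrite cB card_prod.
  by move=> [j j'] /=; apply: sfM => //; case: (Tx j).
have iW : indep W (fun ij : J * J' => x ij.1 * u ij.2).
  apply: fund2 => //; first by move=> j; case: (Tx j).
    by apply: (inequiv_kr_pw kE pwW) => // j; [apply: Tkr|]; case: (Tx j).
  apply: (rindep_kr_pw kE kW EW pwW) iu => j; exists (u j); split=> //; exact/Tkr/Tu.
apply: (basis_disjoint hW EW bE iW Wv iv) s0 => i; apply: tP.
by apply: map_f; rewrite mem_enum.
Qed.

Lemma lin_indepP (L : fieldType) (E : L -> Prop) (s : seq L) : is_subfield E ->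
  lin_indep E s <-> indep E (fun i : 'I_(size s) => s`_i).
Proof.
move=> hE; split=> [ls c Ec s0 i|iv c sc Ec s0 i].
  pose d := mkseq (fun i => if insub i is Some j then c j else 0) (size s).
  have dE (j : 'I_(size s)) : d`_j = c j by rewrite nth_mkseq // valK.
  rewrite -dE; apply: ls; first by rewrite size_mkseq.
    move=> k; have [kn|kn] := ltnP k (size s); first by rewrite (dE (Ordinal kn)).
    by rewrite nth_default ?size_mkseq //; apply: sf0.
  by rewrite -[RHS]s0; apply: eq_bigr => j _; rewrite dE.
have [li|li] := ltnP i (size s); last by rewrite nth_default // sc.
exact: (iv (fun i : 'I_(size s) => c`_i) _ s0 (Ordinal li)).
Qed.

Lemma pw_wild E W : sfK E -> sfK W -> Defs.subset E W -> pw E W -> purely_wild_ext O res E W.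
Proof.
move=> kE kW EW pwW; have hE := sfK_sf kE; have hW := sfK_sf kW; split.
  by split=> // x _; apply: alg_all.
move=> T tT s sW /(lin_indepP _ hE) is_.
have [[_ hT _ _] _] := tT; have Tk := tame_kr kE tT.
apply/(lin_indepP _ hT); apply: (indepS Tk); apply: (pw_disjoint kE kW EW pwW) => // i.
by apply: sW; apply: mem_nth.
Qed.

(** A tame element [a] of [W] outside [E] contradicts disjointness from [E(a)]: 1 and [a] are
    independent over [E], but [a * 1 - 1 * a = 0] is a relation over [E(a)]. So [pw_lemma]
    applies. *)
Lemma wild_pw E W : sfK E -> purely_wild_ext O res E W -> pw E W.
Proof.
move=> kE [[hE hW EW _] wW]; have kW := sfK_sub kE hW EW.
apply: pw_lemma => // a Wa ta; apply: contrapT => nEa.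
have tT := tfin_tame (telt_tfin kE ta).
have ha := adj_subfield hE (alg_all a kE).
have sW x : x \in [:: 1; a] -> W x by rewrite !inE => /orP[] /eqP-> //; apply: sf1.
have ls : lin_indep E [:: 1; a].
  move=> [|c0 [|c1 []]] //= _ Ec; rewrite !big_ord_recl big_ord0 /= mulr1 addr0 => s0.
  have E0 : E c0 := Ec 0%N; have E1 : E c1 := Ec 1%N.
  have c10 : c1 = 0.
    apply: contrapT => /eqP c10; apply: nEa.
    have -> : a = - (c0 / c1).
      by apply: (mulfI c10); rewrite mulrN mulrCA divff // mulr1; apply/eqP; rewrite -addr_eq0 addrC s0.
    by apply: sfN => //; apply: sf_div.
  have c00 : c0 = 0 by move: s0; rewrite c10 mul0r addr0.
  by rewrite c00 c10 => -[|[|i]] //=; rewrite nth_nil.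
have := wW _ tT _ sW ls [:: a; -1] erefl; rewrite !big_ord_recl big_ord0 /= mulr1 mulN1r addr0 subrr.
have hc i : adj E a [:: a; -1]`_i.
  case: i => [|[|i]] /=; [exact: adj_mem | by apply: sfN => //; apply: sf1 | ].
  by rewrite nth_nil; apply: sf0.
by move=> /(_ hc erefl 1%N) /= /eqP; rewrite oppr_eq0 oner_eq0.
Qed.

Lemma span_subfield N I (b : I -> Om) : sfK N -> span N b 1 ->
  (forall i j, span N b (b i * b j)) -> sfK (span N b) /\ Defs.subset N (span N b).
Proof.
move=> kN s1 sM; have hN := sfK_sf kN.
have NS : Defs.subset N (span N b) by move=> n Nn; rewrite -[n]mulr1; apply: spanZ.
split=> //; apply: (sfK_sub kN _ NS); apply: (ring_subfield hN) => //.
- by move=> x y sx sy; apply: spanD => //; apply: spanN.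
- move=> _ _ [c Nc ->] [d Nd ->]; rewrite mulr_suml; apply: span_sum => // i _.
  rewrite mulr_sumr; apply: span_sum => // j _; rewrite mulrACA.
  by apply: spanZ => //; apply: sfM.
- by move=> x _; apply: alg_all.
Qed.

Lemma span_finite N I (b : I -> Om) : sfK N -> sfK (span N b) -> Defs.subset N (span N b) ->
  finite_ext N (span N b).
Proof.
move=> kN kS NS; have hN := sfK_sf kN; apply/finite_extP; split=> //; first exact: sfK_sf kS.
by apply: (@basis_exists _ _ hN _ #|I|) => J w Sw iw; exact: (indep_leq_span hN iw Sw).
Qed.

(* The compositum F.N = span N b is already defined by structure constants in a finite T <= N, and
   both steps of E <= T <= F.T are defectless. *)
Lemma descent E N F : sfK E -> sfK N -> Defs.subset E N ->
  (forall M, finite_ext E M -> Defs.subset M N -> defectless_fin O res E M) ->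
  finite_ext E F ->
  (forall F', finite_ext N F' -> (separable_ext E F -> separable_ext N F') ->
     defectless_fin O res N F') ->
  defectless_fin O res E F.
Proof.
move=> kE kN EN dN fF dF; have /finite_extP[hE hF EF [B [b [Fb ib sb]]]] := fF.
have hN := sfK_sf kN.
have s1 T : Defs.subset E T -> span T b 1 by move=> ET; apply: (spanS ET); apply: sb; apply: sf1.
have sM T : Defs.subset E T -> forall i j, span T b (b i * b j).
  by move=> ET i j; apply: (spanS ET); apply: sb; apply: sfM.
have [kS NS] := span_subfield kN (s1 N EN) (sM N EN); have hS := sfK_sf kS.
have fS := span_finite kN kS NS.
have dS : defectless_fin O res N (span N b).
  apply: dF => // -[_ _ _ sepF]; split=> // x [c Nc ->].
  apply: (sep_gen hN (s := [seq b i | i <- enum B])) => [y /mapP[i _ ->]|].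
    by apply: (sepS EN); apply: sepF.
  have kA := sfK_adjs [seq b i | i <- enum B] kN; have hA := sfK_sf kA.
  have [_ _ NA _] := adjs_finite hN (fun y (_ : y \in [seq b i | i <- enum B]) => alg_all y kN).
  apply: (sf_sum hA) => i _; apply: sfM => //; first exact: NA.
  by apply: adjs_mem => // [y _|]; [exact: alg_all | apply: map_f; rewrite mem_enum].
have [[I [x vx]] [J [u ru]]] := ef_exists fS.
have /finite_extP[_ _ _ [D [d bd]]] := fS; have [_ _ sd] := bd.
have cD := deflE hN dS vx ru bd; have [Sx xi _] := vx; have [Su Ou [_ iu _]] := ru.
have /choice[al alP] i : exists c : B -> Om, (forall k, N (c k)) /\ x i = \sum_k c k * b k.
  by have [[c Nc ->] _] := Sx i; exists c.
have /choice[be beP] j : exists c : B -> Om, (forall k, N (c k)) /\ u j = \sum_k c k * b k.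
  by have [c Nc ->] := Su j; exists c.
have /choice[ga gaP] k : exists c : D -> Om, (forall l, N (c l)) /\ b k = \sum_l c l * d l.
  by have [c Nc ->] := sd _ (span_mem hN b k); exists c.
(* Coordinates with respect to [b] of the class representatives and of the residue lifts, and those
   of [b] with respect to the basis [d]: the former put these families into [span T b], the latter
   bound its degree over [T] by [#|D|]. *)
pose t := codom (fun ik : I * B => al ik.1 ik.2) ++ codom (fun jk : J * B => be jk.1 jk.2) ++
  codom (fun kl : B * D => ga kl.1 kl.2).
have tN y : y \in t -> N y.
  rewrite !mem_cat => /or3P[] /codomP[[k l] ->] /=.
  - by case: (alP k).
  - by case: (beP k).
  - by case: (gaP k).
have tA y : y \in t -> alg E y by move=> _; apply: alg_all.
have fT := adjs_finite hE tA; set T := adjs E t in fT.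
have tT y : y \in t -> T y by apply: adjs_mem.
have [_ hT ET _] := fT; have kT := sfK_sub kE hT ET.
have TN : Defs.subset T N by apply: adjs_least.
have [kR TR] := span_subfield kT (s1 T ET) (sM T ET); have hR := sfK_sf kR.
have fR := span_finite kT kR TR.
have dR : defectless_fin O res T (span T b).
  have /finite_extP[_ _ _ [C [c bc]]] := fR; have [Rc ic _] := bc.
  suff [] : [/\ defectless_fin O res T (span T b), vrep T (span T b) x & rbasis T (span T b) u] by [].
  apply: (deflI fR (degree_card hT bc)) => //.
  - move=> i; have [_ ->] := alP i; exists (al i) => // k; apply: tT.
    by rewrite mem_cat (codom_f (fun ik : I * B => al ik.1 ik.2) (i, k)).
  - by move=> i; case: (Sx i).
  - by move=> i j /(sclS TN)/xi.
  - move=> j; have [_ ->] := beP j; exists (be j) => // k; apply: tT.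
    by rewrite !mem_cat (codom_f (fun ik : J * B => be ik.1 ik.2) (j, k)) orbT.
  - exact: indepS (rfS TN) iu.
  - rewrite -cD; apply: (indep_leq_span hT ic) => k.
    apply: (span_trans hT _ (Rc k)) => l; have [_ ->] := gaP l.
    exists (ga l) => // m; apply: tT.
    by rewrite !mem_cat (codom_f (fun ik : B * D => ga ik.1 ik.2) (l, m)) !orbT.
have fER := finite_ext_trans fT fR.
have dER : defectless_fin O res E (span T b) by apply: (defl_tower fT fR (dN _ fT TN) dR).
have FR : Defs.subset F (span T b) by move=> y /sb; apply: spanS.
by have [] := defl_sub hF EF FR fER dER.
Qed.

(* A finite extension F of kr E descends to F0/T with T/E tame and F0 linearly disjoint from
   kr E over T; then F0/T is purely wild, hence keeps its e and f over kr E. *)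
Lemma kr_defectless E F : sfK E -> finite_ext (kr E) F ->
  (forall F0, finite_ext E F0 -> (separable_ext (kr E) F -> separable_ext E F0) ->
     defectless_fin O res E F0) ->
  defectless_fin O res (kr E) F.
Proof.
move=> kE fF dE; have /finite_extP[hN hF NF [B [b bb]]] := fF; have [Fb ib sb] := bb.
have hE := sfK_sf kE; have kN := kr_sfK kE.
have [o ko oE] := sb 1 (sf1 hF).
have /choice[mu muP] (ij : B * B) : exists c : B -> Om, (forall k, kr E (c k)) /\
    b ij.1 * b ij.2 = \sum_k c k * b k.
  by have [c kc ->] := sb _ (sfM hF (Fb ij.1) (Fb ij.2)); exists c.
pose t := codom o ++ codom (fun p : (B * B) * B => mu p.1 p.2).
have [y|s cs sP] := @kr_seq _ E kE t.
  rewrite mem_cat => /orP[] /codomP[k ->]; first exact: ko.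
  by case: (muP k.1).
set T := adjs E s in sP; have tT := tchain_tfin kE cs; have [fT eT sT dT] := tT.
have [_ hT ET _] := fT; have kT := sfK_sub kE hT ET.
have TN : Defs.subset T (kr E) by move=> y Ty; exists s.
have To k : T (o k) by apply: sP; rewrite mem_cat codom_f.
have [|i j|kR TR] := span_subfield kT (b := b).
- by exists o.
- have [_ e] := muP (i, j); rewrite /= in e; rewrite e; exists (mu (i, j)) => // k; apply: sP.
  by rewrite mem_cat (codom_f (fun p : (B * B) * B => mu p.1 p.2) (i, j, k)) orbT.
set R := span T b in kR TR; have hR := sfK_sf kR; have fR := span_finite kT kR TR.
have RF : Defs.subset R F.
  move=> y [c Tc ->]; apply: (sf_sum hF) => k _; apply: sfM => //; exact/NF/TN.
have bR : basis T R b.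
  by split=> // [i|]; [exact: span_mem | exact: indepS ib].
have fER := finite_ext_trans fT fR.
have dER : defectless_fin O res E R.
  apply: dE => // -[_ _ _ sF]; split=> // [y /ET /TR //|y Ry].
  by apply: (sep_trans hE hN (kr_base (E := E))) => [z|]; [exact: kr_sep | apply/sF/RF].
have [_ dTR] := defl_sub hT ET TR fER dER.
have pwR : pw T R.
  apply: pw_lemma => // a [c Tc aE] ta; have ka := kr_telt kE (teltS TN ta).
  (* [a] is in [kr E], so [a = a * 1] also has the coordinates [a * o k]; the comparison exhibits
     [a] as a quotient of elements of [T]. *)
  have cE k : c k = a * o k.
    apply/eqP; rewrite -subr_eq0; apply/eqP.
    apply: (ib (fun k => c k - a * o k)) => [l|].
      by apply: sfB => //; [exact: TN | apply: sfM].
    under eq_bigr do rewrite mulrBl -mulrA.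
    by rewrite sumrB -mulr_sumr -oE mulr1 -aE subrr.
  have [k ok] : exists k, o k != 0.
    apply: contrapT => h; have /eqP := oE; rewrite big1 ?oner_eq0 // => k _.
    have [->|ok] := eqVneq (o k) 0; [by rewrite mul0r | by case: h; exists k].
  have -> : a = c k / o k by rewrite cE mulfK.
  exact: sf_div.
have [[I [x vx]] [J [u ru]]] := ef_exists fR.
have [Rx xi _] := vx; have [Ru Ou [Rru iu _]] := ru.
have kTE : kr T = kr E by apply: kr_idem.
suff [] : [/\ defectless_fin O res (kr E) F, vrep (kr E) F x & rbasis (kr E) F u] by [].
apply: (deflI fF (degree_card hN bb)) => //.
- by move=> i; apply: RF; case: (Rx i).
- by move=> i; case: (Rx i).
- rewrite -kTE; apply: (inequiv_pw_kr kT kR pwR) => // i; by case: (Rx i).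
- by move=> j; apply: RF; apply: Ru.
- by rewrite -kTE; apply: (rindep_pw_kr kT pwR).
- by rewrite (deflE hT dTR vx ru bR).
Qed.
End Transfer.

(** * Crossed homomorphisms *)

(** [P / 'Phi(P)] is elementary abelian and nontrivial. [V] and [rho] are the coordinates of the
    quotient map and of the conjugation action, so that the later computations concern row vectors
    and matrices over ['F_p]. *)
Lemma frattini_module (p : nat) (gT : finGroupType) (P : {group gT}) :
  p.-group P -> P <| [set: gT] -> P :!=: 1%g ->
  exists n, exists V : gT -> 'rV['F_p]_n, exists rho : gT -> 'M['F_p]_n,
  [/\ (0 < n)%N, {in P &, forall x y, V (x * y)%g = V x + V y},
      forall x g, x \in P -> V (x ^ g)%g = V x *m rho g,
      forall g h, rho (g * h)%g = rho g *m rho h &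
      forall v, exists2 x, x \in P & V x = v].
Proof.
move=> pP nP ntP.
have nPhi : 'Phi(P) <| [set: gT] by apply: char_normal_trans nP; apply: Phi_char.
have abE := Phi_quotient_abelem pP; set E := (P / 'Phi(P))%G.
have sPhi : 'Phi(P) \subset P by apply: Phi_sub.
have ntE : E :!=: 1%g.
  by rewrite -subG1 quotient_sub1 ?normal_norm ?Phi_normal // proper_subn // Phi_proper.
have NPhi g : g \in 'N('Phi(P)).
  by have /andP[_ /subsetP->] := nPhi; rewrite ?inE.
have nEG : ([set: gT] / 'Phi(P))%g \subset 'N(E).
  by apply: normal_norm; apply: quotient_normal.
pose V x := abelem_rV abE ntE (coset 'Phi(P) x).
pose rho g := abelem_repr abE ntE nEG (coset 'Phi(P) g).
have cE x : x \in P -> coset 'Phi(P) x \in E by move=> xP; apply: mem_quotient.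
have cG g : coset 'Phi(P) g \in ([set: gT] / 'Phi(P))%g by apply: mem_quotient; rewrite inE.
exists _, V, rho; split=> //.
- by move=> x y xP yP; rewrite /V morphM ?NPhi // (abelem_rV_M abE ntE) ?cE.
- by move=> x g xP; rewrite /V morphJ ?NPhi // (abelem_rV_J abE ntE nEG) ?cE ?cG.
- by move=> g h; rewrite /rho morphM ?NPhi // repr_mxM ?cG.
- move=> v; have := mem_rVabelem abE ntE v => /morphimP[x Nx xP e].
  by exists x => //; rewrite /V -e rVabelemK.
Qed.

(** The representative between 0 and [p - 1], as an integer of [R]. It is a ring morphism when [R]
    has characteristic [p], but it is also used in valuation rings of mixed characteristic, where
    additivity and multiplicativity appear only after reduction. *)
Definition Fp_lift (R : pzRingType) (p : nat) (c : 'F_p) : R := (nat_of_ord c)%:R.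

Section Lift.
Variables (R : comNzRingType) (p : nat).
Hypothesis pR : p \in [pchar R].
Local Notation l := (@Fp_lift R p).
Let p_pr : prime p. Proof. by case/andP: pR. Qed.

Lemma Fp_liftD a b : l (a + b) = l a + l b.
Proof.
have e : nat_of_ord (a + b) = ((a + b) %% p)%N.
  by transitivity ((a + b) %% (Zp_trunc (pdiv p)).+2)%N => //; congr (_ %% _)%N; apply: Fp_cast.
by rewrite /Fp_lift e (GRing.natr_mod_pchar pR) natrD.
Qed.

Lemma Fp_liftM a b : l (a * b) = l a * l b.
Proof.
have e : nat_of_ord (a * b) = ((a * b) %% p)%N.
  by transitivity ((a * b) %% (Zp_trunc (pdiv p)).+2)%N => //; congr (_ %% _)%N; apply: Fp_cast.
by rewrite /Fp_lift e (GRing.natr_mod_pchar pR) natrM.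
Qed.

Lemma Fp_lift1 : l 1 = 1. Proof. by rewrite /Fp_lift /= modn_small // ltnS. Qed.

Fact Fp_lift_zmod : zmod_morphism l.
Proof.
move=> a b; apply: (addIr (l b)); by rewrite -Fp_liftD !subrK.
Qed.
Fact Fp_lift_monoid : monoid_morphism l.
Proof. by split; [exact: Fp_lift1 | exact: Fp_liftM]. Qed.

Definition Fp_rmorph : {rmorphism 'F_p -> R} :=
  HB.pack l (GRing.isZmodMorphism.Build _ _ l Fp_lift_zmod)
            (GRing.isMonoidMorphism.Build _ _ l Fp_lift_monoid).

Lemma Fp_liftX (c : 'F_p) : l c ^+ p = l c.
Proof. by rewrite /Fp_lift -(pFrobenius_autE pR) pFrobenius_aut_nat. Qed.
End Lift.

Lemma Fp_lift_root (F : fieldType) (p : nat) (y : F) : p \in [pchar F] -> y ^+ p = y ->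
  exists c : 'F_p, y = Fp_lift F c.
Proof.
move=> pF yp; have p_pr : prime p by case/andP: pF.
apply: contrapT => ny.
pose rs := y :: [seq Fp_lift F c | c : 'F_p].
have urs : uniq rs.
  rewrite /= map_inj_uniq ?enum_uniq ?andbT; last exact: (fmorph_inj (Fp_rmorph pF)).
  by apply/negP => /mapP[c _ e]; apply: ny; exists c.
have q0 : 'X^p - 'X != 0 :> {poly F}.
  apply/eqP => /(congr1 (fun q : {poly F} => q`_p)); rewrite coefB coefXn coefX eqxx coef0.
  by rewrite gtn_eqF ?prime_gt1 // subr0 => /eqP; rewrite oner_eq0.
have := max_poly_roots q0 _ urs; rewrite /= size_map -cardE card_Fp // => h.
have /h : all (root ('X^p - 'X)) rs.
  rewrite /= rootE !hornerE yp subrr eqxx /=; apply/allP => _ /mapP[c _ ->].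
  by rewrite rootE !hornerE Fp_liftX ?subrr.
rewrite size_polyDl ?size_polyXn ?size_polyN ?size_polyX ?ltnn //.
by rewrite ltnS prime_gt1.
Qed.

Section CosetSum.
Variables (gT : finGroupType) (P : {group gT}) (R : nmodType).

Definition csum (S : gT -> R) := \sum_(C in rcosets P [set: gT]) S (repr C).

Lemma rcosets_repr (C : {set gT}) : C \in rcosets P [set: gT] -> C = (P :* repr C)%g.
Proof. by case/rcosetsP => g _ ->; rewrite rcoset_repr. Qed.

Lemma csum_shift (S : gT -> R) g : (forall x t, x \in P -> S (x * t)%g = S t) ->
  csum (fun t => S (t * g)%g) = csum S.
Proof.
move=> SP; rewrite /csum [RHS](reindex (fun C : {set gT} => (C :* g)%g)) /=; last first.
  by exists (fun C : {set gT} => (C :* g^-1)%g) => C _; rewrite -rcosetM ?mulgV ?mulVg mulg1.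
have memE (C : {set gT}) : ((C :* g)%g \in rcosets P [set: gT]) = (C \in rcosets P [set: gT]).
  apply/rcosetsP/rcosetsP => -[h _ e].
    by exists (h * g^-1)%g; rewrite ?inE // rcosetM -e rcosetK.
  by exists (h * g)%g; rewrite ?inE // rcosetM e.
rewrite (eq_bigl _ _ memE); apply: eq_bigr => C PC.
have e : (C :* g = P :* (repr C * g))%g by rewrite rcosetM -rcosets_repr.
have := mem_repr_rcoset P (repr C * g)%g; rewrite -e {2}e.
by case/rcosetP => x xP ->; rewrite SP.
Qed.
End CosetSum.

(* Crossed homomorphisms modulo the kernel of phi: since theta has trace 1 over G/P, the
   class of the extension of G/P by V becomes trivial after tensoring V with kappa. *)
Section Crossed.
Variables (gT : finGroupType) (P : {group gT}) (A : comNzRingType) (k : fieldType) (p n : nat).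
Variables (act : gT -> {rmorphism A -> A}) (phi : {rmorphism A -> k}).
Variables (V : gT -> 'rV['F_p]_n) (rho : gT -> 'M['F_p]_n) (theta : A).
Hypothesis pk : p \in [pchar k].
Hypothesis nP : P <| [set: gT].
Hypothesis actM : forall g h y, act (g * h)%g y = act h (act g y).
Hypothesis act_phi : forall g y, phi y = 0 -> phi (act g y) = 0.
Hypothesis actP : forall x y, x \in P -> phi (act x y) = phi y.
Hypothesis VM : {in P &, forall x y, V (x * y)%g = V x + V y}.
Hypothesis VJ : forall x g, x \in P -> V (x ^ g)%g = V x *m rho g.
Hypothesis rhoM : forall g h, rho (g * h)%g = rho g *m rho h.
Hypothesis Vsurj : forall v, exists2 x, x \in P & V x = v.
Hypothesis trth : csum P (fun t => phi (act t theta)) = 1.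

Local Notation lk := (Fp_lift k (p := p)).
Local Notation lA := (Fp_lift A (p := p)).
Local Notation "[[ Y ]]" := (map_mx phi Y) (format "[[ Y ]]").
Local Notation lm := (map_mx lk).

Lemma PJ x g : x \in P -> (x ^ g)%g \in P.
Proof. by move=> xP; rewrite memJ_norm //; have /andP[_ /subsetP->] := nP; rewrite ?inE. Qed.

Lemma V1 : V 1%g = 0.
Proof. by apply: (addrI (V 1%g)); rewrite -VM ?mulg1 ?addr0. Qed.

Lemma VV x : x \in P -> V x^-1%g = - V x.
Proof.
by move=> xP; apply: (addrI (V x)); rewrite -VM ?groupV // mulgV V1 subrr.
Qed.

(** [V] maps [P] onto the module and addition is commutative, so conjugation by an element of [P]
    does not change the values of [V]. *)
Lemma rhoP x : x \in P -> rho x = 1%:M.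
Proof.
move=> xP; apply/row_matrixP => i; rewrite !rowE.
have [y yP <-] := Vsurj (delta_mx 0 i); rewrite mulmx1 -VJ //.
by rewrite conjgE VM ?VM ?groupM ?groupV // VV // addrC addrK.
Qed.

(* Write g = t x with t a fixed representative of gP; [pi g] is the class of x. *)
Definition pi (g : gT) := V ((repr (g *: P))^-1 * g)%g.

Lemma piM g x : x \in P -> pi (g * x)%g = pi g + V x.
Proof.
move=> xP; have e : ((g * x) *: P = g *: P)%g by rewrite lcosetM lcoset_id.
rewrite /pi e mulgA VM //.
by have /lcosetP[y yP ->] := mem_repr g (lcoset_refl P g); rewrite invMg mulgKV groupV.
Qed.

(** Were [pi] a crossed homomorphism, this would equal [pi g] for every [t]. It depends only on the
    coset of [t] ([cpi_P]), and [lF] averages it over the cosets with weights given by the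
    conjugates of [theta]. *)
Definition cpi t g := pi (t * g)%g - pi t *m rho g.

Lemma cpi_P x t g : x \in P -> cpi (x * t)%g g = cpi t g.
Proof.
move=> xP; have xt : (x * t = t * x ^ t)%g by rewrite conjgE mulKVg.
rewrite /cpi xt (piM t (PJ t xP)).
have -> : (t * x ^ t * g = t * g * (x ^ t) ^ g)%g by rewrite [((x ^ t) ^ g)%g]conjgE !mulgA mulgK.
by rewrite (piM _ (PJ g (PJ t xP))) (VJ g (PJ t xP)) mulmxDl opprD addrACA subrr addr0.
Qed.

Lemma phi_act g y z : phi y = phi z -> phi (act g y) = phi (act g z).
Proof.
by move=> e; apply/eqP; rewrite -subr_eq0 -!rmorphB act_phi // rmorphB e subrr.
Qed.

Lemma phi_lA c : phi (lA c) = lk c.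
Proof. exact: rmorph_nat. Qed.

Lemma act_lA g c : act g (lA c) = lA c.
Proof. exact: rmorph_nat. Qed.

(* [lF] is a crossed homomorphism extending V to all of G; [lB], its image under X^p - X, is
   inflated from G/P, hence a coboundary given by [la]. *)
Definition lF g : 'rV[A]_n :=
  \row_i \sum_(C in rcosets P [set: gT]) lA (cpi (repr C) g 0 i) * act (repr C * g)%g theta.

Lemma phi_actP x t y : x \in P -> phi (act (x * t)%g y) = phi (act t y).
Proof. by move=> xP; rewrite actM; apply/phi_act/actP. Qed.

Lemma csumE (S : gT -> 'rV[k]_n) i : csum P S 0 i = csum P (fun t => S t 0 i).
Proof. by rewrite /csum summxE. Qed.

Let lkr := Fp_rmorph pk.
Lemma lmE m1 m2 (X : 'M['F_p]_(m1, m2)) : lm X = map_mx lkr X.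
Proof. by []. Qed.

Lemma phi_lF g : [[lF g]] = csum P (fun t => phi (act (t * g)%g theta) *: lm (cpi t g)).
Proof.
apply/rowP => i; rewrite csumE !mxE rmorph_sum; apply: eq_bigr => C _.
by rewrite rmorphM phi_lA !mxE mulrC.
Qed.

Lemma phi_act_lF g h : [[map_mx (act h) (lF g)]] *m lm (rho h) =
  csum P (fun t => phi (act (t * g * h)%g theta) *: lm (cpi t g *m rho h)).
Proof.
have -> : [[map_mx (act h) (lF g)]] = csum P (fun t => phi (act (t * g * h)%g theta) *: lm (cpi t g)).
  apply/rowP => i; rewrite csumE !mxE !rmorph_sum; apply: eq_bigr => C _.
  by rewrite !rmorphM act_lA phi_lA -actM !mxE mulrC.
rewrite /csum mulmx_suml; apply: eq_bigr => C _.
by rewrite -scalemxAl !lmE map_mxM.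
Qed.

(** Termwise this is [cpi t (g h) = cpi t g * rho h + cpi (t g) h], weighted by [theta] moved by
    [t g h]; translation by [g] turns the sum of the second terms into [lF h]. *)
Lemma lF_cross g h : [[lF (g * h)%g]] = [[map_mx (act h) (lF g)]] *m lm (rho h) + [[lF h]].
Proof.
pose S t := phi (act (t * h)%g theta) *: lm (cpi t h).
have eh : [[lF h]] = csum P (fun t => S (t * g)%g).
  rewrite phi_lF; symmetry; apply: (csum_shift (S := S)) => x t xP.
  have e : (x * t * h = x * (t * h))%g by rewrite mulgA.
  by rewrite /S e (phi_actP (t * h)%g theta xP) (cpi_P t h xP).
rewrite [X in _ = _ + X]eh phi_lF phi_act_lF.
rewrite /csum -big_split; apply: eq_bigr => C _; rewrite /S /=.
rewrite !mulgA -scalerDr; congr (_ *: _); rewrite !lmE -map_mxD; congr map_mx.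
by rewrite /cpi rhoM mulmxBl mulmxA !mulgA [RHS]addrC addrA subrK.
Qed.

Lemma lF_P x : x \in P -> [[lF x]] = lm (V x).
Proof.
move=> xP; rewrite phi_lF.
have cx t : cpi t x = V x by rewrite /cpi piM // rhoP // mulmx1 addrC addKr.
have -> : csum P (fun t => phi (act (t * x)%g theta) *: lm (cpi t x)) =
  csum P (fun t => phi (act (t * x)%g theta)) *: lm (V x).
  by rewrite /csum scaler_suml; apply: eq_bigr => C _; rewrite cx.
by rewrite (csum_shift (S := fun t => phi (act t theta))) ?trth ?scale1r // => y t; apply: phi_actP.
Qed.

Definition lB g : 'rV[A]_n := \row_i (lF g 0 i ^+ p - lF g 0 i).

Lemma phi_lBE g i : [[lB g]] 0 i = [[lF g]] 0 i ^+ p - [[lF g]] 0 i.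
Proof. by rewrite !mxE rmorphB rmorphXn. Qed.

(** Frobenius fixes the entries of [M], so the operator [X^p - X] commutes with the matrices
    [rho g]; this is what makes [lB] a cocycle again. *)
Lemma frob_mul (X : 'rV[k]_n) (M : 'M['F_p]_n) i :
  (X *m lm M) 0 i ^+ p = (map_mx (fun c => c ^+ p) X *m lm M) 0 i.
Proof.
rewrite !mxE; have pp : [pchar k].-nat p by rewrite pnatE //; case/andP: pk.
have -> : forall (f : 'I_n -> k), (\sum_j f j) ^+ p = \sum_j f j ^+ p.
  by move=> f; rewrite -(pFrobenius_autE pk) rmorph_sum.
by apply: eq_bigr => j _; rewrite !mxE exprMn Fp_liftX.
Qed.

Lemma lB_cross g h : [[lB (g * h)%g]] = [[map_mx (act h) (lB g)]] *m lm (rho h) + [[lB h]].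
Proof.
apply/rowP => i; rewrite phi_lBE lF_cross [RHS]mxE phi_lBE mxE.
have -> : forall a b : k, (a + b) ^+ p = a ^+ p + b ^+ p.
  by move=> a b; rewrite -!(pFrobenius_autE pk) rmorphD.
rewrite frob_mul opprD addrACA; congr (_ + _).
have -> : forall (X Y : 'rV[k]_n), X 0 i - Y 0 i = (X - Y) 0 i by move=> X Y; rewrite !mxE.
rewrite -mulmxBl; congr ((_ *m _) 0 i); apply/rowP => j.
by rewrite !mxE !rmorphB !rmorphXn.
Qed.

Lemma lB_P x : x \in P -> [[lB x]] = 0.
Proof.
by move=> xP; apply/rowP => i; rewrite phi_lBE lF_P // !mxE Fp_liftX // subrr.
Qed.

Definition la : 'rV[A]_n :=
  - \sum_(C in rcosets P [set: gT]) act (repr C) theta *: lB (repr C).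

Lemma phi_scale (b : A) (Y : 'rV[A]_n) i : phi ((b *: Y) 0 i) = (phi b *: [[Y]]) 0 i.
Proof. by rewrite !mxE rmorphM. Qed.

Lemma phi_act_scale g (b : A) (Y : 'rV[A]_n) i :
  phi (act g ((b *: Y) 0 i)) = (phi (act g b) *: [[map_mx (act g) Y]]) 0 i.
Proof. by rewrite !mxE !rmorphM. Qed.

(** Additive Hilbert 90: the cocycle identity for [lB (t g)] is summed over the cosets with the
    weights of [theta] moved by [t g], whose total is 1. The sums do not depend on representatives
    because [lB] vanishes on [P]. *)
Lemma la_cob g : [[map_mx (act g) la]] *m lm (rho g) - [[la]] = [[lB g]].
Proof.
have la_E : [[la]] = - csum P (fun t => phi (act t theta) *: [[lB t]]).
  rewrite /la map_mxN /csum; congr (- _); apply/rowP => i; rewrite mxE !summxE raddf_sum.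
  by apply: eq_bigr => C _; apply: phi_scale.
have -> : [[map_mx (act g) la]] *m lm (rho g) =
    - csum P (fun t => phi (act (t * g)%g theta) *: ([[map_mx (act g) (lB t)]] *m lm (rho g))).
  have -> : [[map_mx (act g) la]] =
      - csum P (fun t => phi (act (t * g)%g theta) *: [[map_mx (act g) (lB t)]]).
    rewrite /la map_mxN map_mxN /csum; congr (- _); apply/rowP => i.
    rewrite mxE mxE !summxE !raddf_sum; apply: eq_bigr => C _.
    by rewrite actM; apply: phi_act_scale.
  by rewrite mulNmx /csum mulmx_suml; congr (- _); apply: eq_bigr => C _; rewrite -scalemxAl.
have -> : csum P (fun t => phi (act (t * g)%g theta) *: ([[map_mx (act g) (lB t)]] *m lm (rho g))) =
   csum P (fun t => phi (act (t * g)%g theta) *: [[lB (t * g)%g]]) - [[lB g]].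
  have -> : [[lB g]] = csum P (fun t => phi (act (t * g)%g theta)) *: [[lB g]].
    by rewrite (csum_shift (S := fun t => phi (act t theta))) ?trth ?scale1r // => y t; apply: phi_actP.
  rewrite /csum scaler_suml -sumrB; apply: eq_bigr => C _.
  by rewrite lB_cross scalerDr addrK.
pose S t := phi (act t theta) *: [[lB t]].
have -> : csum P (fun t => phi (act (t * g)%g theta) *: [[lB (t * g)%g]]) = csum P S.
  apply: (csum_shift (S := S)) => x t xP; rewrite /S (phi_actP t theta xP) lB_cross.
  have -> : [[map_mx (act t) (lB x)]] = 0.
    apply/rowP => i; rewrite !mxE; apply: act_phi.
    by have /rowP/(_ i) := lB_P xP; rewrite !mxE.
  by rewrite mul0mx add0r.
by rewrite la_E opprB opprK subrK.
Qed.

(* Over an extension containing roots beta of X^p - X = la, subtracting the coboundary of beta from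
   [lF] gives a crossed homomorphism fixed by Frobenius, i.e. with values in F_p. *)
Section Extend.
Variables (gT' : finGroupType) (A' : comNzRingType) (act' : gT' -> {rmorphism A' -> A'}).
Variables (phi' : {rmorphism A' -> k}) (r : gT' -> gT) (inc : {rmorphism A -> A'}).
Variable beta : 'rV[A']_n.
Hypothesis act'M : forall g h y, act' (g * h)%g y = act' h (act' g y).
Hypothesis act'_phi : forall g y, phi' y = 0 -> phi' (act' g y) = 0.
Hypothesis rM : forall g h, r (g * h)%g = (r g * r h)%g.
Hypothesis inc_act : forall g a, inc (act (r g) a) = act' g (inc a).
Hypothesis inc_phi : forall a, phi' (inc a) = phi a.
Hypothesis beta_eq : forall i, beta 0 i ^+ p - beta 0 i = inc (la 0 i).

Let lA' := Fp_lift A' (p := p).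
Let B g : 'rV[k]_n := map_mx phi' (map_mx (act' g) beta).
Let B1 : 'rV[k]_n := map_mx phi' beta.
Let Y g : 'rV[k]_n := [[lF (r g)]] - (B g *m lm (rho (r g)) - B1).

Lemma ext_frobB g : map_mx (fun c => c ^+ p) (B g) - B g = [[map_mx (act (r g)) la]].
Proof.
apply/rowP => i; rewrite [in RHS]mxE [map_mx _ la 0 i]mxE -inc_phi inc_act -beta_eq.
by rewrite !mxE !rmorphB !rmorphXn.
Qed.

(** By the equation for [beta], the operator [X^p - X] sends [Y g] to [lB (r g)] minus the
    coboundary of [la], which vanishes by [la_cob]. *)
Lemma ext_frob g i : Y g 0 i ^+ p = Y g 0 i.
Proof.
have frobB (a b : k) : (a - b) ^+ p = a ^+ p - b ^+ p by rewrite -!(pFrobenius_autE pk) rmorphB.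
apply/eqP; rewrite -subr_eq0; apply/eqP.
pose Z := [[lB (r g)]] - ((map_mx (fun c => c ^+ p) (B g) - B g) *m lm (rho (r g)) - [[la]]).
suff -> : Y g 0 i ^+ p - Y g 0 i = Z 0 i by rewrite /Z ext_frobB la_cob subrr mxE.
have yE (a b c : 'rV[k]_n) : (a - (b - c)) 0 i = a 0 i - (b 0 i - c 0 i) by rewrite !mxE.
rewrite /Y /Z !yE !frobB phi_lBE frob_mul mulmxBl.
have -> : forall a b : 'rV[k]_n, (a - b) 0 i = a 0 i - b 0 i by move=> a b; rewrite !mxE.
have -> : [[la]] 0 i = B1 0 i ^+ p - B1 0 i.
  by rewrite [LHS]mxE -inc_phi -beta_eq rmorphB rmorphXn !mxE.
ring.
Qed.

Fact ext_ex g : exists v : 'rV['F_p]_n, Y g = lm v.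
Proof.
have h i : exists c : 'F_p, Y g 0 i = lk c := Fp_lift_root pk (ext_frob g i).
exists (\row_i projT1 (cid (h i))); apply/rowP => i.
by rewrite !mxE -(projT2 (cid (h i))) !mxE.
Qed.

Definition ext g := projT1 (cid (ext_ex g)).
Lemma extE g : Y g = lm (ext g). Proof. exact: projT2 (cid (ext_ex g)). Qed.

Lemma lm_inj m1 m2 : injective (fun X : 'M['F_p]_(m1, m2) => lm X).
Proof. by move=> X1 X2 e; apply: (map_mx_inj (f := lkr)). Qed.

Lemma ext_cross g h : ext (g * h)%g = ext g *m rho (r h) + ext h.
Proof.
apply: lm_inj; rewrite [RHS]lmE map_mxD map_mxM -!lmE -[LHS]extE -(extE h) /Y rM lF_cross rhoM.
(* A lift of [Y g] to [A']: the group acts on [A'], and no action on [k] is given. *)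
pose E := map_mx inc (lF (r g)) - (map_mx (act' g) beta *m map_mx lA' (rho (r g)) - beta).
have lA'E c : phi' (lA' c) = lk c by apply: rmorph_nat.
have act'l g' c : act' g' (lA' c) = lA' c by apply: rmorph_nat.
have E_phi : map_mx phi' E = lm (ext g).
  have e1 : map_mx phi' (map_mx inc (lF (r g))) = [[lF (r g)]].
    by rewrite -map_mx_comp; apply: eq_map_mx => a; apply: inc_phi.
  have e2 : map_mx phi' (map_mx lA' (rho (r g))) = lm (rho (r g)).
    by apply/matrixP => i l; rewrite !mxE lA'E.
  by rewrite -extE /Y /E !map_mxB map_mxM e1 e2.
have actE : map_mx phi' (map_mx (act' h) E) =
    [[map_mx (act (r h)) (lF (r g))]] - (B (g * h)%g *m lm (rho (r g)) - B h).
  have e1 : map_mx phi' (map_mx (act' h) (map_mx inc (lF (r g)))) = [[map_mx (act (r h)) (lF (r g))]].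
    by rewrite -!map_mx_comp; apply: eq_map_mx => a; rewrite /= -inc_act inc_phi.
  have e2 : map_mx phi' (map_mx (act' h) (map_mx (act' g) beta)) = B (g * h)%g.
    by apply/rowP => i; rewrite !mxE act'M.
  have e3 : map_mx phi' (map_mx (act' h) (map_mx lA' (rho (r g)))) = lm (rho (r g)).
    by apply/matrixP => i l; rewrite !mxE act'l lA'E.
  by rewrite /E !map_mxB !map_mxM e1 e2 e3.
(* [E] is congruent to a vector of integers modulo the kernel of [phi']; the maps [act' h] fix
   integers and preserve that kernel. *)
have actE' : map_mx phi' (map_mx (act' h) E) = lm (ext g).
  apply/rowP => i; have /rowP/(_ i) := E_phi; rewrite !mxE => e.
  apply/eqP; rewrite -subr_eq0 -lA'E -(act'l h) -!rmorphB act'_phi //.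
  by rewrite rmorphB lA'E e subrr.
rewrite -actE' actE mulmxBl mulmxBl (lmE (rho (r g) *m rho (r h))) map_mxM -!lmE mulmxA.
move: ([[_]] *m _) (B _ *m _ *m _) => a b.
by rewrite opprB !addrA; apply/rowP => i; rewrite !mxE; ring.
Qed.

Lemma ext_P x : r x \in P -> (forall a, phi' (act' x a) = phi' a) -> ext x = V (r x).
Proof.
move=> xP xa; apply: lm_inj; rewrite -[LHS]extE /Y lF_P // rhoP // (lmE 1%:M) map_mx1 mulmx1.
have -> : B x = B1 by apply/rowP => i; rewrite !mxE xa.
by rewrite subrr subr0.
Qed.
End Extend.

(** [a] depends on the small extension only: its Artin-Schreier roots are what has to be adjoined,
    so it must be known before the larger ring exists. Hence [A'] is quantified after [a]. *)
Lemma crossed_ext : exists a : 'rV[A]_n,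
  forall (gT' : finGroupType) (A' : comNzRingType) (act' : gT' -> {rmorphism A' -> A'})
    (phi' : {rmorphism A' -> k}) (r : gT' -> gT) (inc : {rmorphism A -> A'}) (beta : 'rV[A']_n),
  (forall g h y, act' (g * h)%g y = act' h (act' g y)) ->
  (forall g y, phi' y = 0 -> phi' (act' g y) = 0) ->
  (forall g h, r (g * h)%g = (r g * r h)%g) ->
  (forall g y, inc (act (r g) y) = act' g (inc y)) ->
  (forall y, phi' (inc y) = phi y) ->
  (forall i, beta 0 i ^+ p - beta 0 i = inc (a 0 i)) ->
  exists f : gT' -> 'rV['F_p]_n, (forall g h, f (g * h)%g = f g *m rho (r h) + f h) /\
    (forall x, r x \in P -> (forall y, phi' (act' x y) = phi' y) -> f x = V (r x)).
Proof.
exists la => gT' A' act' phi' r inc beta act'M act'_phi rM inc_act inc_phi beta_eq.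
exists (ext inc_act inc_phi beta_eq); split; first exact: ext_cross.
exact: ext_P.
Qed.
End Crossed.

(** * Linear independence of characters *)

Section Dedekind.
Variables (A : Type) (mul : A -> A -> A) (one : A) (k : fieldType) (I : finType).
Variable chi : I -> A -> k.
Hypothesis chiM : forall i a b, chi i (mul a b) = chi i a * chi i b.
Hypothesis chi1 : forall i, chi i one = 1.

(** Induction on the number of nonzero coefficients: where [chi j] and [chi i0] differ at [a], the
    relation at [mul a b] minus [chi i0 a] times the relation at [b] loses the coefficient of [i0]
    but keeps that of [j]. *)
Lemma dedekind_distinct (c : I -> k) : (forall a, \sum_i c i * chi i a = 0) ->
  (forall i j, c i != 0 -> c j != 0 -> chi i = chi j -> i = j) -> forall i, c i = 0.
Proof.
elim: {c}_.+1 {-2}c (ltnSn #|[pred i | c i != 0]|) => // n IH c cn s0 cd i0.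
apply: contrapT => /eqP ci0.
have c0 j : j != i0 -> c j = 0.
  move=> ji; apply: contrapT => /eqP cj.
  have [a ca] : exists a, chi j a != chi i0 a.
    apply: contrapT => h; case/eqP: ji; apply: cd => //; apply: funext => a.
    by apply: contrapT => /eqP ca; apply: h; exists a.
  pose d i := c i * (chi i a - chi i0 a).
  have dc i : d i != 0 -> c i != 0 by rewrite mulf_eq0 negb_or => /andP[].
  have d0 : forall i, d i = 0.
    apply: IH => [|b|i l /dc ci /dc cl]; last exact: cd.
      rewrite ltnS in cn; apply: leq_trans cn; apply: proper_card; apply/properP; split.
        by apply/subsetP => i; rewrite !inE => /dc.
      by exists i0; rewrite !inE // /d subrr mulr0 eqxx.
    have -> : \sum_i d i * chi i b = \sum_i c i * chi i (mul a b) - chi i0 a * \sum_i c i * chi i b.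
      rewrite mulr_sumr -sumrB; apply: eq_bigr => i _.
      by rewrite /d chiM; ring.
    by rewrite !s0 mulr0 subrr.
  by have /eqP := d0 j; rewrite mulf_eq0 subr_eq0 (negPf cj) (negPf ca).
have := s0 one; rewrite (bigD1 i0) //= chi1 mulr1 big1 ?addr0 => [/eqP|j /c0->].
  by rewrite (negPf ci0).
by rewrite mul0r.
Qed.

(** The residue characters of different cosets may coincide; grouping equal characters under a
    chosen representative [rep] reduces to distinct ones. *)
Lemma dedekind (c : I -> k) i0 : (forall a, \sum_i c i * chi i a = 0) ->
  \sum_(i | `[< chi i = chi i0 >]) c i = 0.
Proof.
move=> s0; pose rep i := odflt i [pick j | `[< chi j = chi i >]].
have repE i : chi (rep i) = chi i.
  by rewrite /rep; case: pickP => //= j /asboolP.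
have rep_eq i j : chi i = chi j -> rep i = rep j.
  by move=> e; rewrite /rep; under eq_pick do rewrite e; case: pickP => //= /(_ j) /asboolP.
pose d i := if rep i == i then \sum_(j | rep j == i) c j else 0.
have d0 : forall i, d i = 0.
  apply: dedekind_distinct => [a|i j].
    rewrite -[RHS](s0 a) [RHS](partition_big rep predT) //=; apply: eq_bigr => i _.
    rewrite /d; case: (rep i =P i) => [ri|nri].
      rewrite mulr_suml; apply: eq_bigr => j /eqP <-; by rewrite repE.
    rewrite mul0r big1 // => j /eqP rj; case: nri; rewrite -{2}rj.
    by apply: rep_eq; rewrite -rj repE.
  rewrite /d; case: (rep i =P i) => [ri _|]; last by rewrite eqxx.
  case: (rep j =P j) => [rj _|]; last by rewrite eqxx.
  by move/rep_eq; rewrite ri rj.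
have := d0 (rep i0); rewrite /d (rep_eq (rep i0) i0) ?repE // eqxx => e.
rewrite -[RHS]e; apply: eq_bigl => i; apply/asboolP/eqP => [/rep_eq //|h].
by rewrite -repE h repE.
Qed.
End Dedekind.

(** * The ramification group *)

(* A finite Galois extension of K inside Om, presented as the image of [gj]. *)
Record gdata (V : hvf) := Gdata {
  gk : fieldType; gL : splittingFieldType gk; gj : {rmorphism gL -> hOm V};
  g_gal : galois 1 {:gL};
  g_base : forall y, y \in 1%VS <-> @hK V (gj y);
  g_K : forall x, @hK V x -> exists y, gj y = x }.

(** The roots of the minimal polynomials of the elements of [s] generate the extension. It is normal
    as the splitting field of the product of these polynomials, and separable because its generators
    are; the product itself may have repeated roots. *)
Lemma galois_closure (V : hvf) (s : seq (hOm V)) : (forall x, x \in s -> sep (@hK V) x) ->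
  exists D : gdata V, forall x, x \in s -> exists y, gj D y = x.
Proof.
move=> ss; have kK := sfK_K V; have hKK := sfK_sf kK.
have [rs [rsS ssub [f [Kf fE]]]] : exists rs, [/\ forall x, x \in rs -> sep (@hK V) x,
    {subset s <= rs} &
    exists f, poly_over (@hK V) f /\ f = \prod_(z <- rs) ('X - z%:P)].
  elim: s ss => [|x s IH] ss.
    exists [::]; split=> //; exists 1; rewrite big_nil; split=> //; exact: po1.
  have [rs [rsS sub [f [Kf fE]]]] : exists rs, [/\ forall x, x \in rs -> sep (@hK V) x,
    {subset s <= rs} &
    exists f, poly_over (@hK V) f /\ f = \prod_(z <- rs) ('X - z%:P)].
    by apply: IH => y ys; apply: ss; rewrite inE ys orbT.
  have sx := ss x (mem_head _ _).
  have [g mg] := minpoly_ex hKK (sep_alg sx); have [mong Kg gx gm] := mg.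
  have [t gE] := monic_split mong.
  exists (t ++ rs); split=> [y|y|].
  - rewrite mem_cat => /orP[yt|]; last exact: rsS.
    have [p [Kp sp px]] := sx; exists g; split=> //.
      by apply: dvdp_separable sp; apply: gm.
    by rewrite gE root_prod_XsubC.
  - rewrite inE mem_cat => /predU1P[->|/sub->]; last by rewrite orbT.
    by move: gx; rewrite gE root_prod_XsubC => ->.
  - by exists (g * f); split; [apply: poM | rewrite big_cat fE gE].
have [hE [hF [n [h]]]] := finext_ex (adjs_finite hKK (fun x xs => sep_alg (rsS x xs))).
have [u uE] : exists u : seq (fext h), map (fval h) u = rs.
  by apply: fval_lift_seq => y ys; apply: adjs_mem => // z /rsS/sep_alg.
have U1 : <<1 & u>>%VS = fullv.
  apply/eqP; rewrite eqEsubv subvf /=; apply/subvP => y _.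
  have [|z zU /fval_inj <- //] := @fval_adjs _ _ _ _ _ _ h u (fval h y).
  by rewrite uE; apply: fvalP.
have sax : splitting_field_axiom (fext h).
  have [q q1 fq] := po_fval_lift (fun x => iffLR (mem1_fvalP h x)) Kf.
  exists q => //; exists u => //.
  suff -> : q = \prod_(z <- u) ('X - z%:P) by rewrite eqpxx.
  apply: (map_poly_inj (fval h)); rewrite -fq fE.
  transitivity (\prod_(z <- map (fval h) u) ('X - z%:P)); first by rewrite uE.
  rewrite big_map rmorph_prod.
  by apply: eq_bigr => z _; rewrite rmorphB /= map_polyX map_polyC.
pose mixin := FieldExt_isSplittingField.Build _ (fext h) sax.
pose LS : splittingFieldType _ := HB.pack (fext h) mixin.
have gal : galois 1 {:LS}.
  rewrite /galois sub1v normalFieldf andbT /=; apply/separableP => y _.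
  apply/(sep_fvalP y (mem1_fvalP h)); apply: (sep_gen hKK rsS).
  exact: fvalP.
have KL x : @hK V x -> exists y, fval h y = x by move=> Kx; apply: fval_lift; apply: (fed_sub h).
exists (@Gdata V _ LS (fval h) gal (fun y => mem1_fval y) KL) => x xs /=.
by apply: fval_lift; apply: adjs_mem => [//|z /rsS/sep_alg //|]; apply: ssub.
Qed.

Lemma subfield_pred (k : fieldType) (L : fieldExtType k) (P : L -> Prop) : is_subfield P ->
  (forall y, y \in 1%VS -> P y) -> exists N : {subfield L}, forall y, y \in N <-> P y.
Proof.
move=> hP P1; pose Q m := exists2 N : {subfield L}, \dim N = m & forall y, y \in N -> P y.
have Q0 : exists m, `[< Q m >] by exists (\dim (1%AS : {subfield L})); apply/asboolP; exists 1%AS.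
have Qle m : `[< Q m >] -> (m <= \dim {:L})%N.
  by move=> /asboolP[N <- _]; apply/dimvS/subvf.
case: (ex_maxnP Q0 Qle) => m /asboolP[N dN NP] mmax; exists N => y; split; first exact: NP.
move=> Py; have NN : (N <= <<N; y>>)%VS by apply: subv_adjoin.
suff -> : (N : {vspace L}) = <<N; y>>%VS by apply: memv_adjoin.
apply/eqP; rewrite eqEdim NN dN /=; apply: mmax; apply/asboolP; exists <<N; y>>%AS => // z.
case/Fadjoin_polyP => p /polyOverP Np ->; rewrite horner_coef; apply: (sf_sum hP) => i _.
by apply: sfM => //; [apply/NP/Np | apply: sfX].
Qed.

Section Ramification.
Variables (V : hvf) (D : gdata V).
Local Notation Om := (hOm V).
Local Notation O := (@hO V).
Local Notation kappa := (hk V).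
Local Notation res := (@hres V).
Local Notation K := (@hK V).
Local Notation U := (unitO O).
Local Notation ppow := ([pchar kappa].-nat).
Local Notation L := (gL D).
Local Notation j := (gj D).
Local Notation gT := (gal_of {:L}).
Implicit Types (g h : gT) (y z t : L).

Lemma gal_all g : g \in 'Gal({:L} / 1)%g.
Proof. by rewrite gal_kHom ?sub1v // k1AHom. Qed.

Lemma gal_base g y : y \in 1%VS -> g y = y.
Proof. by apply: fixed_gal (gal_all g); apply: sub1v. Qed.

Lemma gal_O g y : O (j y) -> O (j (g y)).
Proof.
pose S a b := exists y, a = j y /\ b = j (g y).
move=> Oy; suff h : O (j y) <-> O (j (g y)) by apply/h.
apply: (@emb_O V K S (sfK_K V)); last by exists y.
- move=> e Ke; have [z ze] := g_K D Ke; exists z; rewrite ze; split=> //.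
  by rewrite gal_base ?ze //; apply/g_base; rewrite ze.
- by move=> _ _ _ _ [a [-> ->]] [b [-> ->]]; exists (a - b); rewrite !rmorphB.
- by move=> _ _ _ _ [a [-> ->]] [b [-> ->]]; exists (a * b); rewrite !rmorphM.
- by move=> _ [a [/esym/eqP + ->]]; rewrite fmorph_eq0 => /eqP->; rewrite !rmorph0.
Qed.

Lemma gal_U g y : U (j y) -> U (j (g y)).
Proof.
move=> [Oy y0 OV]; split; first exact: gal_O.
  by rewrite !fmorph_eq0 in y0 *.
by rewrite -!fmorphV; apply: gal_O; rewrite fmorphV.
Qed.

Lemma gal_res0 g y : O (j y) -> res (j y) = 0 -> res (j (g y)) = 0.
Proof.
move=> Oy r0; apply: nU_res; first exact: gal_O.
move=> Uy; have := gal_U g^-1%g Uy; rewrite -galM ?memvf // mulgV gal_id.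
by move=> /res_neq0; rewrite r0 eqxx.
Qed.

Lemma gal_res g y z : O (j y) -> O (j z) -> res (j y) = res (j z) -> res (j (g y)) = res (j (g z)).
Proof.
move=> Oy Oz e; have Oyz : O (j (y - z)) by rewrite rmorphB; apply: OB.
have /(gal_res0 g Oyz) : res (j (y - z)) = 0 by rewrite rmorphB resB // e subrr.
have -> : j (g (y - z)) = j (g y) - j (g z) by rewrite raddfB rmorphB.
by rewrite resB; [move/eqP; rewrite subr_eq0 => /eqP | apply: gal_O..].
Qed.

Lemma gal_ou g t : ou (j t) -> ou (j (g t)).
Proof.
move=> [Ot rt]; split; first exact: gal_O.
have -> : 1 = res (j (g 1)) by rewrite !rmorph1 res1.
by apply: gal_res => //; rewrite rmorph1 ?res1 //; apply: O1.
Qed.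

Lemma ppow_inj q (a : kappa) : ppow q -> a ^+ q = 1 -> a = 1.
Proof.
move=> qp e; apply/eqP; rewrite -subr_eq0; have q0 : (0 < q)%N by case/andP: qp.
have : (a - 1) ^+ q == 0.
  by apply/eqP/(addIr 1); rewrite add0r -{2}[1](expr1n _ q) -exprDn_pchar // subrK.
by rewrite expf_eq0 q0.
Qed.

Lemma gal_quoM g h y : y != 0 -> (g * h)%g y / y = h (g y / y) * (h y / y).
Proof.
move=> y0; have hy0 : h y != 0 by rewrite fmorph_eq0.
by rewrite galM ?memvf // rmorphM fmorphV mulrA divfK.
Qed.

(** If [g z / z] is integral, then so are the quotients for all powers of [g]. As [g] has finite
    order, the cocycle rule [gal_quoM] provides an integral inverse of [g z / z]. Otherwise the
    argument is applied to [y^-1]. *)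
Lemma gal_unit g y : y != 0 -> U (j (g y / y)).
Proof.
suff main z : z != 0 -> O (j (g z / z)) -> U (j (g z / z)).
  move=> y0; have [|Ou|Ou] := @Ocase V (j (g y / y)).
  - by rewrite fmorph_eq0 mulf_neq0 ?invr_eq0 // fmorph_eq0.
  - exact: main.
  - have e : j (g y / y)^-1 = j (g y^-1 / y^-1) by rewrite invfM invrK fmorphV mulrC.
    rewrite -fmorphV e in Ou; rewrite -[g y / y]invrK [j _]fmorphV; apply: UV.
    by rewrite e; apply: main; rewrite ?invr_eq0.
move=> z0 Oz; have Om m : O (j ((g ^+ m)%g z / z)).
  elim: m => [|m IH]; first by rewrite expg0 gal_id divff // rmorph1; apply: O1.
  by rewrite expgSr gal_quoM // rmorphM; apply: OM => //; apply: gal_O.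
apply: (UMl (y := j (g ((g ^+ #[g].-1)%g z / z)))) => //; first exact/gal_O/Om.
rewrite -rmorphM mulrC -gal_quoM // -expgSr prednK ?order_gt0 // expg_order gal_id divff //.
by rewrite rmorph1; apply: U1.
Qed.

Lemma gal_ouX g y m : y != 0 -> j (g (y ^+ m) / y ^+ m) = j (g y / y) ^+ m.
Proof. by move=> y0; rewrite rmorphXn -expr_div_n rmorphXn. Qed.

Definition rng x := exists y, j y = x.

Lemma rng_subfield : is_subfield rng.
Proof.
have mk y : rng (j y) by exists y.
split.
- by rewrite -(rmorph0 j).
- by rewrite -(rmorph1 j).
- by move=> _ _ [a <-] [b <-]; rewrite -rmorphB.
- by move=> _ _ [a <-] [b <-]; rewrite -rmorphM.
- by move=> _ [a <-]; rewrite -fmorphV.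
Qed.

Lemma sfK_rng : @sfK V rng.
Proof. by split; [exact: rng_subfield | exact: g_K]. Qed.

Fact N_ex : exists N : {subfield L}, forall y, y \in N <-> kr K (j y).
Proof.
have hk := kr_subfield (sfK_K V); apply: subfield_pred.
  split.
  - by rewrite rmorph0; apply: sf0.
  - by rewrite rmorph1; apply: sf1.
  - by move=> a b; rewrite rmorphB; apply: sfB.
  - by move=> a b; rewrite rmorphM; apply: sfM.
  - by move=> a + a0; rewrite fmorphV; apply: sfV.
by move=> y y1; apply: kr_base; apply/g_base.
Qed.

Definition gN := projT1 (cid N_ex).
Lemma gNP y : y \in gN <-> kr K (j y). Proof. exact: (projT2 (cid N_ex)). Qed.

Definition gfix g x := exists2 y, g y = y & j y = x.

Lemma gfix_subfield g : is_subfield (gfix g).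
Proof.
have mk y : g y = y -> gfix g (j y) by move=> gy; exists y.
split.
- by rewrite -(rmorph0 j); apply/mk/rmorph0.
- by rewrite -(rmorph1 j); apply/mk/rmorph1.
- by move=> _ _ [a ga <-] [b gb <-]; rewrite -rmorphB; apply: mk; rewrite rmorphB /= ga gb.
- by move=> _ _ [a ga <-] [b gb <-]; rewrite -rmorphM; apply: mk; rewrite rmorphM /= ga gb.
- by move=> _ [a ga <-] _; rewrite -fmorphV; apply: mk; rewrite fmorphV /= ga.
Qed.

Lemma gfix_K g : Defs.subset K (gfix g).
Proof.
move=> x Kx; have [y yx] := g_K D Kx; exists y => //.
by apply: gal_base; apply/g_base; rewrite yx.
Qed.

Lemma gal_root g y (f : {poly Om}) : poly_over (gfix g) f -> root f (j y) -> root f (j (g y)).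
Proof.
move=> Kf /rootP fy; apply/rootP.
have : exists q : {poly L}, f = map_poly j q /\ map_poly g q = q.
  elim/poly_ind: f Kf {fy} => [|f c IH] Kf.
    by exists 0; rewrite !map_poly0.
  have [d gd dc] : gfix g c by have := Kf 0%N; rewrite coefD coefC coefMX add0r.
  have [i|q [fq q1]] := IH; first by have := Kf i.+1; rewrite coefD coefC coefMX addr0.
  exists (q * 'X + d%:P); split; first by rewrite rmorphD rmorphM /= map_polyX map_polyC /= dc fq.
  by rewrite rmorphD rmorphM /= map_polyX map_polyC /= gd q1.
case=> q [fq q1]; move: fy; rewrite fq !horner_map => /eqP; rewrite fmorph_eq0 => /eqP y0.
by rewrite -{1}q1 horner_map y0 !rmorph0.
Qed.

(** Otherwise [1 + x + ... + x ^+ m.-1] vanishes, while its residue is [m]. *)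
Lemma ou_root_unity m (x : Om) : m%:R != 0 :> kappa -> x ^+ m = 1 -> ou x -> x = 1.
Proof.
move=> m0 xm [Ox rx]; apply/eqP; rewrite -subr_eq0; have /eqP := subrX1 x m.
rewrite xm subrr eq_sym mulf_eq0 => /orP[//|/eqP s0]; case/eqP: m0.
have := res0 V; rewrite -s0 res_sum => [<-|i _]; last exact: OX.
rewrite (eq_bigr (fun _ => 1)) ?sumr_const ?card_ord // => i _.
by rewrite resX // rx expr1n.
Qed.

(** For [unr], [g y] is a root of the same polynomial with the same residue as [y]; since [y] is a
    simple root modulo the maximal ideal, [g y = y]. For [rad], [g y / y] is an [m]-th root of unity
    and a 1-unit, hence 1. *)
Lemma gfix_telt g y : (forall z, z != 0 -> ou (j (g z / z))) -> telt (gfix g) (j y) -> g y = y.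
Proof.
move=> oug ty; have [->|y0] := eqVneq y 0; first by rewrite rmorph0.
have oy := oug _ y0; have jy0 : j y != 0 by rewrite fmorph_eq0.
have jE : j (g y) = j (g y / y) * j y by rewrite -rmorphM divfK.
apply: (fmorph_inj j); case: ty => [[f [mf gf fy fO Uf]]|[m [m0 _ [z gz zE]]]].
  apply: contrapT => ne; have Oy := fO _ fy; have fgy := gal_root gf fy.
  have [h fh] := factor_theorem _ _ fy; have mh : h \is monic.
    by move: mf; rewrite fh monicMr ?monicXsubC.
  have hO : poly_over O h by apply: monic_O => // b hb; apply: fO; rewrite fh rootM hb.
  have hy : h.[j (g y)] = 0.
    move/rootP: fgy; rewrite fh hornerM hornerXsubC => /eqP; rewrite mulf_eq0 subr_eq0.
    by case/orP => /eqP.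
  move: Uf; rewrite fh derivM derivXsubC !hornerE subrr mulr0 add0r => /res_neq0/eqP; apply.
  rewrite res_horner // -(res0 V) -hy res_horner //; last exact: gal_O.
  by rewrite [in RHS]jE resM ?oy.2 ?mul1r //; case: oy.
rewrite jE (ou_root_unity m0 _ oy) ?mul1r //.
have zy : z = y ^+ m by apply: (fmorph_inj j); rewrite zE rmorphXn.
by rewrite -gal_ouX // -zy gz divff ?rmorph1 // zy expf_neq0.
Qed.

Lemma gfix_chain g E s : (forall z, z != 0 -> ou (j (g z / z))) ->
  Defs.subset E (gfix g) -> (forall x, x \in s -> rng x) -> tchain E s ->
  Defs.subset (adjs E s) (gfix g).
Proof.
move=> oug; elim: s E => [|a s IH] E Eg sr //= [ta ts]; apply: IH => //; last first.
  by move=> x xs; apply: sr; rewrite inE xs orbT.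
apply: adj_least => //; first exact: gfix_subfield.
have [y ya] := sr _ (mem_head _ _); exists y => //; apply: gfix_telt => //.
by rewrite ya; apply: teltS ta.
Qed.

(** From left to right, [pw_lemma] makes [L] purely wild over its intersection with [kr K]:
    [y ^+ q = w * z] with [w] a 1-unit and [z] fixed by [g], so the [q]-th power of [g y / y] is a
    1-unit, and Frobenius is injective on residues. From right to left, every element of [gN] lies
    in a tower of tame elements inside [L], which [g] fixes by [gfix_chain]. *)
Lemma ramP g : g \in 'Gal({:L} / gN)%g <-> forall y, y != 0 -> ou (j (g y / y)).
Proof.
have kK := sfK_K V; split=> [gN_ y y0|oug].
  pose E x := kr K x /\ rng x; have krK := kr_sfK kK.
  have hE : is_subfield E.
    have := rng_subfield; have := sfK_sf krK; case=> a1 a2 a3 a4 a5 [b1 b2 b3 b4 b5].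
    split=> // [x z [? ?] [? ?]|x z [? ?] [? ?]|x [? ?] ?]; split; auto.
  have KE : Defs.subset K E by move=> x Kx; split; [apply: kr_base | apply: g_K].
  have noT a : rng a -> telt E a -> E a.
    move=> ra ta; split=> //; apply: (kr_telt kK); apply: teltS ta => x [] //.
  have jy0 : j y != 0 by rewrite fmorph_eq0.
  have ry : rng (j y) by exists y.
  have pwE := pw_lemma (sfK_sub kK hE KE) sfK_rng (fun x => @proj2 _ _) noT.
  have [q [c [qp [kc [z zc]] c0 oc]]] := pwE _ ry jy0.
  have z0 : z != 0 by rewrite -(fmorph_eq0 j) zc.
  have gz : g z = z by apply: fixed_gal gN_ _; rewrite ?subvf //; apply/gNP; rewrite zc.
  split; first exact: (U_O (gal_unit g y0)).
  apply: (ppow_inj qp); rewrite -resX; last exact: (U_O (gal_unit g y0)).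
  rewrite -gal_ouX //; pose w := y ^+ q / z.
  have yq : y ^+ q = w * z by rewrite /w divfK.
  have w0 : w != 0 by rewrite mulf_neq0 ?expf_neq0 ?invr_eq0.
  have ow : ou (j w) by rewrite /w rmorphM fmorphV rmorphXn zc.
  have -> : g (y ^+ q) / y ^+ q = g w / w.
    by rewrite yq rmorphM /= gz invfM mulrACA divff ?mulr1.
  by rewrite rmorphM fmorphV; apply: (proj2 (ou_div (gal_ou g ow) ow)).
rewrite gal_kHom ?subvf //; apply/kAHomP => u /gNP ku.
have hA := adj_finite (sfK_sf kK) (alg_all (j u) kK).
have hs := adj_least (kr_subfield kK) (kr_base (E := K)) ku.
have [s cs sE] := tfin_chain kK (kr_finite kK hA hs).
have ru : adj K (j u) (j u) by apply/adj_mem/sfK_sf.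
have sr x : x \in s -> rng x.
  move=> xs; apply: (adj_least rng_subfield (@g_K _ D) (a := j u)); first by exists u.
  rewrite sE; apply: (adjs_mem (sfK_sf kK)) => // ? _; exact: alg_all kK.
have As : adjs K s (j u) by rewrite -sE.
by have [w gw /fmorph_inj <-] := gfix_chain oug (gfix_K g) sr cs As.
Qed.
End Ramification.

(** * The ramification group as a normal p-subgroup, and the valuation ring of L *)

Section RamGroup.
Variables (V : hvf) (D : gdata V).
Local Notation Om := (hOm V).
Local Notation O := (@hO V).
Local Notation kappa := (hk V).
Local Notation res := (@hres V).
Local Notation K := (@hK V).
Local Notation U := (unitO O).
Local Notation ppow := ([pchar kappa].-nat).
Local Notation L := (gL D).
Local Notation j := (gj D).
Local Notation gT := (gal_of {:L}).
Implicit Types (g h : gT) (y z t : L).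

Definition gP : {group gT} := 'Gal({:L} / gN D)%G.
Lemma gP_P g : g \in gP <-> forall y, y != 0 -> ou (j (g y / y)).
Proof. exact: ramP. Qed.

Lemma gP_act_ou g y : g \in gP -> y != 0 -> ou (j (g y / y)).
Proof. by move=> /gP_P; apply. Qed.

Lemma gP_normal : gP <| [set: gT].
Proof.
rewrite /normal subsetT; apply/subsetP => g _; rewrite inE; apply/subsetP => _ /imsetP[x xP ->].
apply/gP_P => y y0; pose w := g^-1%g y.
have w0 : w != 0 by rewrite fmorph_eq0.
have yE : y = g w by rewrite /w -galM ?memvf // mulVg gal_id.
have -> : (x ^ g)%g y / y = g (x w / w).
  by rewrite rmorphM fmorphV /= -yE /conjg mulgA galM ?memvf // galM ?memvf.
by apply/gal_ou/gP_act_ou.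
Qed.

(* If r were invertible in kappa, some z <> 0 would have trace 0 under an element of order r of P,
   while z divides its trace with a quotient of residue r. *)
Lemma gP_prime r : prime r -> (r %| #|gP|)%N -> r%:R = 0 :> kappa.
Proof.
move=> pr /(Cauchy pr)[x xP xr]; apply: contrapT => /eqP r0.
have rL0 : r%:R != 0 :> L.
  by have [_ + _] := U_nat r0; rewrite -(rmorph_nat j) fmorph_eq0.
have [y xy] : exists y, x y != y.
  apply: contrapT => nx; have x1 : x = 1%g.
    by apply/eqP/gal_eqP => y _; rewrite gal_id; apply: contrapT => /eqP e; apply: nx; exists y.
  by move: pr; rewrite -xr x1 order1.
pose tr y := \sum_(i < r) (x ^+ i)%g y.
have xtr : x (tr y) = tr y.
  rewrite /tr rmorph_sum /=; case: (r) pr xr => // r' _ xr.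
  rewrite big_ord_recr [RHS]big_ord_recl /= -galM ?memvf // -expgSr -{1}xr expg_order expg0 addrC.
  by congr (_ + _); apply: eq_bigr => i _; rewrite -galM ?memvf // -expgSr.
pose z := y - tr y / r%:R.
have xz : x z = x y - tr y / r%:R by rewrite rmorphB rmorphM fmorphV rmorph_nat /= xtr.
have z0 : z != 0.
  apply: contraNneq xy => z0; rewrite -subr_eq0 -(subrKA (tr y / r%:R)).
  by rewrite -[_ - y]opprB -/z -xz z0 rmorph0 subr0.
have trz : tr z = 0.
  rewrite /tr /z; under eq_bigr do rewrite rmorphB rmorphM fmorphV rmorph_nat /=.
  rewrite sumrB -/(tr y) -mulr_suml.
  have -> : \sum_(i < r) (x ^+ i)%g (tr y) = tr y * r%:R.
    rewrite (eq_bigr (fun _ => tr y)) ?sumr_const ?card_ord ?mulr_natr // => i _.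
    by elim: (i : nat) => [|m IH]; rewrite ?expg0 ?gal_id // expgSr galM ?memvf // IH.
  by rewrite mulfK // subrr.
have: res (j (tr z / z)) = r%:R.
  rewrite /tr mulr_suml rmorph_sum res_sum => [|i _]; last first.
    by case: (gP_act_ou (groupX i xP) z0).
  rewrite (eq_bigr (fun _ => 1)) ?sumr_const ?card_ord // => i _.
  by case: (gP_act_ou (groupX i xP) z0).
by rewrite trz mul0r rmorph0 res0 => /esym/eqP; rewrite (negPf r0).
Qed.

Lemma gP_pgroup : gP :!=: 1%g -> exists2 p, p \in [pchar kappa] & p.-group gP.
Proof.
move=> nt; have gt1 : (1 < #|gP|)%N by rewrite cardG_gt1.
exists (pdiv #|gP|).
  by rewrite inE pdiv_prime //=; apply/eqP/gP_prime; rewrite ?pdiv_prime ?pdiv_dvd.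
have pk : pdiv #|gP| \in [pchar kappa].
  by rewrite inE pdiv_prime //=; apply/eqP/gP_prime; rewrite ?pdiv_prime ?pdiv_dvd.
apply/pgroupP => r pr rP; rewrite -(GRing.pcharf_eq pk) inE pr /=.
by apply/eqP/gP_prime.
Qed.

Definition Ovr : {pred L} := fun y => `[< O (j y) >].
Lemma OvrP y : y \in Ovr <-> O (j y). Proof. by split => /asboolP. Qed.

Fact Ovr_subring : subring_closed Ovr.
Proof.
split; first by apply/OvrP; rewrite rmorph1; apply: O1.
- by move=> a b /OvrP Oa /OvrP Ob; apply/OvrP; rewrite rmorphB; apply: OB.
- by move=> a b /OvrP Oa /OvrP Ob; apply/OvrP; rewrite rmorphM; apply: OM.
Qed.
HB.instance Definition _ := GRing.isSubringClosed.Build L Ovr Ovr_subring.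

Record gO := GO { gOval : L; gO_in : gOval \in Ovr }.
HB.instance Definition _ := [isSub for gOval].
HB.instance Definition _ := [Choice of gO by <:].
HB.instance Definition _ := [SubChoice_isSubComNzRing of gO by <:].

Lemma gO_O (a : gO) : O (j (val a)). Proof. exact/OvrP/valP. Qed.

Definition gact_fun g (a : gO) : gO := GO (iffRL (OvrP _) (gal_O g (gO_O a))).
Fact gact_zmod g : zmod_morphism (gact_fun g).
Proof. by move=> a b; apply: val_inj; rewrite /= rmorphB. Qed.
Fact gact_monoid g : monoid_morphism (gact_fun g).
Proof. by split; [|move=> a b]; apply: val_inj; rewrite /= ?rmorph1 ?rmorphM. Qed.
Definition gact g : {rmorphism gO -> gO} :=
  HB.pack (gact_fun g) (GRing.isZmodMorphism.Build _ _ (gact_fun g) (gact_zmod g))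
            (GRing.isMonoidMorphism.Build _ _ (gact_fun g) (gact_monoid g)).
Lemma gactE g a : val (gact g a) = g (val a). Proof. by []. Qed.

Definition gphi_fun (a : gO) : kappa := res (j (val a)).
Fact gphi_zmod : zmod_morphism gphi_fun.
Proof. by move=> a b; rewrite /gphi_fun /= rmorphB resB //; apply: gO_O. Qed.
Fact gphi_monoid : monoid_morphism gphi_fun.
Proof.
split; first by rewrite /gphi_fun rmorph1 res1.
by move=> a b; rewrite /gphi_fun /= rmorphM resM //; apply: gO_O.
Qed.
Definition gphi : {rmorphism gO -> kappa} :=
  HB.pack gphi_fun (GRing.isZmodMorphism.Build _ _ gphi_fun gphi_zmod)
            (GRing.isMonoidMorphism.Build _ _ gphi_fun gphi_monoid).
Lemma gphiE a : gphi a = res (j (val a)). Proof. by []. Qed.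

Lemma gactM g h a : gact (g * h)%g a = gact h (gact g a).
Proof. by apply: val_inj; rewrite !gactE galM ?memvf. Qed.

Lemma gact_phi g a : gphi a = 0 -> gphi (gact g a) = 0.
Proof. by apply: gal_res0; apply: gO_O. Qed.

Lemma gact_P x a : x \in gP -> gphi (gact x a) = gphi a.
Proof.
move=> xP; rewrite !gphiE gactE; have [->|y0] := eqVneq (val a) 0; first by rewrite !rmorph0.
have [Oz rz] := gP_act_ou xP y0; rewrite -(divfK y0 (x (val a))) rmorphM resM //.
  by rewrite rz mul1r.
exact: gO_O.
Qed.

Lemma gact1 a : gact 1%g a = a.
Proof. by apply: val_inj; rewrite gactE gal_id. Qed.

Lemma gphi_inv a : gphi a != 0 -> exists b, a * b = 1.
Proof.
move=> a0; have [_ + Ov] := resU (gO_O a) a0; rewrite fmorph_eq0 => v0.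
have Ob : (val a)^-1 \in Ovr by apply/OvrP; rewrite fmorphV.
by exists (GO Ob); apply: val_inj; rewrite /= divff.
Qed.

Fact ginert_group : group_set [set g : gT | `[< forall a, gphi (gact g a) = gphi a >] ].
Proof.
apply/group_setP; split; first by rewrite inE; apply/asboolP => a; rewrite gact1.
move=> g h; rewrite !inE => /asboolP gi /asboolP hi; apply/asboolP => a.
by rewrite gactM hi gi.
Qed.
Definition ginert := Group ginert_group.

Lemma ginertP g : g \in ginert -> forall a, gphi (gact g a) = gphi a.
Proof. by rewrite inE => /asboolP. Qed.

Lemma gP_sub_inert : gP \subset ginert.
Proof. by apply/subsetP => x xP; rewrite inE; apply/asboolP => a; apply: gact_P. Qed.

(** On the inertia group the residue of [g y / y] is multiplicative in powers of [g], so its [p]-th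
    power is 1 and injectivity of Frobenius makes it 1. Hence inertia modulo [P] has no element of
    order [p]. *)
Lemma inert_root p g : p \in [pchar kappa] -> g \in ginert -> (g ^+ p)%g \in gP -> g \in gP.
Proof.
move=> pk gi gp; apply/(iffRL (gP_P _)) => y y0.
have Uu := gal_unit g y0; have Ou := U_O Uu; split=> //.
pose u := GO (iffRL (OvrP _) Ou).
have pp : ppow p by rewrite pnatE //; case/andP: pk.
apply: (ppow_inj pp); rewrite -/(gphi u).
have h m : exists2 w, gphi w = gphi u ^+ m & val w = (g ^+ m)%g y / y.
  elim: m => [|m [w pw_ wE]]; first by exists 1; rewrite ?rmorph1 // expg0 gal_id divff.
  exists (gact g w * u); first by rewrite rmorphM ginertP // pw_ exprSr.
  by rewrite expgSr gal_quoM // -wE.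
have [w <- wE] := h p; rewrite gphiE wE.
by case: (gP_act_ou gp y0).
Qed.

(* By Dedekind, if the trace vanished then the inertia group modulo P would have order divisible
   by p; but inertia modulo P is prime to p. *)
Lemma theta_ex p : p \in [pchar kappa] ->
  exists theta, csum gP (fun t : gT => gphi (gact t theta)) = 1.
Proof.
move=> pk; have p_pr : prime p by case/andP: pk.
have [a s0] : exists a, csum gP (fun t : gT => gphi (gact t a)) != 0.
  apply: contrapT => na.
  have s0 a : \sum_(C : {set gT}) (C \in rcosets gP [set: gT])%:R * gphi (gact (repr C) a) = 0.
    have [|ne] := eqVneq (csum gP (fun t : gT => gphi (gact t a))) 0; last by case: na; exists a.
    rewrite /csum big_mkcond /= => e; rewrite -[RHS]e; apply: eq_bigr => C _.
    by case: (C \in _); rewrite ?mul1r ?mul0r.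
  pose chi (C : {set gT}) a := gphi (gact (repr C) a).
  have chiM C a b : chi C (a * b) = chi C a * chi C b by rewrite /chi !rmorphM.
  have chi1 C : chi C 1 = 1 by rewrite /chi !rmorph1.
  have rP : repr gP \in gP by apply: (mem_repr 1%g).
  have := dedekind chiM chi1 (gval gP) s0; rewrite -natr_sum.
  have -> : (\sum_(C | `[< chi C = chi gP >]) (C \in rcosets gP [set: gT]) = #|rcosets gP ginert|)%N.
    rewrite -sum1_card big_mkcond [RHS]big_mkcond /=; apply: eq_bigr => C _.
    case: asboolP => [e|ne].
      suff -> : (C \in rcosets gP [set: gT]) = (C \in rcosets gP ginert) by case: ifP.
      apply/idP/idP => [|/rcosetsP[g _ ->]]; last by apply/rcosetsP; exists g; rewrite ?inE.
      move=> CP; rewrite (rcosets_repr CP); apply/rcosetsP; exists (repr C) => //.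
      rewrite inE; apply/asboolP => a; rewrite -[LHS]/(chi C a) e; exact: gact_P.
    case: ifP => // /rcosetsP[g gi CE]; case: ne; apply/funext => a; rewrite /chi [RHS]gact_P //.
    rewrite CE; have /rcosetP[x xP ->] := mem_repr_rcoset gP g.
    by rewrite gactM ginertP // gact_P.
  move=> i0; have : (p %| #|ginert : gP|)%N.
    by rewrite (dvdn_pcharf pk); apply/eqP.
  have nPI : gP <| ginert by apply: normalS gP_normal; [apply: gP_sub_inert | apply: subsetT].
  rewrite -card_quotient; last exact: normal_norm.
  case/(Cauchy p_pr) => _ /morphimP[g Ng gi ->] og.
  have gp : (g ^+ p)%g \in gP.
    by apply: coset_idr; rewrite ?groupX // morphX //= -og expg_order.
  move: og; rewrite /= (coset_id (inert_root pk gi gp)) order1 => e.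
  by rewrite -e in p_pr.
(* The trace [w] of [a] is a unit whose conjugates all have the same residue. The same then holds
   for its inverse [b], so the trace of [a * b] has residue 1. *)
pose w := \sum_(C in rcosets gP [set: gT]) gact (repr C) a.
have wE g : gphi (gact g w) = csum gP (fun t : gT => gphi (gact t a)).
  rewrite -(csum_shift (P := gP) (S := fun t : gT => gphi (gact t a)) g); last first.
    move=> x g0 xP; rewrite gactM; apply/eqP.
    by rewrite -subr_eq0 -!rmorphB gact_phi // rmorphB gact_P ?subrr.
  by rewrite /csum !rmorph_sum; apply: eq_bigr => C _; rewrite gactM.
have [b wb] : exists b, w * b = 1 by apply: gphi_inv; rewrite -[w]gact1 wE.
exists (a * b); rewrite -[RHS](rmorph1 gphi) -wb rmorphM -[w in RHS]gact1 wE.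
rewrite /csum mulr_suml; apply: eq_bigr => C _; rewrite !rmorphM; congr (_ * _).
apply: (mulfI s0); rewrite -{1}(wE (repr C)) -[X in _ = X * _](wE 1%g) gact1 -!rmorphM wb.
by rewrite !rmorph1.
Qed.
End RamGroup.

(** * Restriction from a larger Galois extension to a smaller one *)

Section GaloisTower.
Variables (V : hvf) (D : gdata V).
Local Notation Om := (hOm V).
Local Notation O := (@hO V).
Local Notation kappa := (hk V).
Local Notation res := (@hres V).
Local Notation K := (@hK V).
Local Notation L := (gL D).
Local Notation j := (gj D).
Local Notation gT := (gal_of {:L}).

Lemma po_minpoly y : poly_over K (map_poly j (minPoly 1 y)).
Proof. by move=> i; rewrite coef_map; apply/g_base; apply: (polyOverP (minPolyOver 1 y)). Qed.

Lemma rng_sep x : rng D x -> sep K x.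
Proof.
move=> [y <-]; exists (map_poly j (minPoly 1 y)); split; first exact: po_minpoly.
  rewrite separable_map; have /and3P[_ /separableP/(_ y (memvf y)) + _] := g_gal D.
  by [].
by rewrite /root horner_map minPolyxx rmorph0.
Qed.

Lemma gj_gen : exists2 s : seq Om, (forall x, x \in s -> rng D x) &
  forall E, is_subfield E -> Defs.subset K E -> (forall x, x \in s -> E x) -> Defs.subset (rng D) E.
Proof.
exists [seq j b | b <- vbasis {:L}] => [_ /mapP[y _ ->]|E hE KE sE _ [y <-]]; first by exists y.
rewrite (coord_vbasis (memvf y)) rmorph_sum; apply: (sf_sum hE) => i _.
rewrite -mulr_algl rmorphM; apply: sfM => //.
  by apply: KE; apply/g_base; rewrite rpredZ ?mem1v.
by apply: sE; apply: map_f; apply: mem_nth; rewrite size_tuple.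
Qed.

Lemma rng_finite : finite_ext K (rng D).
Proof.
have [s sr gen] := gj_gen; have kK := sfK_K V.
have fA : finite_ext K (adjs K s) by apply: (adjs_finite (sfK_sf kK)) => x _; apply: alg_all kK.
have hA := sfK_sf (sfK_adjs s kK).
have sub : Defs.subset (rng D) (adjs K s).
  apply: gen => //; first by case: (sfK_adjs s kK).
  by move=> x xs; apply: (adjs_mem (sfK_sf kK)) => // z _; apply: alg_all kK.
by have [] := finite_ext_sub (rng_subfield D) (@g_K _ D) sub fA.
Qed.

Lemma gP_nontriv x : rng D x -> ~ kr K x -> gP D :!=: 1%g.
Proof.
move=> [y <-] nk; apply/eqP => P1; apply/nk/gNP.
have gal : galois (gN D) {:L} by apply: galoisS (g_gal D); rewrite sub1v subvf.
rewrite -(elimT galois_fixedField gal); apply/fixedFieldP; first exact: memvf.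
by move=> g; rewrite -[('Gal(_ / _))%g]/(gval (gP D)) P1 => /set1P->; rewrite gal_id.
Qed.

Variable D' : gdata V.
Local Notation L' := (gL D').
Local Notation j' := (gj D').
Local Notation gT' := (gal_of {:L'}).
Hypothesis DD' : Defs.subset (rng D) (rng D').

Fact gup_ex (y : L) : exists y' : L', j' y' = j y.
Proof. by apply: DD'; exists y. Qed.
Definition gup y := projT1 (cid (gup_ex y)).
Lemma gupE y : j' (gup y) = j y. Proof. exact: projT2 (cid (gup_ex y)). Qed.

Lemma gup_eq y z : j' z = j y -> z = gup y.
Proof. by move=> e; apply: (fmorph_inj j'); rewrite gupE. Qed.

(** [g] sends [y] to a root of the minimal polynomial of [y], which splits in [L], so it maps [L]
    into itself. *)
Fact rst_ex (g : gT') : exists h : gT, forall y, j (h y) = j' (g (gup y)).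
Proof.
have fex y : exists z, j z = j' (g (gup y)).
  have [r [_ _ rE]] := elimT (galois_factors (sub1v _)) (g_gal D) y (memvf y).
  have : root (map_poly j (minPoly 1 y)) (j' (g (gup y))).
    apply: gal_root; last by rewrite gupE /root horner_map minPolyxx rmorph0.
    by move=> i; apply: gfix_K; apply: po_minpoly.
  rewrite rE rmorph_prod.
  under eq_bigr do rewrite rmorphB /= map_polyX map_polyC.
  rewrite -(big_map j xpredT (fun c => 'X - c%:P)) root_prod_XsubC => /mapP[z _ e].
  by exists z.
pose f y := projT1 (cid (fex y)).
have fE y : j (f y) = j' (g (gup y)) by exact: projT2 (cid (fex y)).
have upB y z : gup (y - z) = gup y - gup z by apply/esym/gup_eq; rewrite !rmorphB !gupE.
have upM y z : gup (y * z) = gup y * gup z by apply/esym/gup_eq; rewrite !rmorphM !gupE.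
have fB y z : f (y - z) = f y - f z.
  by apply: (fmorph_inj j); rewrite [RHS]rmorphB !fE upB raddfB rmorphB.
have fM y z : f (y * z) = f y * f z.
  by apply: (fmorph_inj j); rewrite [RHS]rmorphM !fE upM rmorphM rmorphM.
have f1 y : y \in 1%VS -> f y = y.
  move=> y1; apply: (fmorph_inj j); rewrite fE gal_base ?gupE //.
  by apply/g_base; rewrite gupE; apply/g_base.
have flin : linear f.
  have fN v : f (- v) = - f v by rewrite -sub0r fB f1 ?mem0v // sub0r.
  have fD u v : f (u + v) = f u + f v by rewrite -{1}[v]opprK fB fN opprK.
  move=> a y z.
  by rewrite fD -mulr_algl fM f1 ?mulr_algl // rpredZ ?mem1v.
pose fl : {linear L -> L} := HB.pack f (GRing.isLinear.Build _ _ _ _ f flin).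
have : kAut 1 {:L} (linfun fl).
  rewrite kAutfE; apply/kHomP; split=> [y z _ _|y y1]; rewrite !lfunE /=; [exact: fM | exact: f1].
case/kAut_to_gal => h _ hE; exists h => y; rewrite -fE -hE ?memvf // lfunE //.
Qed.

Definition rst g := projT1 (cid (rst_ex g)).
Lemma rstE g y : j (rst g y) = j' (g (gup y)). Proof. exact: (projT2 (cid (rst_ex g)) y). Qed.

Lemma gup_rst g y : gup (rst g y) = g (gup y).
Proof. by apply/esym/gup_eq; rewrite rstE. Qed.

Lemma rstM g h : rst (g * h)%g = (rst g * rst h)%g.
Proof.
apply/eqP/gal_eqP => y _; apply: (fmorph_inj j).
by rewrite rstE !galM ?memvf // rstE gup_rst.
Qed.

Lemma rst_P g : g \in gP D' -> rst g \in gP D.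
Proof.
move=> gPg; apply/(iffRL (gP_P _)) => y y0; have y0' : gup y != 0.
  by rewrite -(fmorph_eq0 j') gupE fmorph_eq0.
by rewrite rmorphM fmorphV rstE -gupE -fmorphV -rmorphM; apply: gP_act_ou.
Qed.

(** An element of [L] fixed by all restrictions from [gP D'] is fixed by [gP D'], hence lies in
    [kr K]. So the fixed field of the image is contained in [gN D], and Galois theory reverses the
    inclusion. *)
Lemma rst_onto h : h \in gP D -> exists2 g, g \in gP D' & rst g = h.
Proof.
have grA : group_set (rst @: gP D').
  apply/group_setP; split.
    apply/imsetP; exists 1%g => //; apply/eqP/gal_eqP => y _.
    by apply: (fmorph_inj j); rewrite rstE !gal_id gupE.
  move=> _ _ /imsetP[g gPg ->] /imsetP[g' gPg' ->].
  by apply/imsetP; exists (g * g')%g; rewrite ?groupM ?rstM.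
have gal : galois (gN D') {:L'} by apply: galoisS (g_gal D'); rewrite sub1v subvf.
suff sub : gP D \subset Group grA by move=> /(subsetP sub)/imsetP[g gPg ->]; exists g.
rewrite -(gal_fixedField (Group grA)); apply: galS; apply/subvP => y /fixedFieldP-/(_ (memvf y)) yA.
apply/gNP; rewrite -gupE; apply/gNP; rewrite -(elimT galois_fixedField gal).
apply/fixedFieldP; first exact: memvf.
move=> g gPg; rewrite -gup_rst yA //; exact: imset_f.
Qed.

Fact ginc_O (a : gO D) : gup (val a) \in @Ovr V D'.
Proof. by apply/OvrP; rewrite gupE; apply: gO_O. Qed.
Definition ginc_fun (a : gO D) : gO D' := GO (ginc_O a).
Fact ginc_zmod : zmod_morphism ginc_fun.
Proof. by move=> a b; apply/val_inj/esym/gup_eq; rewrite /= !rmorphB !gupE. Qed.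
Fact ginc_monoid : monoid_morphism ginc_fun.
Proof. by split; [|move=> a b]; apply/val_inj/esym/gup_eq; rewrite /= ?rmorph1 ?rmorphM ?gupE. Qed.
Definition ginc : {rmorphism gO D -> gO D'} :=
  HB.pack ginc_fun (GRing.isZmodMorphism.Build _ _ ginc_fun ginc_zmod)
            (GRing.isMonoidMorphism.Build _ _ ginc_fun ginc_monoid).
Lemma ginc_phi a : gphi D' (ginc a) = gphi D a.
Proof. by rewrite !gphiE /= gupE. Qed.
Lemma ginc_act g a : ginc (gact (rst g) a) = gact g (ginc a).
Proof. by apply: val_inj; rewrite /= gup_rst. Qed.
End GaloisTower.

(** * Fields without purely wild extensions *)

(** At an integral root [b] the derivative [p b^(p-1) - 1] has residue -1, also in mixed
    characteristic, so [b] is a simple root. *)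
Lemma artin_schreier (V : hvf) (p : nat) (c : hOm V) (E : hOm V -> Prop) : p \in [pchar hk V] ->
  is_subfield E -> E c -> hO c -> exists b, [/\ b ^+ p - b = c, hO b & sep E b].
Proof.
move=> pk hE Ec Oc; have p_gt1 : (1 < p)%N by case/andP: pk => /prime_gt1.
pose f : {poly hOm V} := 'X^p - ('X + c%:P).
have sf : size ('X + c%:P) = 2%N by rewrite size_XaddC.
have szf : size f = p.+1 by rewrite size_polyDl ?size_polyN ?size_polyXn ?sf.
have mf : f \is monic.
  by rewrite monicE lead_coefDl ?size_polyN ?size_polyXn ?sf // lead_coefXn.
have fE (P : hOm V -> Prop) : P 0 -> P 1 -> (forall x y, P x -> P y -> P (x - y)) -> P c ->
    poly_over P f.
  move=> P0 P1 PB Pc i; have PD x y : P x -> P y -> P (x + y).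
    by move=> Px Py; rewrite -[y]opprK -[- y]sub0r; apply/PB/PB.
  by rewrite coefB coefXn coefD coefX coefC; apply: PB; [case: eqP | apply: PD; case: eqP].
have [|b fb] := closed_rootP f _; first by rewrite szf eqSS -lt0n ltnW.
have bE : b ^+ p - b = c.
  by move/rootP: fb; rewrite !hornerE => /eqP; rewrite opprD addrA subr_eq0 => /eqP.
have Ob : hO b by apply: O_integral fb => //; apply: fE => //; [apply: O0 | apply: O1 | apply: OB].
exists b; split=> //; apply: (sep_simple hE _ fb).
  by apply: fE => //; [apply: sf0 | apply: sf1 | apply: (sfB hE)].
rewrite /f derivB derivXn derivD derivX derivC addr0; apply/negP => /rootP.
rewrite hornerD hornerN hornerMn hornerXn hornerC => /(congr1 (@hres V)).
have Obp : hO (b ^+ p.-1) by apply: OX.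
have rp : hres (b ^+ p.-1 *+ p) = 0 by rewrite res_mulrn // -mulr_natr (pcharf0 pk) mulr0.
have Op : hO (b ^+ p.-1 *+ p).
  move: (b ^+ _) Obp {rp} => y Oy; elim: (p) => [|m IH]; first by rewrite mulr0n; apply: O0.
  by rewrite mulrS; apply: OD.
rewrite (resB Op (O1 V)) rp res0 res1 sub0r => /eqP.
by rewrite oppr_eq0 oner_eq0.
Qed.

Section Final.
Variable V : hvf.
Local Notation O := (@hO V).
Local Notation res := (@hres V).
Local Notation K := (@hK V).
Hypothesis nowild : forall M, finite_ext K M -> separable_ext K M -> pw K M -> Defs.subset M K.

(* If x is not in kr K, let L be its Galois closure, with ramification group P. The crossed
   homomorphism f with values in V = P/Phi(P), defined on the Galois group of some larger M, has a
   kernel H that together with the ramification group of M generates everything. So the fixed field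
   W of H meets kr K in K, is therefore purely wild, hence trivial; but f is onto V <> 0. *)
Lemma nowild_kr x : sep K x -> kr K x.
Proof.
move=> sx; apply: contrapT => nk; have kK := sfK_K V.
have [|D Dx] := @galois_closure V [:: x]; first by move=> y; rewrite inE => /eqP->.
have nt : gP D :!=: 1%g := gP_nontriv (Dx _ (mem_head _ _)) nk.
have [p pk pP] := gP_pgroup nt.
have [n [Vf [rho [n0 VM VJ rhoM Vs]]]] := frattini_module pP (gP_normal D) nt.
have [theta trth] := theta_ex D pk.
have [a ext] := crossed_ext pk (gP_normal D) (@gactM V D) (@gact_phi V D) (@gact_P V D)
  VM VJ rhoM Vs trth.
have bex i : exists b, [/\ b ^+ p - b = gj D (val (a 0 i)), O b & sep K b].
  have [|b [bE Ob sb]] := artin_schreier pk (rng_subfield D) _ (gO_O (a 0 i)).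
    by exists (val (a 0 i)).
  exists b; split=> //; apply: (sep_trans (sfK_sf kK) (rng_subfield D) (@g_K _ D) _ sb).
  exact: rng_sep.
pose b i := projT1 (cid (bex i)).
have bE i : [/\ b i ^+ p - b i = gj D (val (a 0 i)), O (b i) & sep K (b i)] := projT2 (cid (bex i)).
have [s sr gen] := gj_gen D.
have [|D' D's] := @galois_closure V (s ++ [seq b i | i : 'I_n]).
  move=> y; rewrite mem_cat => /orP[/sr/rng_sep //|/mapP[i _ ->]].
  by case: (bE i).
have DD' : Defs.subset (rng D) (rng D').
  apply: gen; [exact: rng_subfield | exact: g_K|].
  by move=> y ys; apply: D's; rewrite mem_cat ys.
have tex i : exists t : gO D', gj D' (val t) = b i.
  have [|y yE] := D's (b i); first by rewrite mem_cat map_f ?orbT ?mem_enum.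
  have Oy : y \in @Ovr V D' by apply/OvrP; rewrite yE; case: (bE i).
  by exists (GO Oy).
pose beta : 'rV[gO D']_n := \row_i projT1 (cid (tex i)).
have betaE i : beta 0 i ^+ p - beta 0 i = ginc DD' (a 0 i).
  apply: val_inj; apply: (fmorph_inj (gj D')).
  rewrite mxE; move: (projT1 _) (projT2 (cid (tex i))) => t tb.
  have -> : val (t ^+ p - t) = val t ^+ p - val t by rewrite rmorphB rmorphXn.
  by rewrite rmorphB rmorphXn tb [RHS]gupE; case: (bE i).
have [f [fM fP]] := ext _ _ (@gact V D') (gphi D') (rst DD') (ginc DD') beta
   (@gactM V D') (@gact_phi V D') (rstM DD') (@ginc_act V D D' DD') (ginc_phi DD') betaE.
have fP' g : g \in gP D' -> f g = Vf (rst DD' g).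
  by move=> gPg; apply: fP; [apply: rst_P | move=> y; apply: gact_P].
have r1 : rst DD' 1%g = 1%g.
  by apply: (mulgI (rst DD' 1%g)); rewrite -rstM !mulg1.
have rhoP' g : g \in gP D -> rho g = 1%:M := rhoP VM VJ Vs (x := g).
have f1 : f 1%g = 0.
  by apply: (addrI (f 1%g)); rewrite addr0 -[in RHS](mulg1 1%g) fM r1 rhoP' // mulmx1.
have grH : group_set [set g | f g == 0].
  apply/group_setP; split; first by rewrite inE f1.
  by move=> g h; rewrite !inE fM => /eqP-> /eqP->; rewrite mul0mx addr0.
pose H := Group grH.
(* [f] restricted to the ramification group is already onto, and [rho] is trivial on its
   restrictions to [L], so a factor [z] from it can cancel the value [f g]. *)
have HP g : exists2 z, z \in gP D' & (g * z)%g \in H.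
  have [y yP yE] := Vs (- f g); have [z zP zE] := rst_onto DD' yP; exists z => //.
  by rewrite inE fM zE rhoP' // mulmx1 (fP' z zP) zE yE subrr.
pose W w := exists2 y, y \in fixedField H & gj D' y = w.
have hW : is_subfield W.
  split.
  - by exists 0; rewrite ?rmorph0 ?mem0v.
  - by exists 1; rewrite ?rmorph1 ?mem1v.
  - by move=> _ _ [y yH <-] [z zH <-]; exists (y - z); rewrite ?rmorphB ?memvB.
  - by move=> _ _ [y yH <-] [z zH <-]; exists (y * z); rewrite ?rmorphM ?rpredM.
  - by move=> _ [y yH <-] _; exists y^-1; rewrite ?fmorphV ?rpredV.
have KW : Defs.subset K W.
  move=> w Kw; have [y yw] := g_K D' Kw; exists y => //.
  apply/fixedFieldP => [|g _]; first exact: memvf.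
  by apply: gal_base; apply/g_base; rewrite yw.
have Wr : Defs.subset W (rng D') by move=> w [y _ <-]; exists y.
have noT w : W w -> telt K w -> K w.
  move=> [y yH <-] ty; have kw : kr K (gj D' y).
    by apply: kr_telt => //; apply: teltS ty; apply: kr_base.
  apply/g_base; rewrite -(elimT galois_fixedField (g_gal D')); apply/fixedFieldP => [|g _].
    exact: memvf.
  have [z zP gzH] := HP g; have zy : z y = y.
    by apply: (fixed_gal (subvf _) zP); apply/gNP.
  have := elimT (fixedFieldP (memvf y)) yH _ gzH; rewrite galM ?memvf // => zgy.
  by apply: (fmorph_inj z); exact: (etrans zgy (esym zy)).
have pwW := pw_lemma kK (sfK_sub kK hW KW) KW noT.
have [fW _] := finite_ext_sub hW KW Wr (rng_finite D').
have sW : separable_ext K W.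
  by split=> //; [exact: (sfK_sf kK) | move=> w /Wr/rng_sep].
have WK := nowild fW sW pwW.
have HT g : g \in H.
  rewrite -(gal_fixedField H) gal_kHom ?subvf //; apply/kAHomP => y yH.
  by apply: gal_base; apply/g_base; apply: WK; exists y.
have [v v0] : exists v : 'rV['F_p]_n, v != 0.
  exists (delta_mx 0 (Ordinal n0)); apply/eqP => /rowP/(_ (Ordinal n0)).
  by rewrite !mxE !eqxx => /eqP; rewrite oner_eq0.
have [y yP yE] := Vs v; have [z zP zE] := rst_onto DD' yP.
have := HT z; by rewrite inE fP' // zE yE (negPf v0).
Qed.

Lemma nowild_sep_defectless : sep_defectless_field O res K.
Proof.
move=> F fF [_ _ _ sF]; have kK := sfK_K V.
have [] // := kr_finite kK fF; by move=> x /sF; apply: nowild_kr.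
Qed.
End Final.

(** Unions are required only for nonempty chains, as the empty union need not be good; the empty
    chain is bounded by [P0]. *)
Lemma zorn_pred (L : fieldType) (good : (L -> Prop) -> Prop) (P0 : L -> Prop) : good P0 ->
  (forall F : (L -> Prop) -> Prop, (exists P, F P) -> (forall P, F P -> good P) ->
     (forall P Q, F P -> F Q -> Defs.subset P Q \/ Defs.subset Q P) ->
     good (fun x => exists2 P, F P & P x)) ->
  exists2 W, good W & forall W', good W' -> Defs.subset W W' -> Defs.subset W' W.
Proof.
move=> g0 gU; pose T := {P | good P}.
pose R (s t : T) := `[< Defs.subset (sval s) (sval t) >].
have [||A tot|[W gW] max] := @classical_sets.ZL_preorder T (exist _ P0 g0) R.
- by move=> t; apply/asboolP.
- by move=> r s t /asboolP rs /asboolP st; apply/asboolP => x /rs /st.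
- have [[t0 At0]|nA] := pselect (exists t, A t); last first.
    by exists (exist _ P0 g0) => s As; case: nA; exists s.
  pose F P := exists2 t, A t & sval t = P.
  have gF : good (fun x => exists2 P, F P & P x).
    apply: gU => [|P [t _ <-]|P Q [s As <-] [t At <-]].
    - by exists (sval t0), t0.
    - exact: svalP.
    - by case: (tot s t As At) => /asboolP; [left | right].
  exists (exist _ _ gF) => s As; apply/asboolP => x sx.
  by exists (sval s) => //; exists s.
exists W => // W' gW' WW'; apply/asboolP.
by have := max (exist _ W' gW'); apply; apply/asboolP.
Qed.

(** * Change of base, tame transfer and maximal purely wild extensions *)

Section Assembly.
Variable V : hvf.
Local Notation Om := (hOm V).
Local Notation O := (@hO V).
Local Notation kappa := (hk V).
Local Notation res := (@hres V).
Local Notation K := (@hK V).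
Local Notation U := (unitO O).
Local Notation rf := (resf O res).
Local Notation scl := (same_class O).
Local Notation ppow := ([pchar kappa].-nat).
Implicit Types (E F M N T W : Om -> Prop) (x y z a b : Om) (I J B C D : finType).
Implicit Types (f g p : {poly Om}) (q : nat).

Lemma henselian_ext E : sfK E -> henselian O E.
Proof.
move=> [hE KE] L R [_ hL EL La] RL EO; apply: (@hK_hens V) => //.
  have [hK _ _ Ka] := hK_alg V; split=> // [x /KE /EL //|x _]; exact: Ka.
by move=> x /KE; apply: EO.
Qed.

Lemma algebraic_all E : sfK E -> algebraic_ext E (fun _ : Om => True).
Proof. by move=> kE; split=> // [|x _]; [apply: sfK_sf | apply: alg_all]. Qed.

(** Results about the base field of an [hvf] become available over any intermediate field, in
    particular over a maximal purely wild extension. *)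
Definition rebase E (kE : sfK E) : hvf :=
  Hvf (hO_val V) (hres_map V) (algebraic_all kE) (henselian_ext kE).

Lemma tame_descent N : tame_ext O res K N -> defectless_field O res N ->
  defectless_field O res K.
Proof.
move=> [[hK hN KN _] tN] dN F fF; have kN : sfK N by split.
apply: (descent (sfK_K V) kN KN _ fF) => [M fM MN|F' fF' _]; last exact: dN.
by have [] := tN M fM MN.
Qed.

Lemma tame_descent_sep N : tame_ext O res K N -> sep_defectless_field O res N ->
  sep_defectless_field O res K.
Proof.
move=> [[hK hN KN _] tN] dN F fF sF; have kN : sfK N by split.
apply: (descent (sfK_K V) kN KN _ fF) => [M fM MN|F' fF' s]; last by apply: dN => //; apply: s.
by have [] := tN M fM MN.
Qed.

(** Since [kr N = kr K], the field [kr K] is tame over [N] as well, and [descent] leads from it down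
    to [N]. The clause on separability lets one proof serve both versions of the theorem. *)
Lemma tame_up N F : tame_ext O res K N -> finite_ext N F ->
  (forall F', finite_ext (kr K) F' -> (separable_ext N F -> separable_ext (kr K) F') ->
     defectless_fin O res (kr K) F') ->
  defectless_fin O res N F.
Proof.
move=> tN fF dk; have [[hK hN KN _] _] := tN; have kN : sfK N by split.
have e : kr N = kr K by apply: kr_idem => //; [exact: sfK_K | apply: tame_kr (sfK_K V) tN].
rewrite -e in dk; apply: (descent kN (kr_sfK kN) (kr_base (E := N)) _ fF dk) => M fM MN.
by have [] := kr_finite kN fM MN.
Qed.

Lemma tame_up_field N : tame_ext O res K N -> defectless_field O res K ->
  defectless_field O res N.
Proof.
move=> tN dK F fF; apply: (tame_up tN fF) => F' fF' _.
by apply: (kr_defectless (sfK_K V) fF') => F0 fF0 _; apply: dK.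
Qed.

Lemma tame_up_field_sep N : tame_ext O res K N -> sep_defectless_field O res K ->
  sep_defectless_field O res N.
Proof.
move=> tN dK F fF sF; apply: (tame_up tN fF) => F' fF' sF'.
by apply: (kr_defectless (sfK_K V) fF') => F0 fF0 s; apply: dK => //; apply/s/sF'.
Qed.

Lemma tame_Kr : tame_ext O res K (Kr O res K).
Proof. by rewrite (Kr_kr (sfK_K V)); apply: kr_tame; apply: sfK_K. Qed.

Lemma tame_K : tame_ext O res K K.
Proof. by apply: tfin_tame; apply: tfin_refl; apply: sfK_sf (sfK_K V). Qed.

Lemma pw_union (F : (Om -> Prop) -> Prop) : (exists P, F P) ->
  (forall P, F P -> sfK P /\ pw K P) ->
  (forall P Q, F P -> F Q -> Defs.subset P Q \/ Defs.subset Q P) ->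
  sfK (fun x => exists2 P, F P & P x) /\ pw K (fun x => exists2 P, F P & P x).
Proof.
move=> [P0 FP0] FG tot; have kK := sfK_K V.
have com P Q x y : F P -> F Q -> P x -> Q y -> exists R, [/\ F R, R x & R y].
  by move=> FP FQ Px Qy; case: (tot P Q FP FQ) => s; [exists Q | exists P]; split=> //; apply: s.
have KP : Defs.subset K (fun x => exists2 P, F P & P x).
  by move=> x Kx; exists P0 => //; have [[_ h] _] := FG _ FP0; apply: h.
split; last by move=> x [P FP Px]; have [_ h] := FG _ FP; apply: h.
split=> //; apply: (ring_subfield (sfK_sf kK)) => //.
- move=> x y [P FP Px] [Q FQ Qy]; have [R [FR Rx Ry]] := com P Q x y FP FQ Px Qy.
  by exists R => //; apply: sfB => //; have [[]] := FG _ FR.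
- move=> x y [P FP Px] [Q FQ Qy]; have [R [FR Rx Ry]] := com P Q x y FP FQ Px Qy.
  by exists R => //; apply: sfM => //; have [[]] := FG _ FR.
- by move=> x _; apply: alg_all.
Qed.

Lemma pw_refl E : is_subfield E -> pw E E.
Proof.
move=> hE x Ex x0; exists 1%N, x; split=> //; rewrite expr1 divff //; exact: ou1.
Qed.

Lemma wild_sub W M : purely_wild_ext O res K W -> is_subfield M -> Defs.subset K M ->
  Defs.subset M W -> purely_wild_ext O res K M.
Proof.
move=> [[hK hW KW aW] dW] hM KM MW; split; first by split=> // x /MW /aW.
by move=> T tT s sM; apply: dW => // x /sM /MW.
Qed.

(** Zorn's lemma is applied to [pw], which passes to unions of chains. As [pw] is transitive, a
    finite purely wild extension of [W] is purely wild over [K] and is absorbed by maximality. *)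
Lemma max_wild_ex : exists2 W, max_purely_wild_ext O res K W &
  [/\ sfK W, pw K W & forall M, finite_ext W M -> pw W M -> Defs.subset M W].
Proof.
have kK := sfK_K V.
have [||W [kW pW] Wmax] := @zorn_pred Om (fun W => sfK W /\ pw K W) K.
- by split=> //; apply: pw_refl; apply: sfK_sf.
- exact: pw_union.
have [hW KW] := kW; exists W; first split.
- exact: pw_wild.
- move=> W' wW'; apply: Wmax; split; last exact: wild_pw.
  by have [[_ hW' KW' _] _] := wW'; split.
split=> // M [_ hM WM _] pM; apply: Wmax => //; split; last exact: pw_trans pM.
exact: sfK_sub kW hM WM.
Qed.

Lemma max_sep_wild_ex : exists2 W, max_sep_purely_wild_ext O res K W &
  [/\ sfK W, pw K W & forall M, finite_ext W M -> separable_ext W M -> pw W M -> Defs.subset M W].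
Proof.
have kK := sfK_K V.
have [||W [[kW pW] sW] Wmax] := @zorn_pred Om (fun W => (sfK W /\ pw K W) /\ forall x, W x -> sep K x) K.
- split; first by split=> //; apply: pw_refl; apply: sfK_sf.
  by move=> x; apply: sep_base; apply: sfK_sf.
- move=> F exF FG tot; split; first by apply: pw_union => // P /FG[].
  by move=> x [P /FG[_ h] /h].
have [hW KW] := kW; have hK := sfK_sf kK; exists W; first split.
- by split; [exact: pw_wild | split].
- move=> W' wW' [_ hW' KW' sW']; apply: Wmax; split=> //; split; first by split.
  exact: wild_pw.
split=> // M [_ hM WM _] [_ _ _ sM] pM; apply: Wmax => //; split.
  split; last exact: pw_trans pM.
  exact: sfK_sub kW hM WM.
by move=> x /sM; apply: sep_trans.
Qed.
End Assembly.

(** For [q] a power of the characteristic exponent, a [q]-th root of an element of [K] generates an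
    extension whose elements all have their [q]-th power in [K]; it is purely wild, hence trivial.
    So the minimal polynomial [h] of a separable [x ^+ q] has [q]-th powers of elements of [K] as
    coefficients. The polynomial [p] formed by their roots satisfies [p(x)^q = h(x^q)], likewise for
    the derivatives, so [x] is a simple root of [p]. *)
Lemma nowild_perfect (V : hvf) :
  (forall M, finite_ext (@hK V) M -> pw (@hK V) M -> Defs.subset M (@hK V)) ->
  forall x, sep (@hK V) x.
Proof.
move=> nw x; have kK := sfK_K V; have hS := sfK_sf kK.
have pq q : [pchar hOm V].-nat q -> [pchar hk V].-nat q.
  apply: sub_in_pnat => r _; rewrite !inE => /andP[-> /eqP r0] /=.
  by rewrite -res_nat r0 res0.
have root_in q (r : hOm V) : [pchar hOm V].-nat q -> hK (r ^+ q) -> hK r.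
  move=> qp Kr; have fr := adj_finite hS (alg_all r kK).
  apply: (nw _ fr _ r (adj_mem r hS)) => z [p Kp ->] z0.
  have Kz : hK (p.[r] ^+ q).
    rewrite horner_coef pchar_sum_exp //; apply: (sf_sum hS) => i _.
    rewrite exprMn -exprM mulnC exprM; apply: sfM => //; apply: sfX => //.
  exists q, (p.[r] ^+ q); split=> //; [exact: pq | by rewrite expf_neq0 |].
  by rewrite divff ?expf_neq0 //; apply: ou1.
have [q qp sq] := sep_exponent hS (alg_all x kK).
have q0 : (0 < q)%N by case/andP: qp.
have [h mh] := minpoly_ex hS (sep_alg sq); have h' := sep_minpoly mh sq.
have [_ Kh hx _] := mh.
have /choice[k kP] i : exists k, hK k /\ k ^+ q = h`_i.
  have [k kE] : exists k, root ('X^q - (h`_i)%:P) k.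
    by apply/closed_rootP; rewrite size_XnsubC // eqSS -lt0n.
  move: kE; rewrite rootE !hornerE subr_eq0 => /eqP kE; exists k; split=> //.
  by apply: (root_in q) => //; rewrite kE.
pose p := \poly_(i < size h) k i.
have natX i : (i%:R : hOm V) ^+ q = i%:R.
  by rewrite -[i in LHS]card_ord -sumr_const pchar_sum_exp // expr1n sumr_const card_ord.
have pX : p.[x] ^+ q = h.[x ^+ q].
  rewrite horner_poly pchar_sum_exp // horner_coef; apply: eq_bigr => i _.
  by rewrite exprMn; case: (kP i) => _ ->; rewrite -!exprM mulnC.
have p'X : p^`().[x] ^+ q = h^`().[x ^+ q].
  have s1 (f : {poly hOm V}) : (size f <= size h)%N -> (size f^`() <= size h)%N.
    by move=> sf; rewrite (leq_trans (size_poly _ _)) // (leq_trans _ sf) // leq_pred.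
  rewrite (horner_coef_wide _ (s1 _ (size_poly _ _))) (horner_coef_wide _ (s1 _ (leqnn _))).
  rewrite pchar_sum_exp //; apply: eq_bigr => i _.
  rewrite exprMn -!exprM [(q * i)%N]mulnC; congr (_ * _).
  rewrite !coef_deriv -mulr_natr exprMn natX mulr_natr coef_poly; case: ltnP => [_|le].
    by case: (kP i.+1) => _ ->.
  by rewrite expr0n eqn0Ngt q0 nth_default.
apply: (sep_simple hS (p := p)).
- by apply: po_poly => // i _; case: (kP i).
- by have := hx; rewrite !rootE -pX expf_eq0 => /andP[].
- by move: h'; rewrite !rootE -p'X expf_eq0 q0.
Qed.

Section Final.
Variable V : hvf.
Local Notation Om := (hOm V).
Local Notation O := (@hO V).
Local Notation res := (@hres V).
Local Notation K := (@hK V).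

Lemma max_wild_defectless :
  (forall W, max_purely_wild_ext O res K W -> defectless_ext O res K W) ->
  defectless_field O res K.
Proof.
move=> dW F fF; have [W mW [kW pW nW]] := max_wild_ex V.
have [_ dKW] := dW W mW; have [hW KW] := kW.
apply: (descent (sfK_K V) kW KW dKW fF) => F' fF' _.
have perf := @nowild_perfect (rebase kW) nW.
apply: (@nowild_sep_defectless (rebase kW)) => // [M fM sM pM|]; first exact: nW.
by have [_ hF' WF' _] := fF'; split=> // x _; exact: perf.
Qed.

Lemma max_sep_wild_defectless :
  (forall W, max_sep_purely_wild_ext O res K W -> defectless_ext O res K W) ->
  sep_defectless_field O res K.
Proof.
move=> dW F fF sF; have [W mW [kW pW nW]] := max_sep_wild_ex V.
have [_ dKW] := dW W mW; have [hW KW] := kW.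
apply: (descent (sfK_K V) kW KW dKW fF) => F' fF' sF'.
by apply: (@nowild_sep_defectless (rebase kW)) => //; apply: sF'.
Qed.
End Final.

Theorem theorem2p22 (Om : closedFieldType) (O : Om -> Prop)
  (kappa : fieldType) (res : Om -> kappa) (K : Om -> Prop) :
  is_valuation_ring (fun _ => True) O ->
  is_residue_map O res ->
  algebraic_ext K (fun _ => True) ->
  henselian O K ->
  [<-> defectless_field O res K;
       exists N, tame_ext O res K N /\ defectless_field O res N;
       forall N, tame_ext O res K N -> defectless_field O res N;
       defectless_field O res (Kr O res K);
       forall W, purely_wild_ext O res K W -> finite_ext K W ->
         defectless_fin O res K W;
       forall W, max_purely_wild_ext O res K W -> defectless_ext O res K W]
  /\
  [<-> sep_defectless_field O res K;
       exists N, tame_ext O res K N /\ sep_defectless_field O res N;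
       forall N, tame_ext O res K N -> sep_defectless_field O res N;
       sep_defectless_field O res (Kr O res K);
       forall W, purely_wild_ext O res K W -> separable_ext K W ->
         finite_ext K W -> defectless_fin O res K W;
       forall W, max_sep_purely_wild_ext O res K W -> defectless_ext O res K W].
Proof.
move=> hO hr aK hK; pose V := Hvf hO hr aK hK; split; tfae.
- by move=> d; exists K; split=> //; exact: (tame_K V).
- by move=> [N [tN dN]] N' tN'; apply: (tame_up_field (V := V) tN') => //;
  exact: (tame_descent (V := V) tN dN).
- by apply; exact: (tame_Kr V).
- by move=> d W _ fW; apply: (tame_descent (tame_Kr V) d).
- move=> d W [wW _]; split=> [|M fM MW]; first by case: wW.
  by apply: d => //; have [_ hM KM _] := fM; exact: (wild_sub (V := V) wW hM KM MW).
- exact: (max_wild_defectless (V := V)).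
- by move=> d; exists K; split=> //; exact: (tame_K V).
- by move=> [N [tN dN]] N' tN'; apply: (tame_up_field_sep (V := V) tN') => //;
  exact: (tame_descent_sep (V := V) tN dN).
- by apply; exact: (tame_Kr V).
- by move=> d W _ sW fW; apply: (tame_descent_sep (tame_Kr V) d).
- move=> d W [[wW sW] _]; split=> [|M fM MW]; first by case: wW.
  have [sK hM KM _] := fM; apply: d => //; first exact: (wild_sub (V := V) wW hM KM MW).
  by have [_ _ _ s] := sW; split=> // x /MW /s.
- exact: (max_sep_wild_defectless (V := V)).
Qed.
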